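(* Let $n$ be a positive integer. Let $X_n$ be the space of isometry classes of cycles of length $1$ with $n$ marks on vertices, let $Y_n\subseteq X_n$ be the subspace of those classes for which the point $(1,0)$ is a vertex and all other vertices are marked, and let $\Phi:X_n\times[-1,1]\to X_n$ be the scanning map (all as defined in the context). Then the map $\Phi$ provides a deformation retraction from $X_n$ to $Y_n$. In particular, the space $X_n$ is homotopy equivalent to $Y_n$, and hence the moduli space $MG_{1,n}^{\mathfrak{v}}$ of metric graphs of genus $1$ with $n$ marks on vertices is homotopy equivalent to the moduli space $TM_{1,n}$ of tropical curves of genus $1$ with $n$ marked points.
   Context: **Metric graphs with marks on vertices.** A metric graph is a finite undirected graph (loops and multiple edges allowed) together with a positive real length for each edge. It has $n$ marks on vertices if each label in $[n]=\{1,\dots,n\}$ is assigned to a vertex; a vertex may carry several labels or none. The set of labels of a vertex is its list of marks. A vertex is called marked if its list is nonempty, and unmarked otherwise. An isometry of such graphs is an isomorphism of the underlying graphs which preserves edge lengths and the marks. $[G]$ denotes the isometry class of $G$. The genus of a connected graph is its first Betti number. **The space $MG_{1,n}^{\mathfrak{v}}$.** This is the set of isometry classes of connected metric graphs of genus $1$ with $n$ marks on vertices, with the topology in which the points of a small open neighborhood of $[G]$ are the classes $[H]$ of graphs obtained from $G$ by a combination of: changing the lengths of the edges of $G$ by a small number; expanding vertices of $G$ into trees with all edges sufficiently short; and distributing the marks of each expanded vertex arbitrarily on the vertices of the tree replacing it. Explicitly: for $\varepsilon>0$ let $N_\varepsilon([G])$ be the set of all $[H]$ such that $H$ contains a (possibly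 empty) forest, each component tree of which has total length less than $\varepsilon$, such that contracting each component of the forest to a vertex (and uniting the lists of marks of the merged vertices) gives a graph that is isomorphic to $G$ as a marked graph via an isomorphism under which the lengths of corresponding edges differ by less than $\varepsilon$. A set $U$ is open iff for every $[G]\in U$ there is $\varepsilon>0$ with $N_\varepsilon([G])\subseteq U$. **The space $TM_{1,n}$.** This is the subspace of $MG_{1,n}^{\mathfrak{v}}$ consisting of the classes whose representatives satisfy: for every vertex, the sum of its valency (a loop contributing $2$) and the number of its marks is at least $3$. **The space $X_n$.** The points of $X_n$ are the isometry classes of cycles of total length $1$ (with finitely many vertices, possibly only one) with $n$ marks on vertices; unmarked vertices are allowed. After rescaling, each such cycle is identified with the unit circle $\{(x,y)\in\mathbb{R}^2 : x^2+y^2=1\}$ so that the vertex whose list of marks includes $1$ is located at $(-1,0)$. The other vertices (marked or not) are placed arbitrarily on the circle, and two such configurations represent the same point of $X_n$ iff they are equal or differ by the reflection in the $x$-axis. Two points $a=(a_1,a_2)$ and $b=(b_1,b_2)$ on the unit circle are called $\varepsilon$-close if the shortest path connecting $a$ and $b$ along the circle does not leave the vertical strip $\{(x,y) : a_1-\varepsilon<x<a_1+\varepsilon\}$. For $x\in X_n$ with representative graph $G$ and $\varepsilon>0$, the neighborhood $N_\varepsilon(x)$ consists of all $y\in X_n$ which have a representative graph $H$ such that: (1) for every mark $k\in[n]$, the vertices of $G$ and of $H$ labelled with $k$ are $\varepsilon$-close; (2) every vertex of $H$ is $\varepsilon$-close to some vertex of $G$; (3) every vertex of $G$ is $\varepsilon$-close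 to some vertex of $H$. A subset $U\subseteq X_n$ is open iff for every $x\in U$ there exists $\varepsilon>0$ with $N_\varepsilon(x)\subseteq U$. **The subspace $Y_n$.** This is the subspace of $X_n$ of all points whose representative graph satisfies: the point $(1,0)$ is a vertex (which might be marked), and all other vertices of the graph are marked. **The map $\Phi:X_n\times[-1,1]\to X_n$.** Let $x\in X_n$ be represented by $G$ (identified, after rescaling, with the unit circle in $\mathbb{R}^2$ so that the vertex whose list of marks includes $1$ is located at $(-1,0)$) and let $t\in[-1,1]$. Set $\Phi(x,t):=[H]$, where $H$ is the cycle on the unit circle such that: the marked vertices of $H$ (with their marks) are the same as those of $G$; the points $(t,\sqrt{1-t^2})$ and $(t,-\sqrt{1-t^2})$ are vertices of $H$ (marked or not); there are no unmarked vertices $(a,b)$ of $H$ with $a<t$; and the unmarked vertices $(a,b)$ of $H$ with $a>t$ are the same as those of $G$. This does not depend on the choice of the representative $G$. **Deformation retraction.** That $\Phi$ provides a deformation retraction from $X_n$ to $Y_n$ means that $\Phi$ is continuous, $\Phi(x,-1)=x$ for all $x\in X_n$, $\Phi(x,1)\in Y_n$ for all $x\in X_n$, and $\Phi(y,1)=y$ for all $y\in Y_n$. It is not required that $\Phi(y,t)=y$ for $y\in Y_n$ and $-1<t<1$ (i.e., it need not be a strong deformation retraction). *)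

(* Defs.v *)
From HB Require Import structures.
From mathcomp Require Import all_boot all_order all_algebra.
From mathcomp Require Import all_classical all_reals all_analysis.

Set Implicit Arguments.
Unset Strict Implicit.
Unset Printing Implicit Defensive.

Import Order.TTheory GRing.Theory Num.Theory.
Import numFieldNormedType.Exports.

Local Open Scope ring_scope.
Local Open Scope quotient_scope.

Section graphs.
Context {R : realType} {n : nat}.

(* The orientation of an edge given by the pair [ends e] carries no meaning.
   The label k of {1, ..., n} is the ordinal of value k - 1. *)
Record mgraph (V E : finType) := MGraph {
  ends : E -> V * V;
  len : E -> R;
  len_gt0 : forall e, 0 < len e;
  mark : 'I_n -> V }.

Section one_graph.
Context {V E : finType} (G : mgraph V E).

Definition joins (e : E) (u v : V) : bool :=
  (ends G e == (u, v)) || (ends G e == (v, u)).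

Definition adj (F : {set E}) (u v : V) : bool :=
  [exists e in F, joins e u v].

Definition connected_graph : Prop :=
  forall u v, connect (adj [set: E]) u v.

Definition boundary : 'M[rat]_(#|E|, #|V|) :=
  \matrix_(i, j) ((enum_val j == (ends G (enum_val i)).2)%:R
                - (enum_val j == (ends G (enum_val i)).1)%:R).

(* A graph has no 2-cells: its first homology is the kernel of the boundary. *)
Definition betti1 : nat := \rank (kermx boundary).

(* k = 0 is a loop, k = 1 is a pair of parallel edges. *)
Definition has_cycle (F : {set E}) : Prop :=
  exists (k : nat) (v : 'I_k.+1 -> V) (e : 'I_k.+1 -> E),
    [/\ injective v, injective e &
        forall i, e i \in F /\ joins (e i) (v i) (v (ordS i))].

Definition forest (F : {set E}) : Prop := ~ has_cycle F.

Definition component (F : {set E}) (v : V) : {set V} :=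
  [set w | connect (adj F) v w].

Definition component_length (F : {set E}) (v : V) : R :=
  \sum_(e in F | (ends G e).1 \in component F v) len G e.

Definition valency (v : V) : nat :=
  (\sum_(e : E) (((ends G e).1 == v) + ((ends G e).2 == v)))%N.

Definition nmarks (v : V) : nat := #|[set k | mark G k == v]|.

Section contraction.
Variable F : {set E}.

Definition contract_vertex : finType :=
  {C : {set V} | C \in [set component F v | v in V]}.

Definition contract_edge : finType := {e : E | e \notin F}.

Definition to_contract (v : V) : contract_vertex :=
  exist _ (component F v) (imset_f (component F) (erefl true : v \in V)).

Definition contract : mgraph contract_vertex contract_edge :=
  MGraph
    (fun e => (to_contract (ends G (val e)).1, to_contract (ends G (val e)).2))
    (fun e => len_gt0 G (val e))
    (fun k => to_contract (mark G k)).

End contraction.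
End one_graph.

(* Isomorphism of marked graphs under which the lengths of corresponding edges
   satisfy P. *)
Definition graph_iso (P : R -> R -> Prop) (V E V' E' : finType)
    (G : mgraph V E) (H : mgraph V' E') : Prop :=
  exists (f : V -> V') (g : E -> E'),
    [/\ bijective f, bijective g,
        forall e, joins H (g e) (f (ends G e).1) (f (ends G e).2),
        forall e, P (len G e) (len H (g e)) &
        forall k, mark H k = f (mark G k)].

Definition isometric (V E V' E' : finType)
    (G : mgraph V E) (H : mgraph V' E') : Prop := graph_iso eq G H.

Definition almost_isometric (eps : R) (V E V' E' : finType)
    (G : mgraph V E) (H : mgraph V' E') : Prop :=
  graph_iso (fun a b => `|a - b| < eps) G H.

Definition close_expansion (eps : R) (V E V' E' : finType)
    (G : mgraph V E) (H : mgraph V' E') : Prop :=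
  exists F : {set E'},
    [/\ forest H F, forall v, component_length H F v < eps &
        almost_isometric eps (contract H F) G].

(* Vertex and edge sets are ordinals, so that isometry classes form a type;
   every finite graph is isometric to one of this form. *)
Record genus1_graph := Genus1Graph {
  nverts : nat;
  nedges : nat;
  graph_of :> mgraph 'I_nverts 'I_nedges;
  genus1_connected : connected_graph graph_of;
  genus1_betti : betti1 graph_of = 1%N }.

HB.instance Definition _ := gen_eqMixin genus1_graph.
HB.instance Definition _ := gen_choiceMixin genus1_graph.

Definition isometricb (G H : genus1_graph) : bool := `[< isometric G H >].

Lemma joinsC (V E : finType) (G : mgraph V E) e u v :
  joins G e u v = joins G e v u.
Proof. by rewrite /joins orbC. Qed.

Lemma joins_ends (V E : finType) (G : mgraph V E) e u v :
  joins G e u v -> (ends G e = (u, v)) \/ (ends G e = (v, u)).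
Proof. by case/orP=> /eqP; [left | right]. Qed.

Lemma isometricb_refl : reflexive isometricb.
Proof.
move=> G; apply/asboolP; exists id, id; split=> //.
- by exists id.
- by exists id.
- by move=> e; rewrite /joins -surjective_pairing eqxx.
Qed.

Lemma isometricb_trans : transitive isometricb.
Proof.
move=> H G K /asboolP[f [g [bf bg j l m]]] /asboolP[f' [g' [bf' bg' j' l' m']]].
apply/asboolP; exists (f' \o f), (g' \o g); split=> /=.
- exact: bij_comp.
- exact: bij_comp.
- move=> e; have /joins_ends[] := j e; have := j' (g e) => + E; rewrite E //=.
  by rewrite joinsC.
- by move=> e; rewrite l l'.
- by move=> k; rewrite m' m.
Qed.

Lemma isometricb_sym : symmetric isometricb.
Proof.
suff sub G H : isometricb G H -> isometricb H G.
  by move=> G H; apply/idP/idP; exact: sub.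
move=> /asboolP[f [g [[f' fK f'K] [g' gK g'K] j l m]]].
apply/asboolP; exists f', g'; split.
- by exists f.
- by exists g.
- move=> e; have /joins_ends[] := j (g' e); rewrite g'K => -> /=; rewrite !fK.
    by rewrite /joins -surjective_pairing eqxx.
  by rewrite joinsC /joins -surjective_pairing eqxx.
- by move=> e; rewrite l g'K.
- by move=> k; rewrite m fK.
Qed.

Canonical isometry_rel :=
  EquivRel isometricb isometricb_refl isometricb_sym isometricb_trans.

End graphs.
Arguments mgraph : clear implicits.
Arguments genus1_graph : clear implicits.
Arguments isometry_rel : clear implicits.

Local Open Scope classical_set_scope.

Section homotopy.
Context {R : realType}.

Definition homotopic (T U : topologicalType) (f g : T -> U) : Prop :=
  exists H : T * `[0 : R, 1]%classic -> U,
    [/\ continuous H,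
        forall x s, set_val s = 0 -> H (x, s) = f x &
        forall x s, set_val s = 1 -> H (x, s) = g x].

Definition homotopy_equivalent (T U : topologicalType) : Prop :=
  exists (f : T -> U) (g : U -> T),
    [/\ continuous f, continuous g,
        homotopic (g \o f) id & homotopic (f \o g) id].

(* The homotopy parameter runs over [-1, 1]. The retraction is not required to
   be strong: points of Y may move at intermediate times. *)
Definition deformation_retraction (T : topologicalType) (Y : set T)
    (F : T * `[-1 : R, 1]%classic -> T) : Prop :=
  [/\ continuous F,
      forall x t, set_val t = -1 -> F (x, t) = x,
      forall x t, set_val t = 1 -> Y (F (x, t)) &
      forall y t, set_val t = 1 -> Y y -> F (y, t) = y].

End homotopy.
Arguments homotopic R {T U} f g.
Arguments homotopy_equivalent R T U : clear implicits.

Section moduli.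
Variables (R : realType) (n : nat).

Definition MG : Type := {eq_quot (isometry_rel R n)}.
HB.instance Definition _ := Choice.on MG.
HB.instance Definition _ := EqQuotient.on MG.

Definition MG_near (x : MG) (eps : R) : set MG :=
  [set y | exists G H : genus1_graph R n,
     [/\ x = \pi_MG G, y = \pi_MG H & close_expansion eps G H]].

Definition MG_open (U : set MG) : Prop :=
  forall x, U x -> exists2 eps, 0 < eps & MG_near x eps `<=` U.

Lemma MG_nearS x (d e : R) : d <= e -> MG_near x d `<=` MG_near x e.
Proof.
move=> de y [G [H [-> -> [F [fF lF [f [g [bf bg j l m]]]]]]]].
exists G, H; split=> //; exists F; split=> //.
  by move=> v; exact: lt_le_trans (lF v) de.
by exists f, g; split=> // a; exact: lt_le_trans (l a) de.
Qed.

Lemma MG_openT : MG_open setT.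
Proof. by move=> x _; exists 1. Qed.

Lemma MG_openI : setI_closed MG_open.
Proof.
move=> A B oA oB x [/oA[d d0 dA] /oB[e e0 eB]].
exists (Num.min d e); first by rewrite lt_min d0.
by move=> y xy; split; [apply: dA | apply: eB];
  apply: MG_nearS xy; rewrite ge_min lexx ?orbT.
Qed.

Lemma MG_open_bigcup (I : Type) (f : I -> set MG) :
  (forall i, MG_open (f i)) -> MG_open (\bigcup_i f i).
Proof.
move=> of_ x [i _ /of_[e e0 ef]]; exists e => // y /ef fy; by exists i.
Qed.

HB.instance Definition _ :=
  isOpenTopological.Build MG MG_openT MG_openI MG_open_bigcup.

Definition TM : set MG :=
  [set x | forall G : genus1_graph R n, x = \pi_MG G ->
     forall v, (3 <= valency G v + nmarks G v)%N].

End moduli.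

Section cycles.
Variables (R : realType) (n : nat).

Definition circle : set (R * R) := [set p | p.1 ^+ 2 + p.2 ^+ 2 = 1].

(* A cycle of total length 1 rescaled to the unit circle, with the vertex
   carrying the label 1 (the ordinal of value 0) at (-1, 0). *)
Record cycle_graph := CycleGraph {
  verts : set (R * R);
  pos : 'I_n -> R * R;
  verts_finite : finite_set verts;
  verts_circle : verts `<=` circle;
  pos_verts : forall k, verts (pos k);
  pos_first : forall k : 'I_n, val k = 0%N -> pos k = (-1, 0) }.

HB.instance Definition _ := gen_eqMixin cycle_graph.
HB.instance Definition _ := gen_choiceMixin cycle_graph.

Definition reflection (p : R * R) : R * R := (p.1, - p.2).

Definition same_cycle (G H : cycle_graph) : Prop :=
  (verts H = verts G /\ pos H = pos G) \/
  (verts H = reflection @` verts G /\ pos H = reflection \o pos G).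

Definition same_cycleb (G H : cycle_graph) : bool := `[< same_cycle G H >].

Lemma reflectionK : involutive reflection.
Proof. by case=> a b; rewrite /reflection /= opprK. Qed.

Lemma image_reflectionK A : reflection @` (reflection @` A) = A.
Proof.
rewrite image_comp (_ : reflection \o reflection = id) ?image_id //.
by apply/funext => p /=; rewrite reflectionK.
Qed.

Lemma same_cycleb_refl : reflexive same_cycleb.
Proof. by move=> G; apply/asboolP; left. Qed.

Lemma same_cycleb_sym : symmetric same_cycleb.
Proof.
suff sub G H : same_cycleb G H -> same_cycleb H G.
  by move=> G H; apply/idP/idP; exact: sub.
move=> /asboolP[[v p]|[v p]]; apply/asboolP; first by left; rewrite v p.
right; rewrite v p image_reflectionK; split=> //.
by apply/funext => k /=; rewrite reflectionK.
Qed.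

Lemma same_cycleb_trans : transitive same_cycleb.
Proof.
move=> H G K /asboolP[[v p]|[v p]] /asboolP[[v' p']|[v' p']];
  apply/asboolP; rewrite /same_cycle v' p' v p; [by left|by right|by right|].
left; rewrite image_reflectionK; split=> //.
by apply/funext => k /=; rewrite reflectionK.
Qed.

Canonical same_cycle_rel :=
  EquivRel same_cycleb same_cycleb_refl same_cycleb_sym same_cycleb_trans.

Definition X : Type := {eq_quot same_cycle_rel}.
HB.instance Definition _ := Choice.on X.
HB.instance Definition _ := EqQuotient.on X.

(* The shortest path from a to b is the arc of angle d with |d| <= pi; if a and
   b are antipodal, either half circle may be used. *)
Definition circle_close (eps : R) (a b : R * R) : Prop :=
  exists th d : R,
    [/\ `|d| <= pi, a = (cos th, sin th), b = (cos (th + d), sin (th + d)) &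
        forall s, 0 <= s <= 1 ->
          a.1 - eps < cos (th + s * d) < a.1 + eps].

Definition cycle_close (eps : R) (G H : cycle_graph) : Prop :=
  [/\ forall k, circle_close eps (pos G k) (pos H k),
      forall b, verts H b -> exists2 a, verts G a & circle_close eps b a &
      forall a, verts G a -> exists2 b, verts H b & circle_close eps a b].

Definition X_near (x : X) (eps : R) : set X :=
  [set y | exists G H : cycle_graph,
     [/\ x = \pi_X G, y = \pi_X H & cycle_close eps G H]].

Definition X_open (U : set X) : Prop :=
  forall x, U x -> exists2 eps, 0 < eps & X_near x eps `<=` U.

Lemma circle_closeS (d e : R) a b :
  d <= e -> circle_close d a b -> circle_close e a b.
Proof.
move=> de [th [del [h1 h2 h3 h4]]]; exists th, del; split=> // s /h4/andP[l r].
by rewrite (le_lt_trans _ l) ?lerB // (lt_le_trans r) // lerD.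
Qed.

Lemma X_nearS x (d e : R) : d <= e -> X_near x d `<=` X_near x e.
Proof.
move=> de y [G [H [-> -> [c1 c2 c3]]]]; exists G, H; split=> //; split.
- by move=> k; exact: circle_closeS (c1 k).
- by move=> b /c2[a Ga /(circle_closeS de) ab]; exists a.
- by move=> a /c3[b Hb /(circle_closeS de) ab]; exists b.
Qed.

Lemma X_openT : X_open setT.
Proof. by move=> x _; exists 1. Qed.

Lemma X_openI : setI_closed X_open.
Proof.
move=> A B oA oB x [/oA[d d0 dA] /oB[e e0 eB]].
exists (Num.min d e); first by rewrite lt_min d0.
by move=> y xy; split; [apply: dA | apply: eB];
  apply: X_nearS xy; rewrite ge_min lexx ?orbT.
Qed.

Lemma X_open_bigcup (I : Type) (f : I -> set X) :
  (forall i, X_open (f i)) -> X_open (\bigcup_i f i).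
Proof.
move=> of_ x [i _ /of_[e e0 ef]]; exists e => // y /ef fy; by exists i.
Qed.

HB.instance Definition _ :=
  isOpenTopological.Build X X_openT X_openI X_open_bigcup.

Definition marked (G : cycle_graph) : set (R * R) := range (pos G).

Definition Y : set X :=
  [set x | forall G, x = \pi_X G ->
     verts G (1, 0) /\ (forall p, verts G p -> p != (1, 0) -> marked G p)].

Definition scan_verts (G : cycle_graph) (t : R) : set (R * R) :=
  marked G
  `|` [set (t, Num.sqrt (1 - t ^+ 2)); (t, - Num.sqrt (1 - t ^+ 2))]
  `|` [set p | [/\ verts G p, ~ marked G p & t < p.1]].

Lemma scan_verts_finite G t : finite_set (scan_verts G t).
Proof.
rewrite /scan_verts !finite_setU; split; first split.
- exact: finite_image.
- by split; exact: finite_set1.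
- by apply: sub_finite_set (verts_finite G) => p [].
Qed.

Lemma scan_verts_circle G (t : `[-1 : R, 1]%classic) :
  scan_verts G (set_val t) `<=` circle.
Proof.
have t1 : set_val t ^+ 2 <= 1.
  have := set_valP t; rewrite /= in_itv /= => /andP[l r].
  by rewrite -real_normK ?num_real // expr_le1 // ler_norml l r.
move=> p [[[k _ <-]|[->|->]]|[+ _ _]].
- exact/verts_circle/pos_verts.
- by rewrite /circle /= sqr_sqrtr ?subr_ge0 // addrC subrK.
- by rewrite /circle /= sqrrN sqr_sqrtr ?subr_ge0 // addrC subrK.
- exact: verts_circle.
Qed.

Lemma scan_pos_verts G t k : scan_verts G t (pos G k).
Proof. by left; left; exists k. Qed.

Definition scan (G : cycle_graph) (t : `[-1 : R, 1]%classic) : cycle_graph :=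
  CycleGraph (scan_verts_finite G (set_val t)) (scan_verts_circle (t := t))
    (scan_pos_verts G (set_val t)) (@pos_first G).

Definition Phi (xt : X * `[-1 : R, 1]%classic) : X :=
  \pi_X (scan (repr xt.1) xt.2).

Lemma scan_same G H t : same_cycle G H -> same_cycle (scan G t) (scan H t).
Proof.
rewrite /same_cycle /=; case=> -[v p]; [left|right];
  rewrite /scan_verts /marked v p //; split=> //.
have mK q : range (reflection \o pos G) q = range (pos G) (reflection q).
  apply/propext; split=> [[k _ <-]|[k _ e]]; exists k => //=.
    by rewrite reflectionK.
  by rewrite e reflectionK.
have vK q : (reflection @` verts G) q = verts G (reflection q).
  apply/propext; split=> [[r Gr <-]|Gq]; first by rewrite reflectionK.
  by exists (reflection q) => //; rewrite reflectionK.
apply/seteqP; split=> q.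
- move=> [[|[->|->]]|[]]; rewrite ?mK ?vK.
  + by move=> Gq; exists (reflection q); rewrite ?reflectionK //; left; left.
  + exists (set_val t, - Num.sqrt (1 - set_val t ^+ 2)).
      by left; right; right.
    by rewrite /reflection /= opprK.
  + exists (set_val t, Num.sqrt (1 - set_val t ^+ 2)) => //.
    by left; right; left.
  + move=> Gq Mq tq; exists (reflection q); rewrite ?reflectionK //.
    by right; split.
- move=> [r + <-] => -[[Mr|[->|->]]|[Gr Mr tr]].
  + by left; left; rewrite mK reflectionK.
  + by left; right; right.
  + by left; right; left; rewrite /reflection /= opprK.
  + by right; split=> //; rewrite ?mK ?vK reflectionK.
Qed.

Lemma PhiE G t : Phi (\pi_X G, t) = \pi_X (scan G t).
Proof.
apply/eqmodP/asboolP/scan_same.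
by have /eqmodP/asboolP := reprK (\pi_X G).
Qed.

End cycles.

(* Main.v *)
(** The scanning map is uniformly continuous: an unmarked vertex that is swept
    for one of two close pairs (cycle, time) but not for the other lies near
    the scanning points of that pair. Sweeping [x] and sweeping [x] without its
    unmarked vertices both end at the same cycle, so forgetting the unmarked
    vertices of a cycle is homotopic to the identity of X_n.

    For graphs, let c : MG -> X_n contract the bridges and rescale the cycle,
    and let r : X_n -> MG regard a cycle as a graph. Scaling the bridges by s
    and the length L of the cycle to 1 - s + s L, for s from 1 to 0, is a
    homotopy from the identity to r c, and it preserves TM. With m : X_n -> X_n
    forgetting the unmarked vertices, the composite r m c takes values in TM,
    is homotopic to r c on MG, and equals r c on TM, because a tree attached to
    the cycle of a stable graph, or else its root, carries a mark. Hence r m c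
    and the inclusion of TM are inverse up to homotopy.

    Everything about graphs of genus 1 is expressed through a generator
    z : E -> {-1, 0, 1} of the circulations: a set of edges is a forest iff it
    misses an edge of the support of z, and the positions on the cycle are
    functions on the vertices that increase by z e * len e / L modulo 1 along e.
    Two graphs are close in MG iff they come from the same graph with weights
    that are close in the l^1 norm, where edges of weight 0 are contracted. *)

From HB Require Import structures.
From mathcomp Require Import all_boot all_order all_algebra finmap.
From mathcomp Require Import all_classical all_reals all_analysis.
From mathcomp Require Import ring lra zify.
Require Import Defs.

Set Implicit Arguments.
Unset Strict Implicit.
Unset Printing Implicit Defensive.

Import Order.TTheory GRing.Theory Num.Theory.
Import numFieldNormedType.Exports.

Local Open Scope ring_scope.
Local Open Scope quotient_scope.

(** * Linear systems over a field *)

(** The sets [MG_near] and [X_near] are not known to be neighborhoods, so continuity is checked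
    directly against the definition of open sets, and homotopies need a tube argument in the time
    variable. In [MG] closeness runs one way, from a graph to its expansions; two graphs are
    therefore compared on the edges of the finer one, where the coarser one is a weight that may
    vanish. This is why circumference, positions and shrinking are defined for weights [l] on a
    fixed graph. The finer graph or cycle can have arbitrarily many edges, so the estimates are
    [l^1] bounds whose constants depend on the limit point only. Spanning trees are avoided: angle
    functions and extensions of circulations both come from the Fredholm alternative. Once the first
    mark is fixed, the sign of [z] is the only choice left, and it becomes the reflection in
    [X_n]. *)

Section LinearSystems.
Variable K : fieldType.

Lemma sum_enum (I : finType) (F : I -> K) :
  \sum_i F i = \sum_(k < #|I|) F (enum_val k).
Proof. by rewrite (reindex (@enum_val I predT)) //;
  exact: onW_bij (enum_val_bij I). Qed.

(** Fredholm alternative: the columns of [cokermx M] lie in the kernel on which [b] is assumed to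
    vanish. *)
Lemma fredholm (I J : finType) (A : I -> J -> K) (b : J -> K) :
    (forall y : J -> K, (forall i, \sum_j A i j * y j = 0) ->
       \sum_j b j * y j = 0) ->
  exists x : I -> K, forall j, \sum_i x i * A i j = b j.
Proof.
move=> orth.
pose M := \matrix_(i < #|I|, j < #|J|) A (enum_val i) (enum_val j).
pose v := \row_(j < #|J|) b (enum_val j).
have /submxP[x vx] : (v <= M)%MS.
  rewrite submxE; apply/eqP/rowP => c; rewrite [LHS]mxE [RHS]mxE.
  transitivity (\sum_j b j * cokermx M (enum_rank j) c).
    by rewrite [RHS]sum_enum; apply: eq_bigr => j _; rewrite mxE enum_valK.
  apply: orth => i.
  have /matrixP/(_ (enum_rank i) c) := mulmx_coker M.
  rewrite mxE [RHS]mxE => E; rewrite -[RHS]E [LHS]sum_enum;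
    apply: eq_bigr => j _.
  by rewrite [M _ _]mxE enum_valK enum_rankK.
exists (fun i => x 0 (enum_rank i)) => j.
have /rowP/(_ (enum_rank j)) := vx; rewrite !mxE enum_rankK => ->.
by rewrite [LHS]sum_enum; apply: eq_bigr => i _;
  rewrite mxE enum_valK enum_rankK.
Qed.

(** A nonzero kernel vector pushes the rank below [#|J|], so with at least as many rows the rows are
    dependent. It serves to show that too many bridges would carry a circulation. *)
Lemma nontrivial_relation (I J : finType) (A : I -> J -> K) (y : J -> K) :
    (#|J| <= #|I|)%N -> (exists j, y j != 0) ->
    (forall i, \sum_j A i j * y j = 0) ->
  exists2 x : I -> K, (exists i, x i != 0) & forall j, \sum_i x i * A i j = 0.
Proof.
move=> JI [j0 yj0] Ay.
pose M := \matrix_(i < #|I|, j < #|J|) A (enum_val i) (enum_val j).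
pose v := \col_(j < #|J|) y (enum_val j).
have Mv : M *m v = 0.
  apply/matrixP => i c; rewrite !mxE -[RHS](Ay (enum_val i)) [RHS]sum_enum.
  by apply: eq_bigr => j _; rewrite !mxE.
have rv : (0 < \rank v)%N.
  rewrite lt0n mxrank_eq0; apply: contra yj0 => /eqP/matrixP.
  by move=> /(_ (enum_rank j0) 0); rewrite !mxE enum_rankK => ->.
have nfree : ~~ row_free M.
  rewrite -row_leq_rank -ltnNge; apply: leq_trans JI.
  by rewrite (leq_trans _ (mulmx0_rank_max Mv)) // -addn1 leq_add2l.
have : kermx M != 0 by rewrite kermx_eq0.
case/matrix0Pn=> a [i xi].
exists (fun i => kermx M a (enum_rank i)); first by exists (enum_val i);
  rewrite enum_valK.
move=> j; have /matrixP/(_ a (enum_rank j)) := mulmx_ker M.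
rewrite mxE [RHS]mxE => E; rewrite -[RHS]E [LHS]sum_enum; apply: eq_bigr => k _.
by rewrite [M _ _]mxE enum_valK enum_rankK.
Qed.

End LinearSystems.

(** * Circulations on a graph *)

Section Circulations.
Context {R : realType} {n : nat} {V E : finType} (G : mgraph R n V E).

Definition tail e := (ends G e).1.
Definition head e := (ends G e).2.

(* Conservation at every vertex, tested against all functions on vertices. *)
Definition circulation (x : E -> R) : Prop :=
  forall phi : V -> R, \sum_e x e * (phi (head e) - phi (tail e)) = 0.

(** The values are restricted through squares because [z e ^+ 2] later acts as the indicator of the
    cycle, insensitive to the sign of [z]. *)
Definition generator (z : E -> R) : Prop :=
  [/\ forall e, z e = 0 \/ z e ^+ 2 = 1, exists e, z e != 0, circulation z &
      forall x, circulation x -> exists c, forall e, x e = c * z e].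

Lemma circulationP x :
  circulation x <->
  forall v, \sum_e x e * ((v == head e)%:R - (v == tail e)%:R) = 0.
Proof.
split=> [xC v|xv phi]; first exact: (xC (fun w => (v == w)%:R)).
have E1 w : phi w = \sum_v phi v * (v == w)%:R.
  rewrite (bigD1 w) //= eqxx mulr1 big1 ?addr0 // => v /negbTE ->.
  by rewrite mulr0.
transitivity (\sum_v phi v *
    \sum_e x e * ((v == head e)%:R - (v == tail e)%:R)); last first.
  by apply: big1 => v _; rewrite xv mulr0.
under [RHS]eq_bigr do rewrite mulr_sumr.
rewrite exchange_big /=; apply: eq_bigr => e _.
rewrite (E1 (head e)) (E1 (tail e)) -sumrB mulr_sumr.
by apply: eq_bigr => v _; rewrite -mulrBr mulrCA.
Qed.

Lemma joins_tail_head e : joins G e (tail e) (head e).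
Proof. by rewrite /joins -surjective_pairing eqxx. Qed.

(** Orient each edge along the flow [x]. Conservation forces every vertex that is entered to be left
    again, so following outgoing edges ends in a periodic orbit. *)
Lemma circulation_has_cycle (x : E -> R) (F : {set E}) :
    circulation x -> (exists e, x e != 0) -> (forall e, x e != 0 -> e \in F) ->
  has_cycle G F.
Proof.
move=> xC [e0 xe0] xF.
pose src e := if x e < 0 then head e else tail e.
pose dst e := if x e < 0 then tail e else head e.
(* Otherwise conservation, tested against the indicator of [dst e], is a vanishing sum of
   nonnegative terms in which the term of [e] is positive. *)
have next e : x e != 0 -> exists e', (x e' != 0) && (src e' == dst e).
  move=> xe; apply: contrapT => none.
  have srcN e' : x e' != 0 -> (src e' == dst e) = false.
    by move=> xe'; apply/negP => h; apply: none; exists e'; rewrite xe'.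
  have := xC (fun v => (v == dst e)%:R).
  rewrite (eq_bigr (fun e' => `|x e'| * (dst e' == dst e)%:R)); last first.
    move=> e' _; have [->|xe'] := eqVneq (x e') 0;
      first by rewrite normr0 !mul0r.
    have := srcN _ xe'; rewrite /src {2 4}/dst; case: ltP => x0 ->.
      by rewrite (ltr0_norm x0) sub0r mulrN mulNr.
    by rewrite (ger0_norm x0) subr0.
  move/eqP; rewrite psumr_eq0 => [|e' _]; last by rewrite mulr_ge0 // ler0n.
  move/allP/(_ e); rewrite mem_index_enum eqxx mulr1 normr_eq0 (negbTE xe).
  by move/(_ isT).
pose live v := [exists e, (x e != 0) && (src e == v)].
pose out v := odflt e0 [pick e | (x e != 0) && (src e == v)].
have outP v : live v -> x (out v) != 0 /\ src (out v) = v.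
  move=> /existsP[e ev]; rewrite /out; case: pickP => [e' /andP[? /eqP ?] //|].
  by move=> /(_ e); rewrite ev.
pose g v := dst (out v).
have liveg v : live v -> live (g v).
  by move=> /outP[/next[e' h] _]; apply/existsP; exists e'.
have live0 : live (src e0) by apply/existsP; exists e0; rewrite xe0 eqxx.
have live_iter i v : live v -> live (iter i g v).
  by move=> lv; elim: i => //= i; apply: liveg.
have /trajectP[i i_lt Ei] := looping_order g (src e0).
set w := iter i g (src e0) in Ei.
have lw : live w by exact: live_iter.
have per : exists k, iter k.+1 g w == w.
  exists (fingraph.order g (src e0) - i).-1.
  by rewrite prednK ?subn_gt0 // /w -iterD subnK ?Ei // ltnW.
case: (ex_minnP per) => k /eqP kP kmin.
pose v (j : 'I_k.+1) := iter j g w.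
have lv j : live (v j) by exact: live_iter.
have v_inj : injective v.
  suff main (a b : nat) : (a < b < k.+1)%N -> iter a g w = iter b g w -> False.
    move=> a b ab; apply/val_inj => /=.
    by case: (ltngtP a b) => // lt; exfalso;
      [apply: (main a b)|apply: (main b a)]; rewrite ?lt ?ltn_ord.
  move=> /andP[ab bk] eab.
  (* A repetition at times [a < b] would give the period [k.+1 - b + a], shorter than the minimal
     one. *)
  have /eqP : iter (k.+1 - b + a) g w = w.
    by rewrite iterD eab -iterD subnK // ltnW.
  have : (k.+1 - b + a = (k.+1 - b + a).-1.+1)%N.
    by rewrite prednK // addn_gt0 subn_gt0 bk.
  move=> -> /kmin; rewrite leqNgt => /negP; apply.
  have /ltnW bk' := bk.
  rewrite -(ltn_add2r 1) !addn1 prednK ?addn_gt0 ?subn_gt0 ?bk //.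
  by rewrite -(ltn_add2r b) -addnA (addnC a) addnA subnK // ltn_add2l.
exists k, v, (fun j => out (v j)); split=> //.
  move=> a b eab; apply: v_inj.
  by have [_ <-] := outP _ (lv a); have [_ <-] := outP _ (lv b); rewrite eab.
move=> j; have [xo so] := outP _ (lv j); split; first exact: xF.
have -> : v (ordS j) = dst (out (v j)).
  rewrite -[RHS]/(g (v j)) /v -iterS /=.
  have [jk|] := ltnP j k; first by rewrite modn_small.
  rewrite leq_eqVlt ltnNge -ltnS ltn_ord orbF => /eqP <-.
  by rewrite modnn /= -iterS kP.
move: (out (v j)) so => e <-; rewrite /src /dst; case: ltP => _.
  by rewrite joinsC joins_tail_head.
exact: joins_tail_head.
Qed.

Lemma has_cycle_circulation (F : {set E}) :
  has_cycle G F ->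
  exists z : E -> R,
    [/\ forall e, z e = 0 \/ z e ^+ 2 = 1, exists e, z e != 0, circulation z &
        forall e, z e != 0 -> e \in F].
Proof.
move=> [k [v [c [v_inj c_inj cP]]]].
pose s i : R := if ends G (c i) == (v i, v (ordS i)) then 1 else -1.
pose z e := \sum_i (c i == e)%:R * s i.
have zc i : z (c i) = s i.
  rewrite /z (bigD1 i) //= eqxx mul1r big1 ?addr0 // => j ji.
  by rewrite (inj_eq c_inj) (negbTE ji) mul0r.
have z0 e : e \notin codom c -> z e = 0.
  move=> eN; rewrite /z big1 // => i _; case: eqP => [ce|_];
    last by rewrite mul0r.
  by case/negP: eN; rewrite -ce codom_f.
have s2 i : s i ^+ 2 = 1 by rewrite /s; case: ifP; rewrite ?sqrrN expr1n.
exists z; split.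
- move=> e; have [/codomP[i ->]|/z0] := boolP (e \in codom c); last by left.
  by right; rewrite zc.
- by exists (c ord0); rewrite zc -sqrf_eq0 s2 oner_eq0.
- move=> phi; rewrite /z.
  under eq_bigr do rewrite mulr_suml.
  rewrite exchange_big /=.
  rewrite (eq_bigr (fun i => phi (v (ordS i)) - phi (v i))).
    by rewrite sumrB [X in _ - X](reindex_inj (@ordS_inj k.+1)) /= subrr.
  move=> i _; rewrite (bigD1 (c i)) //= eqxx mul1r big1 ?addr0 => [|e].
    have [_ /joins_ends] := cP i; rewrite /s /head /tail.
    case: eqP => [->|neq [//|->]] /=; rewrite ?mul1r //.
    by rewrite mulN1r opprB.
  by rewrite eq_sym => /negbTE ->; rewrite !mul0r.
- move=> e; have [/codomP[i -> _]|/z0 ->] := boolP (e \in codom c).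
    by have [] := cP i.
  by rewrite eqxx.
Qed.

(** The rank is the same over [rat] and [R]. A kernel vector may take other values than 0, 1 and -1,
    but the cycle in its support yields one that does not, and it spans the kernel because the rank
    is 1. *)
Lemma generator_betti1 : betti1 G = 1%N <-> exists z, generator z.
Proof.
pose B := map_mx (@ratr R) (boundary G).
have kerB : \rank (kermx B) = betti1 G.
  by rewrite -map_kermx mxrank_map.
have circB (x : E -> R) : circulation x <-> (\row_i x (enum_val i)) *m B = 0.
  have Bv v : ((\row_i x (enum_val i)) *m B) 0 (enum_rank v) =
      \sum_e x e * ((v == head e)%:R - (v == tail e)%:R).
    rewrite mxE [RHS]sum_enum; apply: eq_bigr => i _.
    by rewrite mxE [B _ _]mxE [boundary _ _ _]mxE enum_rankK rmorphB /=
      !rmorph_nat.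
  rewrite circulationP; split=> [xv|xB v]; last by rewrite -Bv xB mxE.
  by apply/rowP => j; rewrite -(enum_valK j) Bv xv mxE.
have rowx (u : 'rV[R]_#|E|) : \row_i u 0 (enum_rank (enum_val i)) = u.
  by apply/rowP => i; rewrite mxE enum_valK.
rewrite -kerB; split=> [rk|[z [z1 [e0 ze0] zC zgen]]].
  have /rowV0Pn[u /sub_kermxP uB u0] : kermx B != 0 by rewrite -mxrank_eq0 rk.
  have uC : circulation (fun e => u 0 (enum_rank e)) by apply/circB;
    rewrite rowx.
  have [] := @has_cycle_circulation [set: E].
    apply: (circulation_has_cycle uC) => //.
    have /matrix0Pn[i [j]] := u0; rewrite (ord1 i) -(enum_valK j) => uj.
    by exists (enum_val j).
  move=> z [z1 [e0 ze0] zC _]; exists z; split=> //; first by exists e0.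
  move=> x /circB /sub_kermxP xk; set zr := \row_(i < #|E|) z (enum_val i).
  have zr0 : zr != 0.
    by apply: contra ze0 => /eqP/rowP/(_ (enum_rank e0));
      rewrite !mxE enum_rankK => ->.
  have zk : (zr <= kermx B)%MS by apply/sub_kermxP/circB.
  have : (kermx B <= zr)%MS.
    by rewrite -(geq_leqif (mxrank_leqif_sup zk)) rk rank_rV zr0.
  move/(submx_trans xk)/sub_rVP=> [c xc]; exists c => e.
  by move/rowP: xc => /(_ (enum_rank e)); rewrite !mxE enum_rankK.
set zr := \row_(i < #|E|) z (enum_val i).
have zr0 : zr != 0.
  by apply: contra ze0 => /eqP/rowP/(_ (enum_rank e0));
    rewrite !mxE enum_rankK => ->.
have zk : (zr <= kermx B)%MS by apply/sub_kermxP/circB.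
apply/eqP; rewrite eqn_leq; apply/andP; split.
  rewrite (_ : 1%N = \rank zr); last by rewrite rank_rV zr0.
  apply/mxrankS/row_subP => i; set u := row i _.
  have : circulation (fun e => u 0 (enum_rank e)).
    by apply/circB; rewrite rowx; apply/sub_kermxP/row_sub.
  move=> /zgen[c xc]; apply/sub_rVP; exists c; apply/rowP => j.
  by rewrite [RHS]mxE [zr _ _]mxE -xc enum_valK.
by rewrite -[X in (X <= _)%N](_ : \rank zr = 1%N) ?mxrankS // rank_rV zr0.
Qed.

(** Every circulation is a multiple of [z], so a cycle inside [F] forces the whole support of [z]
    into [F]. *)
Lemma forest_generator z F :
  generator z -> forest G F <-> exists2 e, z e != 0 & e \notin F.
Proof.
move=> [z1 [e0 ze0] zC zgen]; split=> [Ff|[e ze eF] /has_cycle_circulation].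
  apply: contrapT => none; apply: Ff; apply: (circulation_has_cycle zC).
    by exists e0.
  by move=> e ze; apply/negPn/negP => eF; apply: none; exists e.
move=> [x [_ [e1 xe1] /zgen[c xc] xF]]; case/negP: eF; apply: xF.
by move: xe1; rewrite !xc !mulf_eq0 !negb_or ze andbT => /andP[].
Qed.

Lemma generator_unique z z' :
  generator z -> generator z' ->
  (forall e, z' e = z e) \/ (forall e, z' e = - z e).
Proof.
move=> [z1 [e0 ze0] zC zgen] [z1' [e0' ze0'] zC' zgen'].
have [c zc] := zgen _ zC'.
have c2 : c ^+ 2 = 1.
  move: ze0' (z1' e0') (z1 e0');
    rewrite zc mulf_eq0 negb_or exprMn => /andP[c0 z0].
  case=> [/eqP|]; first by rewrite mulf_eq0 (negbTE c0) (negbTE z0).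
  by move=> cz [/eqP|z2]; [rewrite (negbTE z0)|move: cz; rewrite z2 mulr1].
move/eqP: c2; rewrite sqrf_eq1 => /orP[] /eqP c1; [left|right] => e;
  by rewrite zc c1 ?mul1r ?mulN1r.
Qed.

Lemma connect_invariant (F : {set E}) (P : V -> Prop) u v :
  (forall e, e \in F -> P (tail e) <-> P (head e)) ->
  connect (adj G F) u v -> P u -> P v.
Proof.
move=> PF /connectP[p + ->]; elim: p u => //= w p IH u /andP[uw wp] Pu.
apply: IH wp _; have /existsP[e /andP[eF /joins_ends ej]] := uw.
by have := PF _ eF; rewrite /tail /head; case: ej => -> /= [? ?]; auto.
Qed.

Lemma connected_invariant (P : V -> Prop) u v :
  connected_graph G -> (forall e, P (tail e) <-> P (head e)) -> P u -> P v.
Proof. by move=> Gc PE; apply: (@connect_invariant [set: E]). Qed.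

Lemma adjC F : symmetric (adj G F).
Proof.
move=> u v; apply/existsP/existsP => -[e /andP[eF j]]; exists e;
  by rewrite eF joinsC.
Qed.

Lemma connectC F : connect_sym (adj G F).
Proof. exact: sym_connect_sym (adjC F). Qed.

Lemma connect_ends (F : {set E}) e :
  e \in F -> connect (adj G F) (tail e) (head e).
Proof.
by move=> eF; apply/connect1/existsP; exists e; rewrite eF joins_tail_head.
Qed.

End Circulations.

(** * Isometries and contractions *)

Lemma inj_surj_bij (A B : Type) (f : A -> B) :
  injective f -> (forall y, exists x, f x = y) -> bijective f.
Proof.
move=> f_inj /choice[g gP]; exists g => // x.
by apply: f_inj; rewrite gP.
Qed.

Lemma sum_sig (I : finType) (K : nmodType) (P : pred I) (h : I -> K) :
  \sum_(i : {i | P i}) h (val i) = \sum_(i | P i) h i.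
Proof.
rewrite [RHS](reindex_omap (val : {i | P i} -> I) insub) /=; last first.
  by move=> i Pi; rewrite insubT.
by apply: eq_bigl => -[i Pi] /=; rewrite insubT Pi; apply/esym/eqP.
Qed.

Lemma sum_notin (I : finType) (K : nmodType) (F : {set I}) (h : I -> K) :
  \sum_(i : {i | i \notin F}) h (val i) = \sum_(i | i \notin F) h i.
Proof. exact: sum_sig. Qed.

Section Isometries.
Context {R : realType} {n : nat}.

Definition genus1 (V E : finType) (G : mgraph R n V E) : Prop :=
  connected_graph G /\ betti1 G = 1%N.

Section Transport.
Context {V E V' E' : finType} (G : mgraph R n V E) (H : mgraph R n V' E').
Variables (f : V -> V') (g : E -> E').
Hypotheses (f_bij : bijective f) (g_bij : bijective g).
Hypothesis fg_joins : forall e, joins H (g e) (f (ends G e).1) (f (ends G e).2).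

(** An isomorphism may reverse the stored orientation of an edge; circulations are transported with
    this sign. *)
Definition iso_sign e : R :=
  if ends H (g e) == (f (tail G e), f (head G e)) then 1 else -1.

Lemma iso_sign2 e : iso_sign e * iso_sign e = 1.
Proof. by rewrite /iso_sign; case: ifP; rewrite ?mulrNN mulr1. Qed.

Lemma iso_signN e : iso_sign e = 1 \/ iso_sign e = -1.
Proof. by rewrite /iso_sign; case: ifP; [left|right]. Qed.

Lemma iso_diff (phi : V' -> R) e :
  phi (head H (g e)) - phi (tail H (g e)) =
  iso_sign e * (phi (f (head G e)) - phi (f (tail G e))).
Proof.
have /joins_ends := fg_joins e; rewrite /iso_sign.
case: eqP => [E1 _|neq [//|E1]].
  by rewrite mul1r [head H _]/head [tail H _]/tail E1.
by rewrite mulN1r opprB [head H _]/head [tail H _]/tail E1.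
Qed.

Lemma iso_circulation (x : E' -> R) :
  circulation H x <-> circulation G (fun e => iso_sign e * x (g e)).
Proof.
have [f' fK f'K] := f_bij.
have key (phi : V' -> R) :
    \sum_e' x e' * (phi (head H e') - phi (tail H e')) =
    \sum_e (iso_sign e * x (g e)) * (phi (f (head G e)) - phi (f (tail G e))).
  rewrite (reindex g) /=; last exact: onW_bij.
  by apply: eq_bigr => e _; rewrite iso_diff mulrCA mulrA.
split=> xC phi; last by rewrite key; exact: (xC (phi \o f)).
rewrite -[RHS](xC (phi \o f')) key.
by apply: eq_bigr => e _ /=; rewrite !fK.
Qed.

Lemma iso_generator z : generator G z ->
  exists2 z', generator H z' & forall e, z' (g e) = iso_sign e * z e.
Proof.
have [g' gK g'K] := g_bij.
move=> [z1 [e0 ze0] zC zgen].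
exists (fun e' => iso_sign (g' e') * z (g' e')); last by move=> e; rewrite gK.
have back e : iso_sign e * (iso_sign (g' (g e)) * z (g' (g e))) = z e.
  by rewrite gK mulrA iso_sign2 mul1r.
split.
- move=> e'; have [->|z2] := z1 (g' e'); first by left; rewrite mulr0.
  by right; rewrite exprMn expr2 iso_sign2 mul1r z2.
- exists (g e0); rewrite gK;
  apply: contra ze0 => /eqP/(congr1 ( *%R (iso_sign e0))).
  by rewrite mulrA iso_sign2 mul1r mulr0 => ->.
- apply/iso_circulation => phi; rewrite -[RHS](zC phi).
  by apply: eq_bigr => e _; rewrite back.
- move=> x /iso_circulation/zgen[c xc]; exists c => e'.
  have := xc (g' e'); rewrite g'K => /(congr1 ( *%R (iso_sign (g' e')))).
  by rewrite mulrA iso_sign2 mul1r => ->; rewrite mulrCA.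
Qed.

Lemma iso_connected : connected_graph G -> connected_graph H.
Proof.
have [f' fK f'K] := f_bij.
move=> Gc u v; rewrite -[v]f'K.
apply: (@connected_invariant _ _ _ _ G
  (fun w => connect (adj H (finset.setTfor _)) u (f w)) (f' u) _ Gc);
  last by rewrite f'K.
have fe e : connect (adj H (finset.setTfor _)) (f (tail G e)) (f (head G e)).
  by apply/connect1/existsP; exists (g e); rewrite inE fg_joins.
move=> e; split=> h; apply: connect_trans h _ => //.
by rewrite connectC.
Qed.

Lemma iso_genus1 : genus1 G -> genus1 H.
Proof.
move=> [Gc /generator_betti1[z /iso_generator[z' z'g _]]].
by split; [exact: iso_connected|apply/generator_betti1; exists z'].
Qed.

End Transport.

Lemma isometric_genus1 (V E V' E' : finType)
    (G : mgraph R n V E) (H : mgraph R n V' E') :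
  isometric G H -> genus1 G -> genus1 H.
Proof. by move=> [f [g [bf bg j _ _]]]; exact: iso_genus1 bf bg j. Qed.

Lemma isometric_refl (V E : finType) (G : mgraph R n V E) : isometric G G.
Proof.
exists id, id; split=> //; [by exists id|by exists id|].
by move=> e; exact: joins_tail_head.
Qed.

Lemma isometric_sym (V E V' E' : finType)
    (G : mgraph R n V E) (H : mgraph R n V' E') :
  isometric G H -> isometric H G.
Proof.
move=> [f [g [[f' fK f'K] [g' gK g'K] j l m]]]; exists f', g'; split.
- by exists f.
- by exists g.
- move=> e; have /joins_ends[] := j (g' e); rewrite g'K => -> /=; rewrite !fK.
    exact: joins_tail_head.
  by rewrite joinsC; exact: joins_tail_head.
- by move=> e; rewrite l g'K.
- by move=> k; rewrite m fK.
Qed.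

Lemma graph_iso_trans (P Q S : R -> R -> Prop) (V E V' E' V'' E'' : finType)
    (G : mgraph R n V E) (H : mgraph R n V' E') (K : mgraph R n V'' E'') :
  (forall a b c, P a b -> Q b c -> S a c) ->
  graph_iso P G H -> graph_iso Q H K -> graph_iso S G K.
Proof.
move=> PQ [f [g [bf bg j l m]]] [f' [g' [bf' bg' j' l' m']]].
exists (f' \o f), (g' \o g); split=> /=.
- exact: bij_comp.
- exact: bij_comp.
- move=> e; have /joins_ends[] := j e; have := j' (g e) => + Ee; rewrite Ee //=.
  by rewrite joinsC.
- by move=> e; apply: PQ (l e) (l' _).
- by move=> k; rewrite m' m.
Qed.

Lemma isometric_trans (V E V' E' V'' E'' : finType)
    (G : mgraph R n V E) (H : mgraph R n V' E') (K : mgraph R n V'' E'') :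
  isometric G H -> isometric H K -> isometric G K.
Proof. by apply: graph_iso_trans => a b c -> ->. Qed.

Lemma genus1_relabel (V E : finType) (G : mgraph R n V E) :
  genus1 G -> exists G' : genus1_graph R n, isometric G G'.
Proof.
move=> G1.
pose G' := MGraph
  (fun e : 'I_#|E| => (enum_rank (ends G (enum_val e)).1,
                       enum_rank (ends G (enum_val e)).2))
  (fun e => len_gt0 G (enum_val e)) (fun k => enum_rank (mark G k)).
have GG' : isometric G G'.
  exists enum_rank, enum_rank; split.
  - exact: enum_rank_bij.
  - exact: enum_rank_bij.
  - by move=> e; rewrite /joins /= enum_rankK eqxx.
  - by move=> e /=; rewrite enum_rankK.
  - by [].
have [c b] := isometric_genus1 GG' G1.
by exists (Genus1Graph c b).
Qed.

(** Contractions and polygons have vertex types other than ordinals; this relation ties them to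
    points of [MG] through a relabelled copy. *)
Definition represents (V E : finType) (G : mgraph R n V E) (x : MG R n) : Prop
  :=
  exists2 G' : genus1_graph R n, x = \pi_(MG R n) G' & isometric G G'.

Lemma pi_isometric (G H : genus1_graph R n) :
  \pi_(MG R n) G = \pi_(MG R n) H <-> isometric G H.
Proof.
split=> [/eqmodP/asboolP //|GH].
by apply/eqmodP/asboolP.
Qed.

Lemma represents_exists (V E : finType) (G : mgraph R n V E) :
  genus1 G -> exists x, represents G x.
Proof. by move=> /genus1_relabel[G' GG']; exists (\pi_(MG R n) G'), G'. Qed.

Lemma represents_genus1 (V E : finType) (G : mgraph R n V E) x :
  represents G x -> genus1 G.
Proof.
move=> [G' _ /isometric_sym GG']; apply: isometric_genus1 GG' _.
by split; [exact: genus1_connected|exact: genus1_betti].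
Qed.

Lemma represents_isometric (V E V' E' : finType)
    (G : mgraph R n V E) (H : mgraph R n V' E') x :
  represents G x -> isometric G H -> represents H x.
Proof.
move=> [G' -> GG'] GH; exists G' => //.
by apply: isometric_trans GG'; exact: isometric_sym.
Qed.

Lemma represents_inj (V E V' E' : finType)
    (G : mgraph R n V E) (H : mgraph R n V' E') x y :
  represents G x -> represents H y -> isometric G H -> x = y.
Proof.
move=> [G' -> GG'] [H' -> HH'] GH; apply/pi_isometric.
exact: isometric_trans (isometric_trans (isometric_sym GG') GH) HH'.
Qed.

Lemma represents_uniq (V E V' E' : finType)
    (G : mgraph R n V E) (H : mgraph R n V' E') x :
  represents G x -> represents H x -> isometric G H.
Proof.
move=> [G' -> GG'] [H' /pi_isometric G'H' HH'].
exact: isometric_trans (isometric_trans GG' G'H') (isometric_sym HH').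
Qed.

Lemma represents_pi (G : genus1_graph R n) : represents G (\pi_(MG R n) G).
Proof. by exists G => //; exact: isometric_refl. Qed.

Lemma represents_repr (x : MG R n) : represents (repr x) x.
Proof. by exists (repr x); [rewrite reprK|exact: isometric_refl]. Qed.

Section Contraction.
Context {V E : finType} (G : mgraph R n V E).

Lemma to_contract_eq (F : {set E}) u v :
  to_contract G F u = to_contract G F v <-> connect (adj G F) u v.
Proof.
split=> [/(congr1 val)/= /setP/(_ v)|uv]; first by rewrite !inE connect0.
apply/val_inj/setP => w /=; rewrite !inE.
by apply/idP/idP; apply: connect_trans => //; rewrite connectC.
Qed.

Lemma to_contract_surj (F : {set E}) (c : contract_vertex G F) :
  exists v, to_contract G F v = c.
Proof.
by have /imsetP[v _ cv] := valP c; exists v; apply: val_inj.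
Qed.

Lemma to_contract_ends (F : {set E}) e :
  e \in F -> to_contract G F (tail G e) = to_contract G F (head G e).
Proof. by move=> eF; apply/to_contract_eq/connect_ends. Qed.

Lemma sum_contract (F : {set E}) (x : contract_edge F -> R) (y : E -> R) phi :
    (forall e, x e = y (val e)) ->
  \sum_e x e * (phi (head (contract G F) e) - phi (tail (contract G F) e)) =
  \sum_(e | e \notin F) y e * (phi (to_contract G F (head G e)) -
                               phi (to_contract G F (tail G e))).
Proof.
move=> xy; rewrite -sum_notin; apply: eq_bigr => e _.
by rewrite xy.
Qed.

(* A circulation of the contraction extends over the forest: by duality the
   obstruction pairs with functions constant on the components. *)
Lemma circulation_extend (F : {set E}) (x : contract_edge F -> R) :
  circulation (contract G F) x ->
  exists2 y, circulation G y & forall e, x e = y (val e).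
Proof.
move=> xC.
pose y0 e := if insub e is Some e' then x e' else 0.
have y0x e : x e = y0 (val e) by rewrite /y0 valK.
(* [d v] is the excess at [v] of the extension of [x] by 0; the edges of [F] have to absorb it. *)
pose d v := \sum_(e | e \notin F) y0 e * ((v == head G e)%:R - (v == tail G
  e)%:R).
pose A e v : R := if e \in F then (v == head G e)%:R - (v == tail G e)%:R else
  0.
have delta (phi : V -> R) w : \sum_v (v == w)%:R * phi v = phi w.
  rewrite (bigD1 w) //= eqxx mul1r big1 ?addr0 // => v /negbTE ->.
  by rewrite mul0r.
have Aphi e (phi : V -> R) : e \in F ->
    \sum_v A e v * phi v = phi (head G e) - phi (tail G e).
  move=> eF; rewrite /A eF.
  by under eq_bigr do rewrite mulrBl; rewrite sumrB !delta.
have dphi phi : \sum_v d v * phi v =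
    \sum_(e | e \notin F) y0 e * (phi (head G e) - phi (tail G e)).
  under eq_bigr do rewrite mulr_suml.
  rewrite exchange_big /=; apply: eq_bigr => e _.
  under eq_bigr do rewrite -mulrA.
  rewrite -mulr_sumr; congr (_ * _).
  by under eq_bigr do rewrite mulrBl; rewrite sumrB !delta.
have [|t tP] := @fredholm R E V A (fun v => - d v).
  move=> phi phiF.
  suff -> : \sum_v - d v * phi v = - \sum_v d v * phi v.
    have [sec secP] := choice (@to_contract_surj F).
    pose psi c := phi (sec c).
    have psiE v : psi (to_contract G F v) = phi v.
      have /to_contract_eq := secP (to_contract G F v).
      rewrite /psi; move: (sec _) => w wv.
      apply: (connect_invariant (P := fun u => phi w = phi u) _ wv) => //.
      by move=> e eF; have /eqP := phiF e; rewrite Aphi // subr_eq0 => /eqP ->.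
    have := xC psi; rewrite (sum_contract psi y0x) => E0.
    rewrite dphi -[X in - X](_ : 0 = _) ?oppr0 // -[LHS]E0.
    by apply: eq_bigr => e _; rewrite !psiE.
  by rewrite -sumrN; apply: eq_bigr => v _; rewrite mulNr.
exists (fun e => if e \in F then t e else y0 e); last first.
  by move=> e; rewrite (negbTE (valP e)).
apply/circulationP => v; rewrite (bigID (mem F)) /=.
have := tP v; rewrite (bigID (mem F)) /= [X in _ + X]big1 ?addr0; last first.
  by move=> e /negbTE eF; rewrite /A eF mulr0.
move=> tv; apply/eqP; rewrite addr_eq0; apply/eqP.
transitivity (- d v).
  by rewrite -tv; apply: eq_bigr => e eF; rewrite /A eF.
by congr (- _); apply: eq_bigr => e /negbTE ->.
Qed.

(** A forest misses an edge of the support, which keeps the restriction of [z] nonzero; circulations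
    of the contraction extend to [G] and are therefore multiples of it. *)
Lemma contract_generator F z :
  generator G z -> forest G F -> generator (contract G F) (z \o val).
Proof.
move=> zg Ff; have [z1 _ zC zgen] := zg; split=> [e||phi|x].
- exact: z1.
- by have /(forest_generator _ zg)[e ze eF] := Ff; exists (exist _ e eF).
- rewrite (sum_contract (y := z)) // -[RHS](zC (phi \o to_contract G F)).
  rewrite [RHS](bigID (mem F)) /= [X in _ = X + _]big1 ?add0r // => e eF.
  by rewrite to_contract_ends // subrr mulr0.
- move=> /circulation_extend[y /zgen[c yc] xy]; exists c => e.
  by rewrite xy yc.
Qed.

Lemma contract_set0 : isometric G (contract G finset.set0).
Proof.
have e0 e : e \notin (finset.set0 : {set E}) by rewrite inE.
exists (to_contract G finset.set0), (fun e => exist _ e (e0 e)); split=> //.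
- apply: inj_surj_bij; last exact: to_contract_surj.
  move=> u v /to_contract_eq uv.
  by apply: (connect_invariant (P := fun w => u = w) _ uv) => // e; rewrite inE.
- apply: inj_surj_bij; first by move=> e e' [].
  by move=> e; exists (val e); exact: val_inj.
- by move=> e; rewrite /joins /= eqxx.
Qed.

End Contraction.

Section Reweighting.
Context {V E : finType} (G : mgraph R n V E) (l : E -> R).

Definition new_len e : R := if 0 < l e then l e else 1.

Lemma new_len_gt0 e : 0 < new_len e.
Proof. by rewrite /new_len; case: ifP. Qed.

(* Edges of weight 0 get the junk length 1: they are going to be contracted. *)
Definition reweight : mgraph R n V E := MGraph (ends G) new_len_gt0 (mark G).

End Reweighting.

End Isometries.

(** * Weights on the edges of a graph *)

Section Weights.
Context {R : realType} {n : nat}.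

Definition weighting (E : finType) (F : {set E}) (l : E -> R) : Prop :=
  forall e, 0 <= l e /\ (l e == 0) = (e \in F).

Lemma weighting_gt0 (E : finType) (F : {set E}) (l : E -> R) e :
  weighting F l -> e \notin F -> 0 < l e.
Proof. by move=> /(_ e)[l0 lF] eF; rewrite lt_def l0 lF eF. Qed.

Lemma weighting_eq0 (E : finType) (F : {set E}) (l : E -> R) e :
  weighting F l -> e \in F -> l e = 0.
Proof. by move=> /(_ e)[l0 lF] eF; apply/eqP; rewrite lF. Qed.

Lemma len_reweight (V E : finType) (G : mgraph R n V E) F l e :
  weighting F l -> e \notin F -> len (reweight G l) e = l e.
Proof. by move=> wFl eF; rewrite /= /new_len (weighting_gt0 wFl). Qed.

(** The [l^1] distance bounds at once the length of every component of [F], where [l] vanishes, and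
    the change of every other edge. *)
Lemma represents_near (H : genus1_graph R n) F l x eps :
    weighting F l -> forest H F ->
    represents (contract (reweight H l) F) x ->
    \sum_e `|l e - len H e| < eps ->
  MG_near x eps (\pi_(MG R n) H).
Proof.
move=> wFl Ff [G -> CG] small; exists G, H; split=> //; exists F; split=> //.
  move=> v; apply: le_lt_trans small; rewrite /component_length.
  rewrite [leRHS](bigID (fun e =>
    (e \in F) && ((ends H e).1 \in component H F v))) /=.
  apply: ler_wpDr; first by apply: sumr_ge0 => e _; exact: normr_ge0.
  apply: ler_sum => e /andP[eF _].
  by rewrite (weighting_eq0 wFl) // sub0r normrN gtr0_norm // len_gt0.
pose P (a b : R) := `|a - b| < eps.
apply: (@graph_iso_trans R n P eq P _ _ _ _ _ _ _ (contract (reweight H l) F) _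
  _ _ CG);
  first by move=> a b c /[swap] <-.
exists id, id; split=> //; [by exists id|by exists id| |].
  by move=> e; rewrite /joins /= eqxx.
move=> e; rewrite /P /= -[new_len l _]/(len (reweight H l) (val e)).
rewrite (len_reweight _ wFl) ?(valP e) // distrC; apply: le_lt_trans small.
rewrite (bigD1 (val e)) //= lerDl.
by apply: sumr_ge0 => e' _; exact: normr_ge0.
Qed.

Lemma MG_near_refl (x : MG R n) e : 0 < e -> MG_near x e x.
Proof.
move=> e0; exists (repr x), (repr x); split; rewrite ?reprK //.
exists finset.set0; split.
- by move=> [k [v [c [_ _ /(_ ord0)[]]]]]; rewrite inE.
- by move=> v; rewrite /component_length big_pred0 // => e'; rewrite inE.
pose P (a b : R) := `|a - b| < e.
apply: (@graph_iso_trans R n eq P P _ _ _ _ _ _ _ (repr x)); last 2 first.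
- exact/isometric_sym/contract_set0.
- exists id, id; split=> //; [by exists id|by exists id| |].
    by move=> e'; exact: joins_tail_head.
  by move=> e'; rewrite /P subrr normr0.
by move=> a b c ->.
Qed.

Lemma open_MGP (A : set (MG R n)) : open A <->
  forall x, A x -> exists2 e, 0 < e & (MG_near x e `<=` A)%classic.
Proof. by []. Qed.

Lemma near_represents (x : MG R n) eps : 0 < eps ->
  exists2 d, 0 < d & forall y, MG_near x d y ->
    exists (H : genus1_graph R n) (F : {set 'I_(nedges H)}) l,
      [/\ y = \pi_(MG R n) H, forest H F, weighting F l,
          represents (contract (reweight H l) F) x &
          \sum_e `|l e - len H e| < eps].
Proof.
(* With tolerance [eps / N], each component of the contracted forest and each surviving edge costs
   at most [eps / N]. There are as many of them as vertices and edges of [repr x], however large [H]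
   is; the successor makes the bound strict. *)
move=> eps0; pose N := (nverts (repr x) + nedges (repr x)).+1.
have N0 : 0 < N%:R :> R by rewrite ltr0n.
exists (eps / N%:R); first by rewrite divr_gt0.
move=> _ [G [H [xG -> [F [Ff Fl [f [g [bf bg j len_close m]]]]]]]].
have [f0 [g0 [bf0 bg0 _ _ _]]] : isometric (repr x) G.
  by apply/pi_isometric; rewrite reprK.
have cV : (#|contract_vertex H F| = nverts (repr x))%N.
  by rewrite (bij_eq_card bf) -(bij_eq_card bf0) card_ord.
have cE : (#|contract_edge F| = nedges (repr x))%N.
  by rewrite (bij_eq_card bg) -(bij_eq_card bg0) card_ord.
pose l e := if insub e is Some e' then len G (g e') else 0.
have lN (e : contract_edge F) : l (val e) = len G (g e) by rewrite /l valK.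
have lF e : e \in F -> l e = 0.
  by move=> eF; rewrite /l insubF // eF.
have wFl : weighting F l.
  move=> e; have [eF|eF] := boolP (e \in F); first by rewrite lF // eqxx.
  by rewrite (lN (exist _ e eF)) gt_eqF ?len_gt0 // ltW ?len_gt0.
exists H, F, l; split=> //.
- exists G => //; exists f, g; split=> // e.
  by rewrite -lN -(len_reweight H wFl (valP e)).
set d := eps / N%:R in len_close Fl *.
have d0 : 0 < d by rewrite divr_gt0.
have -> : eps = d * N%:R by rewrite /d divfK // gt_eqF.
rewrite (bigID (mem F)) /=.
have h1 : \sum_(e in F) `|l e - len H e| <= d * (nverts (repr x))%:R.
  rewrite -cV (partition_big (fun e =>
    to_contract H F (ends H e).1) xpredT) //=.
  rewrite -sum1_card natr_sum mulr_sumr; apply: ler_sum => c _.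
  have [v <-] := to_contract_surj c; rewrite mulr1.
  apply: le_trans (ltW (Fl v)); rewrite /component_length.
  rewrite le_eqVlt; apply/orP; left; apply/eqP; apply: eq_big => e.
    case: (e \in F) => //=; rewrite inE.
    by apply/eqP/idP => [/esym/to_contract_eq|/to_contract_eq].
  by move=> /andP[eF _]; rewrite lF // sub0r normrN gtr0_norm // len_gt0.
have h2 : \sum_(e | e \notin F) `|l e - len H e| <= d * (nedges (repr x))%:R.
  rewrite -(sum_notin F (fun e =>
    `|l e - len H e|)) -cE -sum1_card natr_sum mulr_sumr.
  apply: ler_sum => e _; rewrite mulr1 lN distrC; exact: ltW (len_close e).
apply: le_lt_trans (lerD h1 h2) _; rewrite -mulrDr ltr_pM2l // -natrD ltr_nat.
exact: ltnSn.
Qed.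

End Weights.

(** * Continuity and homotopies *)

Local Open Scope classical_set_scope.

Section GeneralTopology.
Context {R : realType}.

Lemma continuous_to_sub (T U : topologicalType) (A : set U) (f : T -> A) :
  continuous (fun x => set_val (f x)) -> continuous f.
Proof.
move=> fc; apply/continuousP => _ [B oB <-].
by have /continuousP/(_ _ oB) := fc.
Qed.

Lemma continuous_set_val (U : topologicalType) (A : set U) :
  continuous (set_val : A -> U).
Proof. exact: initial_continuous. Qed.

Section Clamp.
Variables (a b : R) (ab : a <= b).

Lemma clamp_subproof s : Num.max a (Num.min b s) \in `[a, b]%classic.
Proof.
rewrite inE /= in_itv /= le_max lexx /= ge_max ab /=.
by rewrite ge_min lexx.
Qed.

Definition clamp s : `[a, b]%classic := SigSub (clamp_subproof s).

Lemma clampE s : a <= s <= b -> set_val (clamp s) = s.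
Proof.
by move=> /andP[as_ sb]; rewrite set_valE /= min_r // max_r.
Qed.

Lemma itv_bounds (t : `[a, b]%classic) : a <= set_val t <= b.
Proof. by have := set_valP t; rewrite /= in_itv. Qed.

Lemma continuous_clamp : continuous clamp.
Proof.
apply: continuous_to_sub => s /=.
apply: (@continuous_max R R (fun=> a) (fun s => Num.min b s)).
  exact: cvg_cst.
apply: (@continuous_min R R (fun=> b) id); [exact: cvg_cst|exact: cvg_id].
Qed.

End Clamp.

(* The sets [N x e] are not assumed to be neighborhoods of [x]: compactness of
   the interval makes up for it. *)
Lemma continuous_prod_criterion (T U : topologicalType) (N : T -> R -> set T)
    (a b : R) (H : T * `[a, b]%classic -> U) :
    (forall A : set T, open A <->
       forall x, A x -> exists2 e, 0 < e & N x e `<=` A) ->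
    (forall x e, 0 < e -> N x e x) ->
    (forall x d e, d <= e -> N x d `<=` N x e) ->
    (forall x t V, open V -> V (H (x, t)) -> exists2 e, 0 < e &
       forall y t', N x e y -> `|set_val t' - set_val t| < e -> V (H (y,
         t'))) ->
  continuous H.
Proof.
move=> openN Nxx NS loc [x t] W; rewrite nbhsE => -[V [oV Vxt] VW].
have [e e0 eV] := loc x t V oV Vxt.
have e20 : 0 < e / 2 by rewrite divr_gt0.
(* Tube argument: [A] collects the points that stay in [V] on a closed, hence compact, interval of
   times around [t]. Around a point of [A] each time has its own radius, and compactness yields a
   common one, so [A] is open. *)
pose A := [set y | forall t', `|set_val t' - set_val t| <= e / 2 -> V (H (y,
  t'))].
have Ax : A x.
  move=> t' tt'; apply: eV; first exact: Nxx.
  by apply: le_lt_trans tt' _; rewrite ltr_pdivrMr // ltr_pMr // ltr1n.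
have oA : open A.
  apply/openN => y Ay.
  pose P d s := forall (u : `[a, b]%classic) z,
    set_val u = s -> N y d z -> V (H (z, u)).
  have /compact_near_coveringP/(_ R (0^'+) P _) :=
    @segment_compact R (Num.max a (set_val t - e / 2)) (Num.min b (set_val t +
      e / 2)).
  case=> [s /=|d /= d0 dP].
    rewrite in_itv /= ge_max le_min -!andbA => /and4P[a_s ts sb st].
    have sE : a <= s <= b by rewrite a_s.
    have ab : a <= b by rewrite (le_trans a_s).
    have [|d d0 dV] := loc y (clamp ab s) V oV.
      by apply: Ay; rewrite clampE // ler_distl ts st.
    exists (ball s d, [set d' | d' <= d]) => /=.
      split; first exact: nbhsx_ballx.
      by apply: nbhs_right_le.
    move=> [s' d'] /= [ss' dd'] u z us zN; apply: dV; first exact: NS zN.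
    by rewrite us clampE // distrC.
  exists (d / 2); first by rewrite divr_gt0.
  move=> z Nz u ut; apply: (dP (d / 2)) (erefl (set_val u)) Nz => //=.
  - by rewrite sub0r normrN gtr0_norm ?divr_gt0 // ltr_pdivrMr // ltr_pMr //
    ltr1n.
  - by rewrite divr_gt0.
  have /andP[au ub] := itv_bounds u.
  by move: ut; rewrite ler_distl in_itv /= ge_max le_min au ub => /andP[-> ->].
exists (A, [set t' | `|set_val t' - set_val t| < e / 2]) => /=.
  split; first exact: open_nbhs_nbhs.
  have nb : nbhs (set_val t) (ball (set_val t) (e / 2)) by exact: nbhsx_ballx.
  have nb' : nbhs t (set_val @^-1` ball (set_val t) (e / 2)).
    exact: (@continuous_set_val _ `[a, b]%classic t _ nb).
  apply: filterS nb' => t'.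
  by rewrite /ball /= distrC.
by move=> [y t'] /= [Ay tt']; apply: VW; apply: Ay; exact: ltW.
Qed.

Section Homotopies.
Local Notation I01 := `[0 : R, 1]%classic.


Lemma continuous_pair (S T U : topologicalType) (f : S -> T) (g : S -> U) :
  continuous f -> continuous g -> continuous (fun p => (f p, g p)).
Proof. by move=> fc gc p; apply: cvg_pair; [exact: fc|exact: gc]. Qed.

Lemma continuous_param (T U : topologicalType) (a b c d : R) (cd : c <= d)
    (H : T * `[c, d]%classic -> U) (k : R -> R) :
  continuous H -> continuous k ->
  continuous (fun p : T * `[a, b]%classic =>
    H (p.1, clamp cd (k (set_val p.2)))).
Proof.
move=> Hc kc p; apply: (@continuous_comp _ _ _ (fun p : T * `[a, b]%classic =>
  (p.1, clamp cd (k (set_val p.2)))) H); last exact: Hc.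
apply: continuous_pair; first by move=> q; exact: cvg_fst.
move=> q; apply: (@continuous_comp _ _ _ (fun p : T * `[a, b]%classic =>
  k (set_val p.2)) (clamp cd)); last exact: continuous_clamp.
apply: (@continuous_comp _ _ _ (fun p : T * `[a, b]%classic => set_val p.2) k);
  last exact: kc.
apply: (@continuous_comp _ _ _ (fun p : T * `[a, b]%classic => p.2) set_val);
  first exact: cvg_snd.
exact: continuous_set_val.
Qed.

Lemma continuous_affine (u v : R) : continuous (fun s : R => u + v * s).
Proof.
move=> s; apply: continuousD; first exact: cst_continuous.
by apply: continuousM; [exact: cst_continuous|exact: cvg_id].
Qed.

Lemma homotopic_sym (T U : topologicalType) (f g : T -> U) :
  homotopic R f g -> homotopic R g f.
Proof.
move=> [H [Hc H0 H1]].
exists (fun p => H (p.1, clamp (@ler01 R) (1 + -1 * set_val p.2))); split.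
- exact: (continuous_param Hc (@continuous_affine 1 (-1))).
- by move=> x s s0; apply: H1; rewrite clampE s0 ?mulr0 ?addr0 // ler01 lexx.
- by move=> x s s1; apply: H0; rewrite clampE s1 ?mulr1 ?subrr // ler01 lexx.
Qed.

Lemma homotopic_trans (T U : topologicalType) (f g h : T -> U) :
  homotopic R f g -> homotopic R g h -> homotopic R f h.
Proof.
move=> [H [Hc H0 H1]] [K [Kc K0 K1]].
pose H' (p : T * I01) := H (p.1, clamp (@ler01 R) (0 + 2 * set_val p.2)).
pose K' (p : T * I01) := K (p.1, clamp (@ler01 R) (-1 + 2 * set_val p.2)).
have H'c : continuous H' := continuous_param Hc (@continuous_affine 0 2).
have K'c : continuous K' := continuous_param Kc (@continuous_affine (-1) 2).
pose A := [set p : T * I01 | set_val p.2 <= 1 / 2].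
pose B := [set p : T * I01 | 1 / 2 <= set_val p.2].
have vc : continuous (fun p : T * I01 => set_val p.2).
  move=> p; apply: (@continuous_comp _ _ _ (fun p : T * I01 => p.2) set_val);
    [exact: cvg_snd|exact: continuous_set_val].
have cA : closed A.
  by apply: (@closed_comp _ _ (fun p : T * I01 =>
    set_val p.2) [set x | x <= 1 / 2]) =>
    [p _|]; [exact: vc|exact: closed_le].
have cB : closed B.
  by apply: (@closed_comp _ _ (fun p : T * I01 =>
    set_val p.2) [set x | 1 / 2 <= x]) =>
    [p _|]; [exact: vc|exact: closed_ge].
pose L (p : T * I01) := if set_val p.2 <= 1 / 2 then H' p else K' p.
have HK p : set_val p.2 = 1 / 2 -> H' p = K' p.
  move=> p2; rewrite /H' /K' H1 ?K0 // p2 clampE; lra.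
exists L; split.
- apply/continuous_subspace_setT.
  have -> : setT = A `|` B.
    by apply/seteqP; split=> p // _;
      case: (leP (set_val p.2) (1 / 2)) => [|/ltW]; [left|right].
  apply: withinU_continuous => //.
  + apply: (@subspace_eq_continuous _ A _ H'); last exact: continuous_subspaceT.
    by move=> p /set_mem pA; rewrite /from_subspace /L ifT.
  + apply: (@subspace_eq_continuous _ B _ K'); last exact: continuous_subspaceT.
    move=> p /set_mem p2; rewrite /from_subspace /L; case: ifP => // p2'.
    by rewrite HK //; apply/eqP; rewrite eq_le p2 p2'.
- by move=> x s s0; rewrite /L /H' /= s0 ifT ?H0 // ?clampE; lra.
- by move=> x s s1; rewrite /L /K' /= s1 ifF ?K1 // ?clampE; lra.
Qed.

Lemma homotopic_comp (S T U W : topologicalType) (k : S -> T) (f g : T -> U)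
    (h : U -> W) :
  continuous k -> continuous h -> homotopic R f g ->
  homotopic R (h \o f \o k) (h \o g \o k).
Proof.
move=> kc hc [H [Hc H0 H1]].
exists (fun p => h (H (k p.1, p.2))); split.
- move=> p; apply: (@continuous_comp _ _ _ (fun p : S * I01 =>
  H (k p.1, p.2)) h);
    last exact: hc.
  apply: (@continuous_comp _ _ _ (fun p : S * I01 => (k p.1, p.2)) H);
    last exact: Hc.
  apply: continuous_pair; last by move=> q; exact: cvg_snd.
  move=> q; apply: (@continuous_comp _ _ _ fst k); [exact: cvg_fst|exact: kc].
- by move=> x s s0; rewrite H0.
- by move=> x s s1; rewrite H1.
Qed.

End Homotopies.

End GeneralTopology.

(** * The circle and the scanning map *)

Lemma continuous_criterion (R : realType) (T U : topologicalType)
    (N : T -> R -> set T) (f : T -> U) :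
    (forall A : set T, open A <->
       forall x, A x -> exists2 e, 0 < e & N x e `<=` A) ->
    (forall x V, open V -> V (f x) ->
       exists2 e, 0 < e & forall y, N x e y -> V (f y)) ->
  continuous f.
Proof.
move=> openN loc; apply/continuousP => V oV; apply/openN => x Vfx.
by have [e e0 eV] := loc x V oV Vfx; exists e.
Qed.

Section CircleGeometry.
Context {R : realType}.
Implicit Types (a b p q : R * R) (e th : R).

Lemma le_cos : {in `[0, pi]%R &, {homo @cos R : x y /~ x <= y}}.
Proof.
move=> x y x0 y0; rewrite le_eqVlt => /predU1P[->//|xy].
by apply: ltW; rewrite ltr_cos.
Qed.

Lemma circle_param p : circle p -> exists th, p = (cos th, sin th).
Proof.
case: p => a b; rewrite /circle /= => ab1.
have a1 : -1 <= a <= 1.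
  by rewrite -ler_norml -(@expr_le1 _ 2) // real_normK ?num_real // -ab1 lerDl
    sqr_ge0.
have aE : cos (acos a) = a by rewrite acosK // in_itv.
have b2 : 1 - a ^+ 2 = b ^+ 2 by rewrite -ab1 addrC addKr.
case: (leP 0 b) => b0.
  by exists (acos a); rewrite aE sin_acos // b2 sqrtr_sqr ger0_norm.
exists (- acos a); rewrite cosN sinN aE sin_acos // b2 sqrtr_sqr ltr0_norm //.
by rewrite opprK.
Qed.

Lemma circle_close_refl e a : 0 < e -> circle a -> circle_close e a a.
Proof.
move=> e0 /circle_param[th ->]; exists th, 0; split;
  rewrite ?normr0 ?pi_ge0 ?addr0 //.
by move=> s _; rewrite mulr0 addr0 /= ltrBlDr ltrDl e0.
Qed.

Lemma circle_close_fst e a b : circle_close e a b -> `|b.1 - a.1| < e.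
Proof.
move=> [th [d [_ -> -> /(_ 1)]]]; rewrite mul1r ler01 lexx => /(_ isT) /=.
by rewrite ltr_distl.
Qed.

(** The strip is centered at the first point. Exchanging the points moves its center by less than
    [e], which doubling the width makes up for. *)
Lemma circle_close_sym e a b : circle_close e a b -> circle_close (e * 2) b a.
Proof.
move=> ab; have := circle_close_fst ab.
case: ab => th [d [d1 aE bE close]]; rewrite ltr_distl => /andP[l r].
exists (th + d), (- d); split; rewrite ?normrN ?addrK // => s /andP[s0 s1].
have -> : th + d + s * - d = th + (1 - s) * d by ring.
have /close/andP[l' r'] : 0 <= 1 - s <= 1 by apply/andP; split; lra.
by apply/andP; split; lra.
Qed.

Lemma circle_close_reflection e a b :
  circle_close e a b -> circle_close e (reflection a) (reflection b).
Proof.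
move=> [th [d [d1 -> -> close]]]; exists (- th), (- d).
split; rewrite ?normrN // /reflection /= -?opprD ?cosN ?sinN //.
by move=> s /close; rewrite mulrN -opprD cosN.
Qed.

(** On a closed upper or lower half circle the abscissa is monotone in the angle, so along the arc
    it stays between its values at the ends. *)
Lemma circle_close_half e p q : circle p -> circle q ->
  `|q.1 - p.1| < e -> (0 <= p.2 /\ 0 <= q.2) \/ (p.2 <= 0 /\ q.2 <= 0) ->
  circle_close e p q.
Proof.
move=> pC qC pq half.
wlog [p0 q0] : p q pC qC pq {half} / 0 <= p.2 /\ 0 <= q.2.
  move=> upper; case: half => [half|[p0 q0]]; first exact: upper.
  rewrite -(reflectionK p) -(reflectionK q); apply: circle_close_reflection.
  by apply: upper; rewrite /reflection /circle /= ?sqrrN ?oppr_ge0.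
have acosE (r : R * R) : circle r -> 0 <= r.2 ->
    [/\ r = (cos (acos r.1), sin (acos r.1)), 0 <= acos r.1 & acos r.1 <= pi].
  case: r => a b; rewrite /circle /= => ab1 b0.
  have a1 : -1 <= a <= 1.
    by rewrite -ler_norml -(@expr_le1 _ 2) // real_normK ?num_real // -ab1
      lerDl sqr_ge0.
  rewrite acos_ge0 ?acos_lepi // acosK ?in_itv // sin_acos //.
  by rewrite (_ : 1 - a ^+ 2 = b ^+ 2) ?sqrtr_sqr ?ger0_norm // -ab1 addrC
    addKr.
have [pE pl pr] := acosE _ pC p0; have [qE ql qr] := acosE _ qC q0.
move: (acos p.1) (acos q.1) pE qE pl pr ql qr => u v pE qE pl pr ql qr.
exists u, (v - u); split => //.
- by rewrite ler_norml; apply/andP; split; lra.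
- by rewrite addrC subrK.
move=> s /andP[s0 s1].
move: pq; rewrite pE qE /= ltr_distl => /andP[l r].
have [uv|/ltW vu] := leP u v.
  have h1 : u <= u + s * (v - u) by rewrite lerDl mulr_ge0 // subr_ge0.
  have h2 : u + s * (v - u) <= v by nra.
  have c1 : cos (u + s * (v - u)) <= cos u by apply: le_cos;
    rewrite ?in_itv /=; lra.
  have c2 : cos v <= cos (u + s * (v - u)) by apply: le_cos;
    rewrite ?in_itv /=; lra.
  by apply/andP; split; lra.
have h1 : u + s * (v - u) <= u by nra.
have h2 : v <= u + s * (v - u) by nra.
have c1 : cos u <= cos (u + s * (v - u)) by apply: le_cos; rewrite ?in_itv /=;
  lra.
have c2 : cos (u + s * (v - u)) <= cos v by apply: le_cos; rewrite ?in_itv /=;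
  lra.
by apply/andP; split; lra.
Qed.

End CircleGeometry.

(** * Continuity of the scanning map and its effect at the times -1 and 1 *)

Section ScanningRetraction.
Context {R : realType} {n : nat}.
Notation I := `[-1 : R, 1]%classic.
Implicit Types (G H : cycle_graph R n) (t : I).

Lemma cycle_close_refl e G : 0 < e -> cycle_close e G G.
Proof.
move=> e0.
have refl p : verts G p -> circle_close e p p.
  by move=> /verts_circle; exact: circle_close_refl.
by split=> [k|b Gb|a Ga]; [exact/refl/pos_verts|exists b => //; exact: refl|
  exists a => //; exact: refl].
Qed.

Lemma X_near_refl (x : X R n) e : 0 < e -> X_near x e x.
Proof.
by move=> e0; exists (repr x), (repr x); split; rewrite ?reprK //;
  exact: cycle_close_refl.
Qed.

Lemma open_XP (A : set (X R n)) : open A <->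
  forall x, A x -> exists2 e, 0 < e & X_near x e `<=` A.
Proof. by []. Qed.

Lemma scan_height_bound t : set_val t ^+ 2 <= 1.
Proof.
have /andP[l r] := itv_bounds t.
by rewrite -real_normK ?num_real // expr_le1 // ler_norml l r.
Qed.

(* The points (t, sqrt (1 - t^2)) and (t, - sqrt (1 - t^2)) replace the
   unmarked vertices that the scan has just swept. *)
Lemma scan_height_close G t (p : R * R) e : circle p ->
  `|set_val t - p.1| < e -> exists2 q, scan_verts G (set_val t) q &
    circle_close e p q /\ circle_close e q p.
Proof.
move=> pC pt; have t1 := scan_height_bound t.
have q0 : 0 <= Num.sqrt (1 - set_val t ^+ 2) by exact: sqrtr_ge0.
have tp : `|p.1 - set_val t| < e by rewrite distrC.
have [p0|/ltW p0] := leP 0 p.2.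
  exists (set_val t, Num.sqrt (1 - set_val t ^+ 2)); first by left; right; left.
  have qC : circle (set_val t, Num.sqrt (1 - set_val t ^+ 2)).
    by rewrite /circle /= sqr_sqrtr ?subr_ge0 // addrC subrK.
  by split; apply: circle_close_half => //=; left.
exists (set_val t, - Num.sqrt (1 - set_val t ^+ 2)); first by left; right;
  right.
have qC : circle (set_val t, - Num.sqrt (1 - set_val t ^+ 2)).
  by rewrite /circle /= sqrrN sqr_sqrtr ?subr_ge0 // addrC subrK.
by split; apply: circle_close_half => //=; right; rewrite oppr_le0.
Qed.

Lemma scan_close G H t t' e : 0 < e -> cycle_close (e / 2) G H ->
  `|set_val t' - set_val t| < e / 2 -> cycle_close e (scan G t) (scan H t').
Proof.
move=> e0 [c1 c2 c3] tt'.
have e2 : e / 2 < e by rewrite ltr_pdivrMr // ltr_pMr // ltr1n.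
have height_close (K L : cycle_graph R n) (u u' : I) (p : R * R) :
    `|set_val u' - set_val u| < e / 2 ->
    [set (set_val u, Num.sqrt (1 - set_val u ^+ 2));
         (set_val u, - Num.sqrt (1 - set_val u ^+ 2))] p ->
    exists2 q, scan_verts L (set_val u') q &
      circle_close e p q /\ circle_close e q p.
  move=> uu' pu; apply: scan_height_close.
    by apply: (@scan_verts_circle _ _ K u); left; right.
  have -> : p.1 = set_val u by case: pu => ->.
  exact: lt_trans e2.
have markGH k : circle_close e (pos G k) (pos H k).
  by apply: circle_closeS (c1 k); exact: ltW.
have markHG k : circle_close e (pos H k) (pos G k).
  by have := circle_close_sym (c1 k); rewrite divfK.
split => //= [b|a].
- case=> [[[k _ <-]|bh]|[Hb bN tb]].
  + by exists (pos G k) => //; left; left; exists k.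
  + have [|q Gq [bq _]] := height_close H G t' t b _ bh;
    first by rewrite distrC.
    by exists q.
  + have [a Ga ba] := c2 _ Hb.
    have [aM|aN] := pselect (marked G a).
      by exists a; [left; left|apply: circle_closeS ba; exact: ltW].
    (* If [a] is swept at time [t] but [b] is not at time [t'], then [t] is within [e] of [b.1], and
       a scanning point takes the place of [a]. *)
    have [ta|at_] := ltP (set_val t) a.1.
      by exists a; [right|apply: circle_closeS ba; exact: ltW].
    have [|q Gq [bq _]] := @scan_height_close G t b e (verts_circle Hb).
      have := circle_close_fst ba; move: tt'; rewrite !ltr_distl.
      by move=> /andP[l r] /andP[l' r']; apply/andP; split; lra.
    by exists q.
- case=> [[[k _ <-]|ah]|[Ga aN ta]].
  + by exists (pos H k) => //; left; left; exists k.
  + have [|q Hq [aq _]] := height_close G H t t' a _ ah; first by [].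
    by exists q.
  + have [b Hb ab] := c3 _ Ga.
    have [bM|bN] := pselect (marked H b).
      by exists b; [left; left|apply: circle_closeS ab; exact: ltW].
    have [tb|bt] := ltP (set_val t') b.1.
      by exists b; [right|apply: circle_closeS ab; exact: ltW].
    have [|q Hq [aq _]] := @scan_height_close H t' a e (verts_circle Ga).
      have := circle_close_fst ab; move: tt'; rewrite !ltr_distl.
      by move=> /andP[l r] /andP[l' r']; apply/andP; split; lra.
    by exists q.
Qed.

Lemma continuous_Phi : continuous (@Phi R n).
Proof.
apply: (continuous_prod_criterion open_XP X_near_refl (@X_nearS R n)) =>
  x t V oV Vxt.
have [e e0 eV] := (open_XP V).1 oV _ Vxt.
exists (e / 2); first by rewrite divr_gt0.
move=> _ t' [G [H [xG -> GH]]] tt'; apply: eV.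
exists (scan G t), (scan H t'); split; [by rewrite xG PhiE|by rewrite PhiE|].
exact: scan_close.
Qed.

Section Reflect.
Variable G : cycle_graph R n.

Lemma reflect_finite : finite_set (@reflection R @` verts G).
Proof. exact/finite_image/verts_finite. Qed.

Lemma reflect_circle : @reflection R @` verts G `<=` @circle R.
Proof.
by move=> _ [p /verts_circle + <-]; rewrite /circle /reflection /= sqrrN.
Qed.

Lemma reflect_pos k : (@reflection R @` verts G) (reflection (pos G k)).
Proof. by exists (pos G k) => //; exact: pos_verts. Qed.

Lemma reflect_first (k : 'I_n) : val k = 0%N -> reflection (pos G k) = (-1, 0).
Proof. by move=> k0; rewrite (pos_first G k0) /reflection /= oppr0. Qed.

Definition reflect : cycle_graph R n :=
  CycleGraph reflect_finite reflect_circle reflect_pos reflect_first.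

End Reflect.

Lemma reflect_same G : same_cycle G (reflect G).
Proof. by right. Qed.

(** [X_near] lets the representative of [x] vary; if it is the mirror image of [repr x], reflecting
    [H] as well restores the closeness. *)
Lemma X_near_repr (x : X R n) e y : X_near x e y ->
  exists2 H, y = \pi_(X R n) H & cycle_close e (repr x) H.
Proof.
move=> [G [H [xG yH [c1 c2 c3]]]].
have /eqmodP/asboolP : \pi_(X R n) G = \pi_(X R n) (repr x) by rewrite reprK xG.
case=> -[vE pE]; first by exists H => //; rewrite /cycle_close vE pE.
exists (reflect H); first by rewrite yH; apply/eqmodP/asboolP;
  exact: reflect_same.
rewrite /cycle_close vE pE /=; split=> [k|_ [b Hb <-]|_ [a Ga <-]].
- exact: circle_close_reflection.
- have [a Ga ba] := c2 _ Hb; exists (reflection a); first by exists a.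
  exact: circle_close_reflection.
- have [b Hb ab] := c3 _ Ga; exists (reflection b); first by exists b.
  exact: circle_close_reflection.
Qed.

Section OnlyMarked.
Variable G : cycle_graph R n.

Lemma marked_finite : finite_set (marked G).
Proof. exact: finite_image. Qed.

Lemma marked_circle : marked G `<=` (@circle R).
Proof. by move=> _ [k _ <-]; exact/verts_circle/pos_verts. Qed.

Lemma pos_marked k : marked G (pos G k).
Proof. by exists k. Qed.

Definition only_marked : cycle_graph R n :=
  CycleGraph marked_finite marked_circle pos_marked (@pos_first R n G).

End OnlyMarked.

Definition unmark (x : X R n) : X R n := \pi_(X R n) (only_marked (repr x)).

Lemma only_marked_same G H :
  same_cycle G H -> same_cycle (only_marked G) (only_marked H).
Proof.
case=> -[v p]; [left|right]; rewrite /= /marked p //; split=> //.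
by rewrite image_comp.
Qed.

Lemma unmarkE G : unmark (\pi_(X R n) G) = \pi_(X R n) (only_marked G).
Proof.
apply/eqmodP/asboolP/only_marked_same.
by have /eqmodP/asboolP := reprK (\pi_(X R n) G).
Qed.

Lemma unmark_idem x : unmark (unmark x) = unmark x.
Proof.
rewrite -[x]reprK; move: (repr x) => G; rewrite (unmarkE G) unmarkE.
by apply/eqmodP/asboolP; left; split.
Qed.

Lemma continuous_unmark : continuous unmark.
Proof.
apply: (continuous_criterion open_XP) => x V oV Vx.
have [e e0 eV] := (open_XP V).1 oV _ Vx.
exists (e / 2); first by rewrite divr_gt0.
move=> _ [G [H [xG -> [c1 c2 c3]]]]; apply: eV.
exists (only_marked G), (only_marked H); split; rewrite ?xG ?unmarkE //.
have markGH k : circle_close e (pos G k) (pos H k).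
  by apply: circle_closeS (c1 k); rewrite ler_pdivrMr // ler_pMr // ler1n.
have markHG k : circle_close e (pos H k) (pos G k).
  by have := circle_close_sym (c1 k); rewrite divfK.
by split=> //= _ [k _ <-]; [exists (pos G k)|exists (pos H k)] => //; exists k.
Qed.

Lemma scan_at_1 G t : set_val t = 1 ->
  verts (scan G t) = marked G `|` [set (1, 0)].
Proof.
move=> t1; rewrite /= t1 /scan_verts expr1n subrr sqrtr0 oppr0 setUid.
apply/seteqP; split=> [p [//|[/verts_circle + _]]|p]; last by left.
by rewrite /circle /= => pC p1; exfalso; have := sqr_ge0 p.2; nra.
Qed.

Lemma Phi_at_1_Y x t : set_val t = 1 -> @Y R n (Phi (x, t)).
Proof.
move=> t1 G; rewrite /Phi /= => /eqmodP/asboolP[[vE pE]|[vE pE]];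
  rewrite /marked pE vE scan_at_1 //.
  split; first by right.
  by move=> p [//|->]; rewrite eqxx.
split; first by exists (1, 0); [right|rewrite /reflection /= oppr0].
move=> _ [p [[k _ <-]|->] <-]; first by exists k.
by rewrite /reflection /= oppr0 eqxx.
Qed.

Lemma Phi_at_1 x t : set_val t = 1 -> @Y R n x -> Phi (x, t) = x.
Proof.
move=> t1; rewrite -[x]reprK; move: (repr x) => G /(_ _ erefl)[x1 xm].
rewrite PhiE; apply/eqmodP/asboolP; left; split=> //; rewrite scan_at_1 //.
apply/seteqP; split=> [p xp|p [[k _ <-]|->] //]; last exact: pos_verts.
by have [->|/(xm _ xp)] := eqVneq p (1, 0); [right|left].
Qed.

(** At time -1 both scanning points are [(-1, 0)], which is marked since [n] is positive, and every
    other point of the circle lies strictly to its right. *)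
Lemma Phi_at_N1 x t : (0 < n)%N -> set_val t = -1 -> @Phi R n (x, t) = x.
Proof.
move=> n0 t1; rewrite -[x]reprK; move: (repr x) => G.
rewrite PhiE; apply/eqmodP/asboolP; left; split=> //=.
have N1 : marked G (-1, 0) by exists (Ordinal n0) => //; exact: pos_first.
rewrite t1 /scan_verts sqrrN expr1n subrr sqrtr0 oppr0 setUid.
apply/seteqP; split=> [p xp|p [[[k _ <-]|->]|[]]] //; last 2 first.
- exact: pos_verts.
- by case: N1 => k _ <-; exact: pos_verts.
have [pM|pN] := pselect (marked G p); first by left; left.
right; split=> //; rewrite ltNge; apply/negP => p1; apply: pN.
have := verts_circle xp; rewrite /circle /= => pC.
have p1E : p.1 = -1 by have := sqr_ge0 p.2; nra.
have p2E : p.2 = 0.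
  by move: pC; rewrite p1E sqrrN expr1n => /eqP;
    rewrite -subr_eq0 addrAC subrr add0r sqrf_eq0 => /eqP.
by rewrite [p]surjective_pairing p1E p2E.
Qed.

Lemma Phi_unmark x t : set_val t = 1 -> @Phi R n (unmark x, t) = @Phi R n (x,
  t).
Proof.
move=> t1; rewrite -[x]reprK unmarkE !PhiE; apply/eqmodP/asboolP; left.
by split=> //; rewrite !scan_at_1.
Qed.

Lemma Phi_retraction : (0 < n)%N -> deformation_retraction (@Y R n) (@Phi R n).
Proof.
move=> n0; split.
- exact: continuous_Phi.
- by move=> x t; exact: Phi_at_N1.
- exact: Phi_at_1_Y.
- by move=> x t; exact: Phi_at_1.
Qed.

Lemma le_N11 : -1 <= 1 :> R. Proof. lra. Qed.

Definition last_time : I := clamp le_N11 1.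

Lemma last_timeE : set_val last_time = 1.
Proof. by rewrite clampE // lexx le_N11. Qed.

Definition sweep (x : X R n) : X R n := Phi (x, last_time).

Lemma continuous_sweep : continuous sweep.
Proof.
move=> x; apply: (@continuous_comp _ _ _ (fun x => (x, last_time)) (@Phi R n));
  last exact: continuous_Phi.
by apply: (@continuous_pair _ _ _ id (fun=> last_time)) => y;
  [exact: cvg_id|exact: cst_continuous].
Qed.

Lemma sweep_homotopic : (0 < n)%N -> homotopic R sweep id.
Proof.
move=> n0.
exists (fun p => Phi (p.1, clamp le_N11 (1 + -2 * set_val p.2))); split.
- exact: (continuous_param continuous_Phi (@continuous_affine R 1 (-2))).
- move=> x s s0; congr (Phi (_, _)); apply: val_inj.
  by rewrite -!set_valE last_timeE clampE s0; lra.
- by move=> x s s1; apply: Phi_at_N1 => //; rewrite clampE s1; lra.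
Qed.

Lemma unmark_homotopic : (0 < n)%N -> homotopic R unmark id.
Proof.
move=> n0; apply: homotopic_trans (sweep_homotopic n0).
have := homotopic_comp continuous_unmark (fun x => cvg_id) (sweep_homotopic n0).
move=> /homotopic_sym; congr homotopic; apply/funext => x //=.
by rewrite /sweep Phi_unmark // last_timeE.
Qed.

Lemma X_homotopy_equivalent_Y :
  (0 < n)%N -> homotopy_equivalent R (X R n) (@Y R n).
Proof.
move=> n0.
pose f (x : X R n) : @Y R n := SigSub (mem_set (@Phi_at_1_Y x _ last_timeE)).
have fc : continuous f by apply: continuous_to_sub; exact: continuous_sweep.
exists f, set_val; split=> //; first exact: continuous_set_val.
  exact: sweep_homotopic.
exists fst; split=> [p|y s _|y s _] //; first exact: cvg_fst.
apply: val_inj; rewrite /= Phi_at_1 ?last_timeE //; exact: set_valP.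
Qed.

End ScanningRetraction.

Local Close Scope classical_set_scope.

(** * Angles on the unit circle *)

Section UnitCircle.
Context {R : realType}.
Implicit Types s t e : R.

(** Period 1 matches the total length of the cycle, and the shift by [pi] puts 0 at the first
    mark. *)
Definition circ t : R * R :=
  (cos (pi *+ 2 * t + pi), sin (pi *+ 2 * t + pi)).

Lemma circ_circle t : @circle R (circ t).
Proof. exact: cos2Dsin2. Qed.

Lemma circ0 : circ 0 = (-1, 0).
Proof. by rewrite /circ mulr0 add0r cospi sinpi. Qed.

Lemma circN t : circ (- t) = reflection (circ t).
Proof.
by rewrite /circ /reflection /= mulrN !cosDpi !sinDpi cosN sinN.
Qed.

Lemma circD1 t : circ (t + 1) = circ t.
Proof. by rewrite /circ mulrDr mulr1 addrAC cosD2pi sinD2pi. Qed.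

Lemma circ_nat t (m : nat) : circ (t + m%:R) = circ t.
Proof. by elim: m => [|m IH]; rewrite ?addr0 // -natr1 addrA circD1. Qed.

Lemma circ_int s t : s - t \is a Num.int -> circ s = circ t.
Proof.
move=> /intrP[[m|m] st]; have -> : s = t + (s - t) by rewrite addrC subrK.
  by rewrite st circ_nat.
by rewrite st NegzE mulrNz -(circ_nat _ m.+1) subrK.
Qed.

Lemma cos_eq1 (u : R) : `|u| < pi *+ 2 -> cos u = 1 -> u = 0.
Proof.
wlog u0 : u / 0 <= u => [pos|].
  have [/pos//|/ltW u0 ul uc] := leP 0 u.
  by apply/eqP; rewrite -oppr_eq0; apply/eqP/pos;
    rewrite ?oppr_ge0 ?normrN ?cosN.
rewrite ger0_norm // => ul uc; apply/eqP; rewrite eq_le u0 andbT leNgt.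
apply/negP => u1.
have s0 : 0 < sin (u / 2).
  by apply: sin_gt0_pi; rewrite mulr2n in ul; apply/andP; split; lra.
move: uc; rewrite (_ : u = (u / 2) *+ 2); last by rewrite mulr2n; lra.
by rewrite cos_mulr2n mulr2n; have := cos2Dsin2 (u / 2); nra.
Qed.

Lemma circ_inj s t : 0 <= s < 1 -> 0 <= t < 1 -> circ s = circ t -> s = t.
Proof.
move=> /andP[s0 s1] /andP[t0 t1] [cst sst].
set a := _ + _ in cst sst; set b := pi *+ 2 * t + pi in cst sst.
have pi2 : 0 < pi *+ 2 :> R by rewrite mulrn_wgt0 ?pi_gt0.
have ab : a - b = pi *+ 2 * (s - t) by rewrite /a /b; ring.
have : a - b = 0.
  apply: cos_eq1; last by rewrite cosB cst sst -!expr2 cos2Dsin2.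
  rewrite ab normrM gtr0_norm // gtr_pMr // ltr_norml; apply/andP; split; lra.
by rewrite ab => /eqP; rewrite mulf_eq0 gt_eqF //= subr_eq0 => /eqP.
Qed.

Definition frac t : R := t - (Num.floor t)%:~R.

Lemma frac_itv t : 0 <= frac t < 1.
Proof.
have /andP[l r] := floor_itv t.
by rewrite subr_ge0 l ltrBlDr addrC -[1]/(1%:~R) -intrD r.
Qed.

Lemma frac_int t : t - frac t \is a Num.int.
Proof. by rewrite opprB addrC subrK; exact: intr_int. Qed.

Lemma circ_frac t : circ (frac t) = circ t.
Proof. by symmetry; apply/circ_int/frac_int. Qed.

Lemma int_lt1 t : t \is a Num.int -> `|t| < 1 -> t = 0.
Proof.
move=> ti t1; apply/eqP/negPn/negP => /(norm_intr_ge1 ti).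
by rewrite leNgt t1.
Qed.

Lemma circ_eq s t : circ s = circ t <-> s - t \is a Num.int.
Proof.
split=> [|/circ_int//]; rewrite -(circ_frac s) -(circ_frac t).
move=> /(circ_inj (frac_itv s) (frac_itv t)) st.
have -> : s - t = (s - frac s) - (t - frac t) by rewrite st; ring.
by apply: rpredB; exact: frac_int.
Qed.

Lemma circ_surj p : @circle R p -> exists2 t, 0 <= t < 1 & circ t = p.
Proof.
move=> /circle_param[th ->].
have pi2 : pi *+ 2 != 0 :> R by rewrite mulrn_eq0 /= gt_eqF ?pi_gt0.
exists (frac ((th - pi) / (pi *+ 2))); first exact: frac_itv.
by rewrite circ_frac /circ mulrCA divff // mulr1 subrK.
Qed.

Lemma continuous_near (f : R -> R) x e : {for x, continuous f} -> 0 < e ->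
  exists2 d, 0 < d & forall y, `|y - x| < d -> `|f y - f x| < e.
Proof.
move=> fc e0; have /nbhs_ballP[d /= d0 dP] := fc _ (nbhsx_ballx (f x) e e0).
exists d => // y yx; have := dP y; rewrite /ball /= distrC => /(_ yx).
by rewrite distrC.
Qed.

Lemma circ_close e : 0 < e ->
  exists2 d, 0 < d & forall s t,
    `|s - t| < d -> circle_close e (circ s) (circ t).
Proof.
move=> e0.
have pi2 : 0 < pi *+ 2 :> R by rewrite mulrn_wgt0 ?pi_gt0.
have e20 : 0 < e / 2 by rewrite divr_gt0.
have [d1 d10 dcos] := continuous_near (@continuous_cos R 0) e20.
have [d2 d20 dsin] := continuous_near (@continuous_sin R 0) e20.
(* [pi] makes the arc a shortest one; [d1] and [d2] bound the change of the abscissa uniformly in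
   the starting angle, through the addition formula for [cos]. *)
pose d := Num.min pi (Num.min d1 d2).
have d0 : 0 < d by rewrite !lt_min pi_gt0 d10.
exists (d / (pi *+ 2)); first by rewrite divr_gt0.
move=> s t; rewrite ltr_pdivlMr // => st.
have ud : `|pi *+ 2 * (t - s)| < d by rewrite normrM gtr0_norm // mulrC distrC.
exists (pi *+ 2 * s + pi), (pi *+ 2 * (t - s)); split => //.
- by rewrite ltW // (lt_le_trans ud) // ge_min lexx.
- by rewrite /circ; congr (cos _, sin _); ring.
move=> r /andP[r0 r1]; rewrite -ltr_distl /=.
set th := _ + pi; set u := r * _.
have {}ud : `|u - 0| < d.
  by rewrite subr0; apply: le_lt_trans ud;
    rewrite normrM (ger0_norm r0) ler_piMl.
have /dcos : `|u - 0| < d1 by apply: lt_le_trans ud _;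
  rewrite !ge_min lexx ?orbT.
have /dsin : `|u - 0| < d2 by apply: lt_le_trans ud _;
  rewrite !ge_min lexx ?orbT.
rewrite sin0 cos0 subr0 cosD => hs hc.
have -> : cos th * cos u - sin th * sin u - cos th =
    cos th * (cos u - 1) - sin th * sin u by ring.
apply: le_lt_trans (ler_normB _ _) _; rewrite !normrM.
have := cos_max th; have := sin_max th => h1 h2.
have h3 : `|cos th| * `|cos u - 1| <= `|cos u - 1| by rewrite ler_piMl.
have h4 : `|sin th| * `|sin u| <= `|sin u| by rewrite ler_piMl.
lra.
Qed.

(* The strip of width [2 eps] bounds both differences of [cos] at the ends and
   at the midpoint [m] of the arc, hence [|sin m sin u|] and
   [|cos m (1 - cos u)|], and one of [|sin m|], [|cos m|] is not small. *)
Lemma circle_close_circ e : 0 < e ->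
  exists2 d, 0 < d & forall s b, circle_close d (circ s) b ->
    exists2 t, b = circ t & `|t - s| < e.
Proof.
move=> e0.
have pi2 : 0 < pi *+ 2 :> R by rewrite mulrn_wgt0 ?pi_gt0.
(* [u] will be half of the arc: [pi / 2] keeps [sin] monotone up to [h], and [|u| < pi * e] says
   that the arc has length below [e] in the parameter of [circ]. *)
pose h := Num.min (pi / 2) (pi * e).
have h0 : 0 < h by rewrite lt_min divr_gt0 ?mulr_gt0 ?pi_gt0.
have hpi : h <= pi / 2 by rewrite ge_min lexx.
have sh0 : 0 < sin h.
  by apply: sin_gt0_pi; rewrite h0 /=; have := pi_gt0 R; lra.
exists (sin h ^+ 2 / 4); first by rewrite divr_gt0 // exprn_gt0.
set d := _ / 4; move=> s b [th [dd [dpi sth -> close]]].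
exists (s + dd / (pi *+ 2)).
  have -> : circ (s + dd / (pi *+ 2)) =
      ((circ s).1 * cos dd - (circ s).2 * sin dd,
       (circ s).2 * cos dd + (circ s).1 * sin dd).
    rewrite /circ /= -cosD -sinD; congr (cos _, sin _);
      by rewrite mulrDr mulrCA divff ?gt_eqF // mulr1 addrAC.
  by rewrite sth /= cosD sinD.
rewrite addrAC subrr add0r normrM normfV (gtr0_norm pi2) ltr_pdivrMr //.
pose u := dd / 2.
have ddE : dd = u + u by rewrite /u; lra.
have upi : `|u| <= pi / 2 by rewrite /u normrM (@gtr0_norm _ 2^-1) // ler_pM2r.
suff uh : `|u| < h.
  rewrite ddE; apply: le_lt_trans (ler_normD _ _) _.
  have : h <= pi * e by rewrite ge_min lexx orbT.
  by rewrite mulr2n; lra.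
rewrite ltNge; apply/negP => hu.
have sin_u : sin h ^+ 2 <= sin u ^+ 2.
  have -> : sin u ^+ 2 = sin `|u| ^+ 2.
    by have [u0|u0] := leP 0 u;
      rewrite ?(ger0_norm u0) ?(ltr0_norm u0) // sinN sqrrN.
  have : sin h <= sin `|u|.
    move: hu; rewrite le_eqVlt => /predU1P[->//|hu]; apply: ltW.
    have := pi_gt0 R => pi0.
    have hI : h \in `[(- (pi / 2)), pi / 2] by rewrite in_itv /=; apply/andP;
      split; lra.
    have uI : `|u| \in `[(- (pi / 2)), pi / 2].
      by rewrite in_itv /=; apply/andP; split; lra.
    by rewrite (ltr_sin hI uI).
  by move=> hh; rewrite ler_sqr ?nnegrE // ?(le_trans (ltW sh0)) // ltW.
have half01 : 0 <= (2^-1 : R) <= 1 by apply/andP; split; lra.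
have one01 : 0 <= (1 : R) <= 1 by rewrite ler01 lexx.
move: (close _ half01) (close _ one01).
rewrite mul1r; have -> : 2^-1 * dd = u by rewrite /u mulrC.
rewrite sth /= => /andP[l2 r2] /andP[l1 r1].
pose m := th + u.
have thE : th = m - u by rewrite /m; ring.
have thdE : th + dd = m + u by rewrite /m ddE; ring.
rewrite thdE in l1 r1; rewrite -/m in l2 r2; rewrite thE in l1 l2 r1 r2.
rewrite cosB cosD in l1 r1; rewrite cosB in l2 r2.
have cu : 0 <= cos u by apply: cos_ge0_pihalf; rewrite -ler_norml.
have := cos2Dsin2 u; have := cos2Dsin2 m; have := cos_le1 u.
have := sin_le1 u; have := sin_geN1 u.
move: (cos u) (sin u) (cos m) (sin m) cu sin_u l1 r1 l2 r2 => x y a c.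
rewrite /d; move: (sin h ^+ 2) => S x0 Sy l1 r1 l2 r2 y1 y2 x1 ac xy.
(* The three bounds give [y ^+ 2 <= (|a| + |c|) * y ^+ 2 < S], against [S <= y ^+ 2]; the divisor 4
   in [d] makes the two shares add up to [S]. *)
have k1 : `|a| * y ^+ 2 < 3 / 4 * S.
  have : `|a| * (1 - x) < 3 / 8 * S.
    rewrite -[1 - x]ger0_norm ?subr_ge0 // -normrM ltr_norml.
    by apply/andP; split; lra.
  have : y ^+ 2 <= 2 * (1 - x) by nra.
  by have := normr_ge0 a; nra.
have k2 : `|c| * y ^+ 2 < 1 / 4 * S.
  have : `|c| * `|y| < 1 / 8 * S.
    by rewrite -normrM ltr_norml; apply/andP; split; lra.
  have : y ^+ 2 <= `|y|.
    by rewrite -[y ^+ 2]real_normK ?num_real // expr2 ler_piMl // ler_norml y1.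
  by have := normr_ge0 c; have := normr_ge0 y; nra.
have k3 : 1 <= `|a| + `|c|.
  have : `|a| ^+ 2 + `|c| ^+ 2 = 1 by rewrite !real_normK ?num_real.
  by have := normr_ge0 a; have := normr_ge0 c; nra.
by have := sqr_ge0 y; nra.
Qed.

End UnitCircle.

(** * Coordinates of a graph along its cycle *)

Section Coordinates.
Context {R : realType} {n : nat}.

(** For a generator the square selects the edges of the cycle and forgets their direction. *)
Definition circumference (E : finType) (z l : E -> R) : R :=
  \sum_e z e ^+ 2 * l e.

Lemma circumference_opp (E : finType) (z l : E -> R) :
  circumference (fun e => - z e) l = circumference z l.
Proof. by apply: eq_bigr => e _; rewrite sqrrN. Qed.

Section CycleOf.
Context {V E : finType} (G : mgraph R n V E).
Implicit Types (z l : E -> R) (C : cycle_graph R n) (F : {set E}).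

Lemma generatorN z : generator G z -> generator G (fun e => - z e).
Proof.
move=> [z1 [e0 ze0] zC zgen]; split=> [e||phi|x /zgen[c xc]].
- by have [->|z2] := z1 e; rewrite ?oppr0 ?sqrrN; [left|right].
- by exists e0; rewrite oppr_eq0.
- rewrite -[RHS]oppr0 -[X in _ = - X](zC phi) -sumrN.
  by apply: eq_bigr => e _; rewrite mulNr.
- by exists (- c) => e; rewrite mulrNN.
Qed.

Lemma generator_sqr z z' e :
  generator G z -> generator G z' -> z' e ^+ 2 = z e ^+ 2.
Proof.
by move=> zg zg'; case: (generator_unique zg zg') => ->; rewrite ?sqrrN.
Qed.

Lemma generator_circumference z z' l : generator G z -> generator G z' ->
  circumference z' l = circumference z l.
Proof.
by move=> zg zg'; apply: eq_bigr => e _; rewrite (generator_sqr e zg zg').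
Qed.

Lemma generator_norm z e : generator G z -> `|z e| = z e ^+ 2.
Proof.
move=> [/(_ e)[->|z2] _ _ _]; first by rewrite normr0 expr0n.
move/eqP: (z2); rewrite sqrf_eq1 => /orP[] /eqP ->; rewrite ?normrN normr1.
  by rewrite expr1n.
by rewrite sqrrN expr1n.
Qed.

Lemma circumference_gt0 z l F : generator G z -> forest G F ->
  weighting F l -> 0 < circumference z l.
Proof.
move=> zg Ff wFl; have /(forest_generator _ zg)[e ze eF] := Ff.
rewrite /circumference (bigD1 e) //= ltr_pwDl //.
  by rewrite mulr_gt0 ?(weighting_gt0 wFl) // lt_def sqrf_eq0 ze sqr_ge0.
by apply: sumr_ge0 => e' _; rewrite mulr_ge0 ?sqr_ge0 // (wFl e').1.
Qed.

(* Coordinates on the circle of length 1, increasing by [z e * l e / L] along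
   the edge [e]; edges off the cycle have [z e = 0]. *)
Definition coordinates (z l : E -> R) (th : V -> R) : Prop :=
  forall e, th (head G e) - th (tail G e) - z e * l e / circumference z l
    \is a Num.int.

(** Along bridges and edges of weight 0 the position does not change modulo 1, so [C] is the cycle
    left after contracting them and rescaling, obtained without forming a quotient graph. *)
Definition cycle_of (l : E -> R) (C : cycle_graph R n) : Prop :=
  exists z th, [/\ generator G z, coordinates z l th,
    verts C = range (circ \o th) & forall k, pos C k = circ (th (mark G k))].

Lemma reflect_layout z l th C :
    coordinates z l th -> verts C = range (circ \o th) ->
    (forall k, pos C k = circ (th (mark G k))) ->
  [/\ coordinates (fun e => - z e) l (fun v => - th v),
    verts (reflect C) = range (circ \o (fun v => - th v)) &
    forall k, pos (reflect C) k = circ (- th (mark G k))].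
Proof.
move=> thc vE pE; split=> [e||k].
- rewrite circumference_opp mulNr mulNr.
  have -> : - th (head G e) - - th (tail G e) - - (z e * l e / circumference z
    l)
      = - (th (head G e) - th (tail G e) - z e * l e / circumference z l) by
        ring.
  by rewrite rpredN.
- rewrite /= vE image_comp; congr image; apply/funext => v /=.
  by rewrite circN.
- by rewrite /= pE circN.
Qed.

Lemma cycle_of_same l C C' : same_cycle C C' -> cycle_of l C -> cycle_of l C'.
Proof.
move=> CC' [z [th [zg thc vE pE]]].
case: CC' => -[vC pC]; first by exists z, th; split; rewrite ?vC ?pC.
have [thc' vE' pE'] := reflect_layout thc vE pE.
exists (fun e => - z e), (fun v => - th v); split=> //; first exact: generatorN.
  by rewrite vC -vE'.
by move=> k; rewrite pC -pE'.
Qed.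

(** Two solutions differ by a constant modulo 1, and the first mark, placed at [circ 0], makes it an
    integer. *)
Lemma layout_uniq z l th th' C C' : (0 < n)%N -> connected_graph G ->
    coordinates z l th -> verts C = range (circ \o th) ->
    (forall k, pos C k = circ (th (mark G k))) ->
    coordinates z l th' -> verts C' = range (circ \o th') ->
    (forall k, pos C' k = circ (th' (mark G k))) ->
  verts C' = verts C /\ pos C' = pos C.
Proof.
move=> n0 Gc thc vE pE thc' vE' pE'.
pose k0 := Ordinal n0.
have base (th0 : V -> R) (C0 : cycle_graph R n) :
    (forall k, pos C0 k = circ (th0 (mark G k))) ->
    th0 (mark G k0) \is a Num.int.
  move=> pE0; have := pos_first C0 (erefl (val k0)).
  by rewrite pE0 -circ0 => /circ_eq; rewrite subr0.
have diff v : th v - th' v \is a Num.int.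
  apply: (@connected_invariant _ _ _ _ G
    (fun v => th v - th' v \is a Num.int) (mark G k0) v Gc); last first.
    by apply: rpredB; [exact: base pE|exact: base pE'].
  move=> e; have d : (th (head G e) - th' (head G e)) -
      (th (tail G e) - th' (tail G e)) \is a Num.int.
    have := rpredB (thc e) (thc' e); congr (_ \is a Num.int); ring.
  split=> h; first by have := rpredD d h; rewrite subrK.
  by have := rpredB h d; rewrite opprB addrC subrK.
have circE v : circ (th' v) = circ (th v).
  by apply/esym/circ_eq.
split; last by apply/funext => k; rewrite pE pE' circE.
by rewrite vE vE'; congr image; apply/funext => v /=; rewrite circE.
Qed.

(** The generator is unique up to sign, and a change of sign mirrors the cycle. *)
Lemma cycle_of_uniq l C C' : (0 < n)%N -> connected_graph G ->
  cycle_of l C -> cycle_of l C' -> same_cycle C C'.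
Proof.
move=> n0 Gc [z [th [zg thc vE pE]]] [z' [th' [zg' thc' vE' pE']]].
have [/funext zz'|zz'] := generator_unique zg zg'.
  by left; rewrite zz' in thc'; exact: layout_uniq thc' vE' pE'.
have [] := reflect_layout thc' vE' pE'.
have -> : (fun e => - z' e) = z by apply/funext => e; rewrite zz' opprK.
move=> thc1 vE1 pE1; right.
have [<- <-] := layout_uniq n0 Gc thc vE pE thc1 vE1 pE1.
by rewrite image_reflectionK; split=> //; apply/funext => k /=;
  rewrite reflectionK.
Qed.

Section FromAngles.
Variable th : V -> R.
Hypothesis th0 : forall k : 'I_n, val k = 0%N -> th (mark G k) = 0.

Lemma angles_finite : finite_set (range (circ \o th)).
Proof. exact: finite_image. Qed.

Lemma angles_circle : (range (circ \o th) `<=` @circle R)%classic.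
Proof. by move=> _ [v _ <-]; exact: circ_circle. Qed.

Lemma angles_pos k : range (circ \o th) (circ (th (mark G k))).
Proof. by exists (mark G k). Qed.

Lemma angles_first (k : 'I_n) : val k = 0%N -> circ (th (mark G k)) = (-1, 0).
Proof. by move=> /th0 ->; exact: circ0. Qed.

Definition cycle_from : cycle_graph R n :=
  CycleGraph angles_finite angles_circle angles_pos angles_first.

Lemma cycle_of_from z l :
  generator G z -> coordinates z l th -> cycle_of l cycle_from.
Proof. by exists z, th. Qed.

End FromAngles.

(* All weights use the same cut of the cycle at [e0], so that coordinates of
   different weights can be compared as real numbers. *)
Lemma coordinates_exists z l e0 v0 :
    generator G z -> z e0 != 0 -> circumference z l != 0 ->
  exists2 th, th v0 = 0 & forall e, th (head G e) - th (tail G e) =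
    z e * l e / circumference z l - (e == e0)%:R * z e0.
Proof.
move=> [z1 _ zC zgen] ze0 L0.
pose b e := z e * l e / circumference z l - (e == e0)%:R * z e0.
have [|x xP] := @fredholm R V E
    (fun v e => (v == head G e)%:R - (v == tail G e)%:R) b.
  move=> y yv; have /zgen[c yc] : circulation G y.
    apply/circulationP => v; rewrite -[RHS](yv v).
    by apply: eq_bigr => e _; rewrite mulrC.
  (* Around the cycle the increments add up to 1, which the cut at [e0] cancels. *)
  have -> : \sum_e b e * y e = c * ((\sum_e z e ^+ 2 * l e) / circumference z l
      - \sum_e (e == e0)%:R * (z e0 * z e)).
    rewrite mulrBr mulr_suml !mulr_sumr -sumrB; apply: eq_bigr => e _.
    by rewrite /b yc; ring.
  rewrite divff // (bigD1 e0) //= big1 ?addr0 => [|e /negbTE ->];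
    last by rewrite mul0r.
  rewrite eqxx mul1r -expr2.
  by have [z0|->] := z1 e0; [rewrite z0 eqxx in ze0|rewrite subrr mulr0].
exists (fun v => x v - x v0); first exact: subrr.
move=> e; rewrite -/(b e) -xP.
have delta w : \sum_v x v * (v == w)%:R = x w.
  rewrite (bigD1 w) //= eqxx mulr1 big1 ?addr0 // => v /negbTE ->.
  by rewrite mulr0.
under eq_bigr do rewrite mulrBr.
by rewrite sumrB !delta; ring.
Qed.

Lemma cut_coordinates z l e0 th : generator G z ->
    (forall e, th (head G e) - th (tail G e) =
      z e * l e / circumference z l - (e == e0)%:R * z e0) ->
  coordinates z l th.
Proof.
move=> zg thE e; rewrite thE addrAC subrr add0r rpredN.
have z_int : z e0 \is a Num.int.
  have [z1 _ _ _] := zg; have [->|] := z1 e0; first exact: rpred0.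
  by move/eqP; rewrite sqrf_eq1 => /orP[] /eqP ->; rewrite ?rpredN rpred1.
by case: (e == e0); rewrite ?mul1r ?mul0r ?rpred0.
Qed.

(* Grow a set around [u] by one edge at a time: an edge is paid for only when
   it brings in its new endpoint. *)
Lemma connected_variation (w : E -> R) (phi : V -> R) u v :
    connected_graph G -> (forall e, 0 <= w e) ->
    (forall e, `|phi (head G e) - phi (tail G e)| <= w e) ->
  `|phi v - phi u| <= \sum_e w e.
Proof.
move=> Gc w0 wphi.
pose inside (A : {set V}) e := (tail G e \in A) && (head G e \in A).
pose P (A : {set V}) := (u \in A) &&
  [forall v in A, `|phi v - phi u| <= \sum_(e | inside A e) w e].
have Pu : P [set u].
  rewrite /P inE eqxx; apply/forall_inP => a; rewrite inE => /eqP ->.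
  by rewrite subrr normr0 sumr_ge0.
case: (arg_maxnP (fun A : {set V} => #|A|) Pu) =>
  A /andP[uA /forall_inP PA] Amax.
suff AT w' : w' \in A.
  apply: le_trans (PA _ (AT v)) _.
  rewrite [leRHS](bigID (inside A)) /= lerDl; exact: sumr_ge0.
apply/negPn/negP => w'A.
have [e eA] : exists e, (tail G e \in A) != (head G e \in A).
  apply: contrapT => none; case/negP: w'A.
  apply: (@connected_invariant _ _ _ _ G (fun x => x \in A) u w' Gc) uA => e.
  have /negPn/eqP -> // : ~~ ((tail G e \in A) != (head G e \in A)).
  by apply/negP => h; apply: none; exists e.
have [x [xA ex]] : exists x, x \notin A /\
    exists2 a, a \in A & `|phi x - phi a| <= w e /\ inside (x |: A) e.
  move: eA; rewrite /inside; case: (boolP (tail G e \in A)) => tA /=.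
    move=> hA; exists (head G e); split=> //; exists (tail G e) => //.
    by rewrite !inE tA eqxx orbT.
  rewrite eq_sym eqbF_neg negbK => hA; exists (tail G e); split=> //.
  by exists (head G e) => //; rewrite distrC !inE hA eqxx orbT.
have {ex} [a aA [xa eI]] := ex.
have : P (x |: A).
  rewrite /P !inE uA orbT; apply/forall_inP => b; rewrite !inE => bxA.
  have eNA : ~~ inside A e by move: eA; rewrite /inside; case: (_ \in A);
    case: (_ \in A).
  have sub e' : inside A e' -> inside (x |: A) e'.
    by rewrite /inside !inE => /andP[-> ->]; rewrite !orbT.
  have extra : w e + \sum_(e' | inside A e') w e' <= \sum_(e' | inside (x |: A)
    e') w e'.
    rewrite [leRHS](bigD1 e) //= lerD2l.
    rewrite [leRHS](bigID (inside A)) /=.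
    rewrite (eq_bigl (inside A)) ?lerDl ?sumr_ge0 // => e'.
    apply/andP/idP => [[]//|h]; split=> //; rewrite sub //=.
    by apply/eqP => ee; rewrite -ee h in eNA.
  have [/eqP ->|bA] := orP bxA.
    apply: le_trans extra; rewrite -(subrK (phi a) (phi x)) -addrA.
    by apply: le_trans (ler_normD _ _) _; apply: lerD => //; exact: PA.
  by apply: le_trans (PA _ bA) (le_trans _ extra); rewrite lerDr.
move=> /Amax; rewrite cardsU1 xA add1n; apply/negP; rewrite -ltnNge;
  exact: ltnSn.
Qed.

Lemma contract_circumference z l F : weighting F l ->
  circumference (z \o val) (len (contract (reweight G l) F)) = circumference z
    l.
Proof.
move=> wFl; rewrite /circumference [RHS](bigID (mem F)) /= [X in _ = X + _]big1
  ?add0r; last first.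
  by move=> e eF; rewrite (weighting_eq0 wFl eF) mulr0.
rewrite -(sum_notin F (fun e => z e ^+ 2 * l e)); apply: eq_bigr => e _ /=.
by rewrite -[new_len l _]/(len (reweight G l) (val e)) (len_reweight _ wFl)
  ?(valP e).
Qed.


End CycleOf.

Lemma cycle_of_contract (V E : finType) (G : mgraph R n V E) l C F :
  forest G F -> weighting F l -> cycle_of G l C ->
  cycle_of (contract (reweight G l) F) (len (contract (reweight G l) F)) C.
Proof.
move=> Ff wFl [z [th [zg thc vE pE]]].
have [sec secP] := choice (@to_contract_surj _ _ _ _ (reweight G l) F).
(* [th] may jump by an integer along an edge of [F], so [th'] agrees with it only modulo 1,
   whichever section is chosen. *)
pose th' c := th (sec c).
have th'E v : th v - th' (to_contract (reweight G l) F v) \is a Num.int.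
  have /to_contract_eq := secP (to_contract (reweight G l) F v).
  rewrite /th'; move: (sec _) => u uv.
  apply: (@connect_invariant _ _ _ _ (reweight G l) F
    (fun v => th v - th u \is a Num.int) u v _ uv);
      last by rewrite subrr rpred0.
  move=> e eF; have := thc e;
    rewrite (weighting_eq0 wFl eF) mulr0 mul0r subr0 => d.
  split=> h; last by have := rpredB h d; congr (_ \is a Num.int);
    rewrite /tail /head /=; ring.
  by have := rpredD h d; congr (_ \is a Num.int); rewrite /tail /head /=; ring.
have circE v : circ (th' (to_contract (reweight G l) F v)) = circ (th v).
  by apply/esym/circ_eq.
exists (z \o val), th'; split.
- exact: (@contract_generator _ _ _ _ (reweight G l)).
- move=> e; rewrite contract_circumference //.
  rewrite -[len _ e]/(len (reweight G l) (val e)) (len_reweight _ wFl) ?(valP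
    e) //.
  have := rpredD (rpredB (thc (val e)) (th'E (head G (val e)))) (th'E (tail G
    (val e))).
  congr (_ \is a Num.int).
  rewrite [head (contract _ _) e]/(to_contract (reweight G l) F (head G (val
    e))).
  rewrite [tail (contract _ _) e]/(to_contract (reweight G l) F (tail G (val
    e))).
  by rewrite /=; ring.
- rewrite vE; apply/seteqP; split=> _ [v _ <-] /=.
    by exists (to_contract (reweight G l) F v); rewrite //= circE.
  by exists (sec v).
- by move=> k; rewrite pE circE.
Qed.

Lemma cycle_of_iso (V E V' E' : finType) (G : mgraph R n V E)
    (H : mgraph R n V' E') (f : V -> V') (g : E -> E') l l' C :
    bijective f -> bijective g ->
    (forall e, joins H (g e) (f (ends G e).1) (f (ends G e).2)) ->
    (forall k, mark H k = f (mark G k)) -> (forall e, l e = l' (g e)) ->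
  cycle_of G l C -> cycle_of H l' C.
Proof.
move=> f_bij g_bij fg m ll' [z [th [zg thc vE pE]]].
have [f' fK f'K] := f_bij; have [g' gK g'K] := g_bij.
have [z' zg' z'g] := iso_generator f_bij g_bij fg zg.
have LE : circumference z' l' = circumference z l.
  rewrite /circumference (reindex g) /=; last exact: onW_bij.
  by apply: eq_bigr => e _; rewrite z'g -ll' exprMn expr2 iso_sign2 mul1r.
exists z', (th \o f'); split=> //.
- move=> e'; rewrite -(g'K e'); set e := g' e'.
  rewrite (iso_diff fg (th \o f')) /= !fK z'g LE -ll' -!mulrA -mulrBr mulrA.
  by have [->|->] := iso_signN G H f g e; rewrite ?mul1r ?mulN1r ?rpredN;
    exact: thc.
- rewrite vE; apply/seteqP; split=> _ [v _ <-].
    by exists (f v); rewrite //= fK.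
  by exists (f' v).
- by move=> k; rewrite /= m fK.
Qed.

Lemma cycle_of_isometric (V E V' E' : finType) (G : mgraph R n V E)
    (H : mgraph R n V' E') C :
  isometric G H -> cycle_of G (len G) C -> cycle_of H (len H) C.
Proof. by move=> [f [g [bf bg j l m]]]; exact: cycle_of_iso bf bg j m l. Qed.

End Coordinates.

(** * From graphs to cycles *)

Section Positions.
Context {R : realType} {n : nat}.
Hypothesis n_gt0 : (0 < n)%N.

Lemma forest_set0 (V E : finType) (G : mgraph R n V E) : forest G finset.set0.
Proof. by move=> [k [v [c [_ _ /(_ ord0)[]]]]]; rewrite inE. Qed.

Lemma weighting_len (V E : finType) (G : mgraph R n V E) :
  weighting finset.set0 (len G).
Proof. by move=> e; rewrite inE gt_eqF ?len_gt0 // ltW // len_gt0. Qed.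

Lemma circumference_len_gt0 (V E : finType) (G : mgraph R n V E) z :
  generator G z -> 0 < circumference z (len G).
Proof.
by move=> zg; apply: (circumference_gt0 zg (@forest_set0 _ _ G));
  exact: weighting_len.
Qed.

Lemma mark_first (V E : finType) (G : mgraph R n V E) (k : 'I_n) :
  val k = 0%N -> mark G k = mark G (Ordinal n_gt0).
Proof. by move=> k0; congr mark; exact: val_inj. Qed.

Lemma cycle_of_exists (V E : finType) (G : mgraph R n V E) z l :
  generator G z -> circumference z l != 0 -> exists C, cycle_of G l C.
Proof.
move=> zg L0; have [_ [e0 ze0] _ _] := zg.
have [th th0 thE] := coordinates_exists (mark G (Ordinal n_gt0)) zg ze0 L0.
have thf (k : 'I_n) : val k = 0%N -> th (mark G k) = 0.
  by move=> /(mark_first G) ->.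
exists (cycle_from thf); exact: cycle_of_from zg (cut_coordinates zg thE).
Qed.

Lemma genus1_graph_genus1 (G : genus1_graph R n) : genus1 G.
Proof. by split; [exact: genus1_connected|exact: genus1_betti]. Qed.

Lemma genus1_generator (V E : finType) (G : mgraph R n V E) :
  genus1 G -> exists z, generator G z.
Proof. by move=> [_ /generator_betti1]. Qed.

Lemma cycle_of_repr (x : MG R n) : exists C, cycle_of (repr x) (len (repr x)) C.
Proof.
have [z zg] := genus1_generator (genus1_graph_genus1 (repr x)).
by apply: (cycle_of_exists zg); rewrite gt_eqF ?circumference_len_gt0.
Qed.

Definition positions (x : MG R n) : X R n :=
  \pi_(X R n) (projT1 (cid (cycle_of_repr x))).

Lemma positionsE (V E : finType) (G : mgraph R n V E) x C :
  represents G x -> cycle_of G (len G) C -> positions x = \pi_(X R n) C.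
Proof.
move=> Gx GC; apply/eqmodP/asboolP.
have Gr := represents_uniq Gx (represents_repr x).
apply: (cycle_of_uniq n_gt0 (represents_genus1 (represents_repr x)).1).
  exact: projT2 (cid (cycle_of_repr x)).
exact: cycle_of_isometric GC.
Qed.

Definition cycle_length (x : MG R n) : R :=
  circumference (projT1 (cid (genus1_generator (genus1_graph_genus1 (repr x)))))
    (len (repr x)).

Lemma cycle_lengthE (V E : finType) (G : mgraph R n V E) x z :
  represents G x -> generator G z -> circumference z (len G) = cycle_length x.
Proof.
move=> Gx zg; have [f [g [bf bg j l m]]] :=
  represents_uniq Gx (represents_repr x).
have [z' zg' z'g] := iso_generator bf bg j zg.
rewrite /cycle_length; case: cid => z0 zg0 /=.
rewrite (generator_circumference (len (repr x)) zg' zg0).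
rewrite /circumference [RHS](reindex g) /=; last exact: onW_bij.
by apply: eq_bigr => e _;
  rewrite z'g exprMn [iso_sign _ _ _ _ _ ^+ 2]expr2 iso_sign2 mul1r l.
Qed.

Lemma cycle_length_gt0 x : 0 < cycle_length x.
Proof.
have [z zg] := genus1_generator (genus1_graph_genus1 (repr x)).
by rewrite -(cycle_lengthE (represents_repr x) zg) circumference_len_gt0.
Qed.

Section Variation.
Context {V E : finType} (G : mgraph R n V E) (z l l' : E -> R).
Hypothesis zg : generator G z.

Lemma generator_sqr_le1 e : z e ^+ 2 <= 1.
Proof. by have [/(_ e)[->|->] _ _ _] := zg; rewrite ?expr0n. Qed.

Lemma circumference_dist :
  `|circumference z l - circumference z l'| <= \sum_e `|l e - l' e|.
Proof.
rewrite /circumference -sumrB; apply: le_trans (ler_norm_sum _ _ _) _.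
apply: ler_sum => e _; rewrite -mulrBr normrM ger0_norm ?sqr_ge0 //.
by rewrite ler_piMl // generator_sqr_le1.
Qed.

(** Split each difference into [(l e - l' e) / L] and [l' e * (1 / L - 1 / L')]. On the cycle the
    weights [l'] add up to [L'], so the second parts contribute [|L - L'| / L], which is bounded
    like the first. *)
Lemma slope_dist : 0 < circumference z l -> 0 < circumference z l' ->
    (forall e, 0 <= l' e) ->
  \sum_e `|z e * l e / circumference z l - z e * l' e / circumference z l'| <=
  2 * (\sum_e `|l e - l' e|) / circumference z l.
Proof.
move=> L0 L'0 l'0; have := circumference_dist.
set L := circumference z l in L0 *; set L' := circumference z l' in L'0 *.
set D := \sum_e `|_ - _| => LD.
apply: le_trans (_ : \sum_e (`|l e - l' e| / L +
   z e ^+ 2 * l' e * (`|L - L'| / (L * L'))) <= _).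
  apply: ler_sum => e _.
  have -> : z e * l e / L - z e * l' e / L' =
      z e * ((l e - l' e) / L) + z e * (l' e * ((L' - L) / (L * L'))).
    by field; rewrite !gt_eqF.
  apply: le_trans (ler_normD _ _) _; apply: lerD.
    rewrite normrM (generator_norm e zg) normrM normfV (gtr0_norm L0).
    by rewrite ler_piMl ?generator_sqr_le1 // divr_ge0 // ltW.
  rewrite normrM (generator_norm e zg) normrM (ger0_norm (l'0 e)) normrM distrC.
  by rewrite normfV normrM (gtr0_norm L0) (gtr0_norm L'0) mulrA.
rewrite big_split /= -!mulr_suml -/D -[X in _ + X * _]/L'.
have -> : L' * (`|L - L'| / (L * L')) = `|L - L'| / L by field; rewrite !gt_eqF.
rewrite -mulrDl ler_pM2r ?invr_gt0 //; lra.
Qed.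

End Variation.

Lemma continuous_positions : continuous positions.
Proof.
apply: (continuous_criterion open_MGP) => x V oV Vx.
have [e e0 eV] := (open_XP V).1 oV _ Vx.
have [d d0 dclose] := circ_close e0.
have L0 := cycle_length_gt0 x.
(* By [slope_dist] an [l^1] error below this moves the angles by less than [d]. *)
have eps0 : 0 < d * cycle_length x / 2 by rewrite divr_gt0 // mulr_gt0.
have [r r0 rP] := near_represents x eps0.
exists r => // y /rP[H [F [l [-> Ff wFl Hx small]]]]; apply: eV.
have [z zg] := genus1_generator (genus1_graph_genus1 H).
have LE : circumference z l = cycle_length x.
  rewrite -(contract_circumference H z wFl).
  by apply: (cycle_lengthE Hx);
    exact: (@contract_generator _ _ _ _ (reweight H l)).
have [_ [e1 ze1] _ _] := zg; pose v0 := mark H (Ordinal n_gt0).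
have L0' := circumference_len_gt0 zg.
have [th th0 thE] : exists2 th, th v0 = 0 & forall e,
  th (head H e) - th (tail H e) =
    z e * l e / circumference z l - (e == e1)%:R * z e1.
  by apply: coordinates_exists => //; rewrite LE gt_eqF.
have [th' th0' thE'] := coordinates_exists v0 zg ze1 (lt0r_neq0 L0').
have thf (k : 'I_n) : val k = 0%N -> th (mark H k) = 0.
  by move=> /(mark_first H) ->.
have thf' (k : 'I_n) : val k = 0%N -> th' (mark H k) = 0.
  by move=> /(mark_first H) ->.
have HC := cycle_of_from thf zg (cut_coordinates zg thE).
have HC' := cycle_of_from thf' zg (cut_coordinates zg thE').
rewrite (positionsE (represents_pi H) HC').
rewrite (positionsE Hx (cycle_of_contract Ff wFl HC)).
exists (cycle_from thf), (cycle_from thf'); split=> //.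
have dist v : `|th v - th' v| < d.
  have : `|(th v - th' v) - (th v0 - th' v0)| <= \sum_e
      `|z e * l e / circumference z l - z e * len H e / circumference z (len
        H)|.
    apply: (@connected_variation _ _ _ _ H _ (fun v => th v - th' v)) =>
      [|//|a].
      exact: genus1_connected.
    have -> : forall a b c d : R,
      a - b - (c - d) = (a - c) - (b - d) by move=> *; ring.
    by rewrite thE thE' le_eqVlt; apply/orP; left; apply/eqP; congr `|_|; ring.
  rewrite th0 th0' subrr subr0 => /le_lt_trans; apply.
  have := slope_dist zg _ L0' (fun e => ltW (len_gt0 H e)).
  rewrite -LE in L0 eps0 small; move=> /(_ _ L0)/le_lt_trans; apply.
  by rewrite ltr_pdivrMr // mulrC -ltr_pdivlMr.
have closeth v : circle_close e (circ (th v)) (circ (th' v)) by exact: dclose.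
have closeth' v : circle_close e (circ (th' v)) (circ (th v)).
  by apply: dclose; rewrite distrC.
split=> [k|_ [v _ <-]|_ [v _ <-]]; first exact: closeth.
  by exists (circ (th v)); [exists v|exact: closeth'].
by exists (circ (th' v)); [exists v|exact: closeth].
Qed.

End Positions.

(** * The polygon of a cycle *)

Section Polygon.
Context {R : realType} {n : nat}.
Hypothesis n_gt0 : (0 < n)%N.
Variable C : cycle_graph R n.

Definition angle_of (p : R * R) : R :=
  xget 0 [set t | 0 <= t < 1 /\ circ t = p]%classic.

Lemma angle_ofP p : circle p -> 0 <= angle_of p < 1 /\ circ (angle_of p) = p.
Proof.
move=> /circ_surj[t t01 tp]; rewrite /angle_of.
by case: xgetP => [s _ //|/(_ t)]; case.
Qed.

Lemma angle_ofK t : 0 <= t < 1 -> angle_of (circ t) = t.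
Proof.
move=> t01; have [a01 ae] := angle_ofP (circ_circle t).
exact: circ_inj.
Qed.

Definition angle_set : set R :=
  [set t | 0 <= t < 1 /\ verts C (circ t)]%classic.

Lemma angle_set_finite : finite_set angle_set.
Proof.
apply: sub_finite_set (finite_image angle_of (verts_finite C)) => t [t01 Ct].
by exists (circ t); rewrite ?angle_ofK.
Qed.

Definition angle : finType := fset_set angle_set.

Lemma angleP t : angle_set t -> exists a : angle, val a = t.
Proof.
move=> At; have tA : t \in fset_set angle_set.
  by rewrite in_fset_set ?inE //; exact: angle_set_finite.
by exists (FSetSub tA).
Qed.

Lemma angle_valP (a : angle) : angle_set (val a).
Proof.
have := valP a; rewrite in_fset_set ?inE //; exact: angle_set_finite.
Qed.

Lemma angle_ge0 (a : angle) : 0 <= val a.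
Proof. by have [/andP[]] := angle_valP a. Qed.

Lemma angle_lt1 (a : angle) : val a < 1.
Proof. by have [/andP[]] := angle_valP a. Qed.

Lemma vert_angle p : verts C p -> exists a : angle, circ (val a) = p.
Proof.
move=> Cp; have [p01 pE] := angle_ofP (verts_circle Cp).
have [|a aE] := @angleP (angle_of p); first by split; rewrite ?pE.
by exists a; rewrite aE.
Qed.

(** The default 1 closes the cycle: after the last angle comes the base point, seen at 1 instead of
    0. *)
Definition next_angle (t : R) : R :=
  \big[Num.min/1]_(b : angle | t < val b) val b.

Lemma next_angle_gt t : t < 1 -> t < next_angle t.
Proof. by move=> t1; apply: lt_bigmin. Qed.

Lemma next_angle_le1 t : next_angle t <= 1.
Proof. exact: bigmin_le_id. Qed.

Lemma next_angle_le t (b : angle) : t < val b -> next_angle t <= val b.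
Proof. exact: bigmin_le_cond. Qed.

Lemma next_angle_cases t :
  next_angle t = 1 \/ exists2 b : angle, next_angle t = val b & t < val b.
Proof.
rewrite /next_angle.
apply: (big_ind (fun x => x = 1 \/ exists2 b : angle, x = val b & t < val b)).
- by left.
- by move=> x y Px Py; rewrite /Num.min; case: ifP.
- by move=> b tb; right; exists b.
Qed.

Lemma zero_angle_exists : exists a : angle, val a = 0.
Proof.
apply: angleP; rewrite /angle_set /= lexx ltr01 circ0; split=> //.
rewrite -(pos_first C (k := Ordinal n_gt0)) //; exact: pos_verts.
Qed.

Definition zero_angle : angle := projT1 (cid zero_angle_exists).

Lemma zero_angleE : val zero_angle = 0.
Proof. exact: projT2 (cid zero_angle_exists). Qed.

Lemma next_vertex_exists (a : angle) : exists b : angle,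
  val b = next_angle (val a) - (next_angle (val a) == 1)%:R.
Proof.
have [n1|[b nb _]] := next_angle_cases (val a).
  by exists zero_angle; rewrite zero_angleE n1 eqxx subrr.
by exists b; rewrite nb lt_eqF ?angle_lt1 // subr0.
Qed.

Definition next_vertex (a : angle) : angle :=
  projT1 (cid (next_vertex_exists a)).

Lemma next_vertexE a :
  val (next_vertex a) = next_angle (val a) - (next_angle (val a) == 1)%:R.
Proof. exact: projT2 (cid (next_vertex_exists a)). Qed.

Lemma next_vertex_zero a :
  (next_vertex a == zero_angle) = (next_angle (val a) == 1).
Proof.
rewrite -val_eqE zero_angleE next_vertexE.
have [->|ne] := eqVneq (next_angle (val a)) 1; first by rewrite subrr eqxx.
rewrite subr0 gt_eqF // (le_lt_trans (angle_ge0 a)) // next_angle_gt //.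
exact: angle_lt1.
Qed.

Lemma next_vertex_inj : injective next_vertex.
Proof.
suff main a b : val a < val b -> next_vertex a = next_vertex b -> False.
  move=> a b ab; apply/val_inj; case: (ltgtP (val a) (val b)) => // lt; exfalso.
    exact: main lt ab.
  exact: main lt (esym ab).
move=> ab /(congr1 val); rewrite !next_vertexE.
have na := next_angle_le ab; have ga := next_angle_gt (angle_lt1 a).
have gb := next_angle_gt (angle_lt1 b); have b1 := angle_lt1 b.
have a0 := angle_ge0 a.
rewrite (lt_eqF (le_lt_trans na b1)) subr0.
have [->|_] := eqVneq (next_angle (val b)) 1; rewrite ?subrr ?subr0; lra.
Qed.

Lemma mark_angle_exists k : exists a : angle, circ (val a) = pos C k.
Proof. by apply: vert_angle; exact: pos_verts. Qed.

Lemma gap_gt0 (a : angle) : 0 < next_angle (val a) - val a.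
Proof. by rewrite subr_gt0 next_angle_gt // angle_lt1. Qed.

(** Each edge is named by the vertex it leaves; a cycle with a single vertex becomes a loop of
    length 1. *)
Definition polygon : mgraph R n angle angle :=
  @MGraph R n angle angle (fun a => (a, next_vertex a))
    (fun a => next_angle (val a) - val a)
    gap_gt0
    (fun k => projT1 (cid (mark_angle_exists k))).

Lemma polygon_mark k : circ (val (mark polygon k)) = pos C k.
Proof. exact: projT2 (cid (mark_angle_exists k)). Qed.

Lemma polygon_connected : connected_graph polygon.
Proof.
have step (a : angle) :
    connect (adj polygon (finset.setTfor _)) a (next_vertex a).
  by have := @connect_ends _ _ _ _ polygon (finset.setTfor _) a; apply;
    rewrite inE.
have main (a : angle) : connect (adj polygon (finset.setTfor _)) zero_angle a.
  apply/negPn/negP => aN.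
  pose P (b : angle) :=
    connect (adj polygon (finset.setTfor _)) zero_angle b && (val b < val a).
  have P0 : P zero_angle.
    rewrite /P connect0 /= lt_def zero_angleE angle_ge0 andbT.
    apply: contra aN => /eqP a0; rewrite (_ : a = zero_angle) ?connect0 //.
    by apply: val_inj; exact: etrans a0 (esym zero_angleE).
  (* Take the largest reachable angle [b] below [a]: its successor is reachable and at most [a], so
     it is [a] or contradicts maximality. *)
  case: (Order.TotalTheory.arg_maxP (fun b : angle => val b) P0) =>
    b /andP[cb ba] bmax.
  have cnb := connect_trans cb (step b).
  have nba := next_angle_le ba.
  have nb : val (next_vertex b) = next_angle (val b).
    by rewrite next_vertexE lt_eqF ?subr0 // (le_lt_trans nba) ?angle_lt1.
  have : P (next_vertex b).
    rewrite /P cnb /= lt_def nb nba andbT; apply: contra aN => /eqP ab.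
    by rewrite (_ : a = next_vertex b) //; apply: val_inj;
      exact: etrans ab (esym nb).
  move=> /bmax; rewrite -[X in X -> _]/(is_true (val (next_vertex b) <= val b))
    nb leNgt => /negP; apply.
  exact: next_angle_gt (angle_lt1 b).
by move=> a b; apply: connect_trans (main b); rewrite connectC.
Qed.

Lemma sum_next (h : angle -> R) : \sum_a h (next_vertex a) = \sum_a h a.
Proof. by rewrite [RHS](reindex_inj next_vertex_inj). Qed.

Lemma polygon_circulation (c : R) : circulation polygon (fun=> c).
Proof. by move=> phi; rewrite -mulr_sumr sumrB sum_next subrr mulr0. Qed.

(** Each vertex has one incoming and one outgoing edge, so a circulation is constant along the
    polygon. *)
Lemma polygon_generator : generator polygon (fun=> 1).
Proof.
split=> [e|||x xC].
- by right; rewrite expr1n.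
- by exists zero_angle; rewrite oner_eq0.
- exact: polygon_circulation.
exists (x zero_angle) => a; rewrite mulr1.
apply: (@connected_invariant _ _ _ _ polygon (fun b => x b = x zero_angle)
  zero_angle a polygon_connected) => // b.
suff -> : x (head polygon b) = x b by [].
have := xC (fun v => (v == next_vertex b)%:R).
under eq_bigr do rewrite mulrBr.
rewrite sumrB (bigD1 b) //= eqxx mulr1 big1 ?addr0 => [|a' /negbTE ab];
  last first.
  by rewrite /head /= (inj_eq next_vertex_inj) ab mulr0.
rewrite (bigD1 (next_vertex b)) //= eqxx mulr1 big1 ?addr0 => [|a' /negbTE ab].
  by move=> /eqP; rewrite subr_eq0 => /eqP ->.
by rewrite /tail /= ab mulr0.
Qed.

Lemma polygon_genus1 : genus1 polygon.
Proof.
split; first exact: polygon_connected.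
by apply/generator_betti1; exists (fun=> 1); exact: polygon_generator.
Qed.

Lemma sum_gap (s : R -> R) :
  \sum_(a : angle) (s (next_angle (val a)) - s (val a)) = s 1 - s 0.
Proof.
have sE a : s (next_angle (val a)) = s (val (next_vertex a)) +
    (next_vertex a == zero_angle)%:R * (s 1 - s 0).
  have [nz|nz] := eqVneq (next_vertex a) zero_angle.
    have /eqP -> : next_angle (val a) == 1 by rewrite -next_vertex_zero nz.
    by rewrite nz zero_angleE mul1r addrC subrK.
  have /negbTE n1 : next_angle (val a) != 1 by rewrite -next_vertex_zero.
  by rewrite next_vertexE n1 subr0 mul0r addr0.
under eq_bigr do rewrite sE.
rewrite sumrB big_split /= (sum_next (fun a => s (val a))).
rewrite (sum_next (fun a => (a == zero_angle)%:R * (s 1 - s 0))).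
rewrite addrAC subrr add0r (bigD1 zero_angle) //= eqxx mul1r big1 ?addr0 //.
by move=> a /negbTE ->; rewrite mul0r.
Qed.

Lemma polygon_circumference (s : R -> R) : s 0 = 0 -> s 1 = 1 ->
  circumference (fun=> 1) (fun a : angle =>
    s (next_angle (val a)) - s (val a)) = 1.
Proof.
move=> s0 s1; rewrite /circumference.
under eq_bigr do rewrite expr1n mul1r.
by rewrite sum_gap s0 s1 subr0.
Qed.

(** [s] relocates the vertices. It is the identity when the polygon is compared with its own cycle,
    and a snapping map when it is compared with a nearby one. *)
Lemma polygon_cycle_of (s : R -> R) (C' : cycle_graph R n) :
    s 0 = 0 -> s 1 = 1 ->
    verts C' = range (fun a : angle => circ (s (val a))) ->
    (forall k, pos C' k = circ (s (val (mark polygon k)))) ->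
  cycle_of polygon (fun a => s (next_angle (val a)) - s (val a)) C'.
Proof.
move=> s0 s1 vE pE; exists (fun=> 1), (fun a => s (val a)); split=> //.
  exact: polygon_generator.
move=> a; rewrite polygon_circumference // divr1 mul1r [tail _ _]/= [head _
  _]/=.
rewrite opprB addrA subrK next_vertexE.
have [->|_] := eqVneq (next_angle (val a)) 1.
  by rewrite subrr s0 s1 sub0r rpredN rpred1.
by rewrite subr0 subrr rpred0.
Qed.

Lemma polygon_self : cycle_of polygon (len polygon) C.
Proof.
apply: (@polygon_cycle_of id) => //.
  apply/seteqP; split=> [p /vert_angle[a <-]|_ [a _ <-]]; first by exists a.
  by have [] := angle_valP a.
by move=> k; rewrite polygon_mark.
Qed.

End Polygon.

(** * A contraction to its cycle is a polygon *)

Section Tiling.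
Context {R : realType} {n : nat} {V E : finType} (G : mgraph R n V E).
Variables (z l : E -> R) (F : {set E}) (th : V -> R).
Hypotheses (G_connected : connected_graph G) (z_generator : generator G z).
Hypotheses (F_weighting : weighting F l) (bridges_F : forall e,
  z e = 0 -> e \in F).
Hypothesis length1 : circumference z l = 1.
Hypothesis th_coordinates : coordinates G z l th.

Definition tau v := frac (th v).
Definition src e := if z e < 0 then head G e else tail G e.
Definition dst e := if z e < 0 then tail G e else head G e.

(* 1 if the arc from [tau (src e)] to [tau (dst e)] wraps around, else 0. *)
Definition wrap e := l e - (tau (dst e) - tau (src e)).

(* 1 if the angle [t] lies on the arc of the edge [e], else 0. *)
Definition covers e (t : R) : R :=
  (tau (src e) <= t)%R%:R - (tau (dst e) <= t)%R%:R + wrap e.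

Lemma tau_ge0 v : 0 <= tau v.
Proof. by have /andP[] := frac_itv (th v). Qed.

Lemma tau_lt1 v : tau v < 1.
Proof. by have /andP[] := frac_itv (th v). Qed.

Lemma weight_ge0 e : 0 <= l e.
Proof. by have [] := F_weighting e. Qed.

Lemma generator_cases e : [\/ z e = 0, z e = 1 | z e = -1].
Proof.
have [/(_ e)[z0|z2] _ _ _] := z_generator; first by constructor 1.
by move/eqP: z2; rewrite sqrf_eq1 => /orP[] /eqP; [constructor 2|constructor 3].
Qed.

Lemma flow_diff (phi : V -> R) e :
  z e * (phi (head G e) - phi (tail G e)) =
  if z e != 0 then phi (dst e) - phi (src e) else 0.
Proof.
rewrite /dst /src; have [->|->|->] := generator_cases e.
- by rewrite eqxx mul0r.
- by rewrite oner_eq0 ltr10 mul1r.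
- by rewrite oppr_eq0 oner_eq0 ltrN10 mulN1r opprB.
Qed.

Lemma flow_sum0 (phi : V -> R) : \sum_(e | z e != 0) (phi (dst e) - phi (src
  e)) = 0.
Proof.
have [_ _ /(_ phi) flow0 _] := z_generator.
rewrite big_mkcond /= -[RHS]flow0.
by apply: eq_bigr => e _; rewrite flow_diff.
Qed.

Lemma wrap_int e : wrap e \is a Num.int.
Proof.
have := th_coordinates e; rewrite length1 divr1.
have d v : th v - tau v \is a Num.int by exact: frac_int.
have dd := rpredB (d (dst e)) (d (src e)).
have l0 : z e = 0 -> l e = 0 by move=> /bridges_F; exact: weighting_eq0.
rewrite /wrap; move: dd; rewrite /dst /src.
have [z0|z1|z1] := generator_cases e.
- rewrite z0 ltxx l0 // mulr0 subr0 => dd h.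
  by have := rpredB dd h; congr (_ \is a Num.int); ring.
- rewrite z1 ltr10 mul1r => dd h.
  by have := rpredB dd h; congr (_ \is a Num.int); ring.
- rewrite z1 ltrN10 mulN1r => dd h.
  by have := rpredD dd h; congr (_ \is a Num.int); ring.
Qed.

Lemma weight_le1 e : l e <= 1.
Proof.
have [ze|ze] := eqVneq (z e) 0.
  by rewrite (weighting_eq0 F_weighting) ?bridges_F.
have z2 : z e ^+ 2 = 1.
  by have [/(_ e)[z0|//] _ _ _] := z_generator; rewrite z0 eqxx in ze.
rewrite -length1 /circumference (bigD1 e) //= z2 mul1r lerDl.
by apply: sumr_ge0 => e' _; rewrite mulr_ge0 ?sqr_ge0 ?weight_ge0.
Qed.

(** An integer strictly between -1 and 2, as [l e] lies in [0, 1] and [tau] takes values in [0,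
    1). *)
Lemma wrap_cases e : wrap e = 0 \/ wrap e = 1.
Proof.
have wi := wrap_int e; have w1 := weight_le1 e; have w0 := weight_ge0 e.
have := tau_ge0 (src e); have := tau_lt1 (src e).
have := tau_ge0 (dst e); have := tau_lt1 (dst e) => d1 d0 s1 s0.
have [k1|k1] := ltP (wrap e) 1; [left|right].
  by apply: int_lt1 => //; rewrite ltr_norml k1 andbT /wrap; lra.
apply/eqP; rewrite -subr_eq0; apply/eqP; apply: int_lt1.
  by rewrite rpredB // rpred1.
by rewrite ltr_norml; apply/andP; split; rewrite /wrap in k1 *; lra.
Qed.

Lemma dst_wrap e : tau (src e) + l e = tau (dst e) + wrap e.
Proof. by rewrite /wrap; ring. Qed.

Lemma tau_forest e : e \in F -> tau (tail G e) = tau (head G e).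
Proof.
move=> eF; have l0 := weighting_eq0 F_weighting eF.
have := dst_wrap e; rewrite l0 addr0 => sd.
have [w0|w1] := wrap_cases e.
  by move: sd; rewrite w0 addr0 /src /dst; case: ifP => _ ->.
have := tau_lt1 (src e); have := tau_ge0 (dst e).
by rewrite sd w1; lra.
Qed.

Lemma sum_wrap : \sum_(e | z e != 0) wrap e = 1.
Proof.
rewrite sumrB flow_sum0 subr0 -length1 /circumference big_mkcond /=.
apply: eq_bigr => e _; have [->|->|->] := generator_cases e.
- by rewrite eqxx expr0n mul0r.
- by rewrite oner_eq0 expr1n mul1r.
- by rewrite oppr_eq0 oner_eq0 sqrrN expr1n mul1r.
Qed.

(** Conservation makes the number of arcs through [t] independent of [t]; it equals the number of
    wraps, which is the circumference. Hence the arcs tile the circle. *)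
Lemma sum_covers t : \sum_(e | z e != 0) covers e t = 1.
Proof.
rewrite big_split /= sum_wrap -[RHS]add0r; congr (_ + _).
rewrite -[RHS]oppr0 -[X in _ = - X](flow_sum0 (fun v =>
  (tau v <= t)%R%:R)) -sumrN.
by apply: eq_bigr => e _; rewrite opprB.
Qed.

Lemma covers_ge0 e t : 0 <= covers e t.
Proof.
have w0 := weight_ge0 e; have := dst_wrap e; rewrite /covers.
have [->|->] := wrap_cases e; rewrite ?addr0 => sd.
  have [d|_] := boolP (tau (dst e) <= t).
    by rewrite (_ : tau (src e) <= t) ?subrr //; lra.
  by rewrite subr0 ler0n.
by rewrite -addrA addr_ge0 ?ler0n // addrC subr_ge0 lern1 leq_b1.
Qed.

Lemma covers_uniq e e' t : z e != 0 -> z e' != 0 ->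
  1 <= covers e t -> 1 <= covers e' t -> e = e'.
Proof.
move=> ze ze' c c'; apply/eqP/negPn/negP => ee'; have := sum_covers t.
rewrite (bigD1 e) //= (bigD1 e') /=; last by rewrite ze' eq_sym.
have : 0 <= \sum_(i | (z i != 0) && (i != e) && (i != e')) covers i t.
  by apply: sumr_ge0 => i _; exact: covers_ge0.
by lra.
Qed.

Lemma covers_arc e t : tau (src e) <= t -> t < tau (src e) + l e -> 1 <= covers
  e t.
Proof.
rewrite dst_wrap /covers => ->; have [->|->] := wrap_cases e; rewrite ?addr0.
  by rewrite ltNge => /negbTE ->; rewrite subr0.
by move=> _; case: (_ <= t); rewrite /= ?mulr1n ?mulr0n; lra.
Qed.

Lemma covers_wrap e t : wrap e = 1 -> t < tau (dst e) -> 1 <= covers e t.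
Proof.
rewrite /covers => ->; rewrite ltNge => /negbTE ->.
by case: (_ <= t); rewrite /= ?mulr1n ?mulr0n; lra.
Qed.

Lemma notin_generator e : e \notin F -> z e != 0.
Proof. by apply: contra => /eqP/bridges_F. Qed.

Lemma src_inj e e' : e \notin F -> e' \notin F ->
  tau (src e) = tau (src e') -> e = e'.
Proof.
move=> eF e'F ee'; have := weighting_gt0 F_weighting eF.
have := weighting_gt0 F_weighting e'F => l0' l0.
apply: (@covers_uniq _ _ (tau (src e))); rewrite ?notin_generator //.
  by apply: covers_arc; rewrite ?lexx // ltrDl.
by apply: covers_arc; rewrite ee' ?lexx // ltrDl.
Qed.

Lemma tau_connect u v : connect (adj G F) u v -> tau u = tau v.
Proof.
move=> uv; apply: (@connect_invariant _ _ _ _ G F (fun w =>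
  tau u = tau w) u v) => //.
by move=> e /tau_forest ->.
Qed.

(** If no edge outside [F] left the component, conservation would forbid edges outside [F] to enter
    it. Then it would be the whole connected graph, although some edge lies outside [F]. *)
Lemma out_edge v : exists2 e, e \notin F & connect (adj G F) v (src e).
Proof.
pose D w := connect (adj G F) v w.
have DF e : e \in F -> D (tail G e) = D (head G e).
  move=> eF; have te := connect_ends G eF; apply/idP/idP => h.
    exact: connect_trans h te.
  by apply: connect_trans h _; rewrite connectC.
apply: contrapT => none.
have srcN e : e \notin F -> D (src e) = false.
  by move=> eF; apply/negP => h; apply: none; exists e.
have dstN e : e \notin F -> D (dst e) = false.
  move=> eF; have := flow_sum0 (fun w => (D w)%:R).
  rewrite (eq_bigr (fun e => (e \notin F)%:R * (D (dst e))%:R)); last first.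
    move=> e' _; have [e'F|e'F] := boolP (e' \in F).
      by rewrite mul0r /dst /src; case: ifP => _; rewrite DF // subrr.
    by rewrite (srcN _ e'F) subr0 mul1r.
  move/eqP; rewrite psumr_eq0 => [|e' _]; last by rewrite mulr_ge0 ?ler0n.
  move/allP/(_ e); rewrite mem_index_enum notin_generator // eF mul1r.
  by move/(_ isT)/implyP/(_ isT); rewrite pnatr_eq0 eqb0 => /negbTE.
have DE e : D (tail G e) <-> D (head G e).
  have [eF|eF] := boolP (e \in F); first by rewrite (DF _ eF).
  have := srcN e eF; have := dstN e eF; rewrite /src /dst.
  by case: ifP => _ -> ->.
have [e eF] : exists e, e \notin F.
  apply: contrapT => allF; have := length1;
    rewrite /circumference big1 => [|e _].
    by move/eqP; rewrite eq_sym oner_eq0.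
  rewrite (weighting_eq0 F_weighting) ?mulr0 //.
  by apply/negPn/negP => h; apply: allF; exists e.
have : D (src e).
  apply: (@connected_invariant _ _ _ _ G (fun w => D w) v _ G_connected DE).
  exact: connect0.
by rewrite srcN.
Qed.

Section NextVertex.
Hypothesis n_gt0 : (0 < n)%N.
Variable C : cycle_graph R n.
Hypothesis vertsE : verts C = range (circ \o th).
Hypothesis posE : forall k, pos C k = circ (th (mark G k)).

Lemma tau_angle v : exists a : angle C, val a = tau v.
Proof.
apply: angleP; split; first exact: frac_itv.
by rewrite vertsE circ_frac; exists v.
Qed.

Lemma angle_tau (a : angle C) : exists v, tau v = val a.
Proof.
have [a01] := angle_valP a; rewrite vertsE => -[v _ /= va]; exists v.
by apply: circ_inj => //; [exact: frac_itv|rewrite circ_frac].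
Qed.

(** By [out_edge] every angle of [C] starts the arc of some edge, and arcs do not overlap, so no
    angle of [C] lies strictly inside the arc of [e]. *)
Lemma next_src e : e \notin F ->
  next_angle C (tau (src e)) = tau (src e) + l e.
Proof.
move=> eF; have l0 := weighting_gt0 F_weighting eF.
have cover_eq (b : angle C) : 1 <= covers e (val b) -> tau (src e) = val b.
  move=> eb; have [v vb] := angle_tau b;
    have [e' e'F /tau_connect ve'] := out_edge v.
  rewrite -vb ve'; congr (tau (src _)).
  apply: (@covers_uniq _ _ (val b)); rewrite ?notin_generator //.
  apply: covers_arc; rewrite -vb ve' ?lexx // ltrDl.
  exact: weighting_gt0 F_weighting e'F.
apply/eqP; rewrite eq_le; apply/andP; split.
  rewrite dst_wrap; have [w0|w1] := wrap_cases e.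
    have [b bE] := tau_angle (dst e); rewrite w0 addr0 -bE;
      apply: next_angle_le.
    by rewrite bE -[X in _ < X]addr0 -w0 -dst_wrap ltrDl.
  by apply: le_trans (next_angle_le1 _ _) _; rewrite w1 lerDr tau_ge0.
rewrite leNgt; apply/negP => lt.
have [N1|[b bE sb]] := next_angle_cases C (tau (src e)).
  (* Here the arc would run past the base point, so 0 lies on it and must be its start; then [e]
     would be longer than 1. *)
  rewrite N1 dst_wrap in lt; have [w0|w1] := wrap_cases e.
    by move: lt; rewrite w0 addr0 ltNge ltW ?tau_lt1.
  have s0 : tau (src e) = 0.
    rewrite -(zero_angleE n_gt0 C); apply: cover_eq; rewrite zero_angleE.
    by apply: covers_wrap => //; move: lt; rewrite w1; lra.
  move: lt; rewrite -dst_wrap s0 add0r ltNge; apply/negP/negPn.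
  exact: weight_le1.
have := cover_eq b; rewrite bE in lt => /(_ (covers_arc (ltW sb) lt)) sE.
by move: sb; rewrite sE ltxx.
Qed.

(** Components go to the position of their vertices, edges to the position of their source.
    Components with equal positions have outgoing edges starting at the same angle, hence share that
    edge. *)
Lemma tiling_isometric :
  isometric (contract (reweight G l) F) (polygon n_gt0 C).
Proof.
have [ang angE] := choice tau_angle.
have [sec secP] := choice (@to_contract_surj _ _ _ _ (reweight G l) F).
pose f c := ang (sec c).
have tau_sec v : tau (sec (to_contract (reweight G l) F v)) = tau v.
  by apply/tau_connect/(to_contract_eq (reweight G l) F)/secP.
have fE v : f (to_contract (reweight G l) F v) = ang v.
  by apply: val_inj; rewrite !angE tau_sec.
pose g (e : contract_edge F) := ang (src (val e)).
have nextE e : e \notin F -> next_vertex n_gt0 (ang (src e)) = ang (dst e).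
  move=> eF; apply: val_inj; rewrite next_vertexE !angE next_src // dst_wrap.
  have [w0|w1] := wrap_cases e;
    first by rewrite w0 addr0 lt_eqF ?tau_lt1 // subr0.
  have : next_angle C (tau (src e)) <= 1 := next_angle_le1 _ _.
  rewrite next_src // dst_wrap w1 => d0.
  have -> : tau (dst e) = 0 by have := tau_ge0 (dst e); lra.
  by rewrite add0r eqxx subrr.
exists f, g; split.
- apply: inj_surj_bij => [c c' cc'|a]; last first.
    have [v va] := angle_tau a; exists (to_contract (reweight G l) F v).
    by rewrite fE; apply: val_inj; rewrite angE.
  have [u uc] := to_contract_surj c; have [v vc] := to_contract_surj c'.
  move: cc'; rewrite -uc -vc !fE => /(congr1 val); rewrite !angE => uv.
  have [e eF ue] := out_edge u; have [e' e'F ve'] := out_edge v.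
  have ee' : e = e'.
    by apply: src_inj => //; rewrite -(tau_connect ue) -(tau_connect ve').
  apply/to_contract_eq; apply: (connect_trans ue); rewrite ee'.
  by rewrite (connectC G F).
- apply: inj_surj_bij => [e e' /(congr1 val)|a].
    by rewrite !angE => /(src_inj (valP e) (valP e'))/val_inj.
  have [v va] := angle_tau a; have [e eF ve] := out_edge v.
  exists (exist _ e eF); apply: val_inj; rewrite /g angE /=.
  by rewrite -(tau_connect ve).
- move=> e; rewrite /joins /= !fE /g nextE ?(valP e) //.
  rewrite /src /dst -/(head G (val e)) -/(tail G (val e)).
  by case: ifP; rewrite eqxx ?orbT.
- move=> e; rewrite -[LHS]/(len (reweight G l) (val e)) (len_reweight _
  F_weighting) ?(valP e) //.
  by rewrite /= angE next_src ?(valP e) // addrAC subrr add0r.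
- move=> k; rewrite -[mark (contract _ _) k]/(to_contract (reweight G l) F
  (mark G k)) fE.
  apply: val_inj; apply: circ_inj.
  + by have [] := angle_valP (mark (polygon n_gt0 C) k).
  + by have [] := angle_valP (ang (mark G k)).
  + by rewrite polygon_mark posE angE circ_frac.
Qed.

End NextVertex.
End Tiling.

Lemma polygon_isometric (R : realType) (n : nat) (n_gt0 : (0 < n)%N)
    (V E : finType) (G : mgraph R n V E) z l F C :
    connected_graph G -> generator G z -> weighting F l ->
    (forall e, z e = 0 -> e \in F) -> circumference z l = 1 -> cycle_of G l C ->
  isometric (contract (reweight G l) F) (polygon n_gt0 C).
Proof.
move=> Gc zg wFl zF L1 [z' [th [zg' thc vE pE]]].
apply: (@tiling_isometric _ _ _ _ _ z' _ _ th) => //.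
  by move=> e z0; apply: zF; apply/eqP;
    rewrite -sqrf_eq0 (generator_sqr e zg' zg) z0 expr0n.
by rewrite (generator_circumference l zg zg').
Qed.

(** * From cycles to graphs *)

Section Realization.
Context {R : realType} {n : nat}.
Hypothesis n_gt0 : (0 < n)%N.

Definition realize (x : X R n) : MG R n :=
  projT1 (cid (represents_exists (polygon_genus1 n_gt0 (repr x)))).

Lemma reweight_len (V E : finType) (G : mgraph R n V E) :
  isometric G (reweight G (len G)).
Proof.
exists id, id; split=> //; [by exists id|by exists id| |].
  by move=> e; exact: joins_tail_head.
by move=> e; rewrite /= /new_len len_gt0.
Qed.

(** [realize] is defined by the polygon of a chosen representative; this reads it off any graph
    whose weights vanish on the bridges, the form needed on a common expansion. *)
Lemma represents_realize (V E : finType) (G : mgraph R n V E) z l F C :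
    connected_graph G -> generator G z -> weighting F l ->
    (forall e, z e = 0 -> e \in F) -> circumference z l = 1 -> cycle_of G l C ->
  represents (contract (reweight G l) F) (realize (\pi_(X R n) C)).
Proof.
move=> Gc zg wFl zF L1 GC.
set C' := repr (\pi_(X R n) C).
have CC' : same_cycle C C'.
  by have /eqmodP/asboolP : \pi_(X R n) C = \pi_(X R n) C' by rewrite reprK.
have GC' := cycle_of_same CC' GC.
have := projT2 (cid (represents_exists (polygon_genus1 n_gt0 C'))).
move=> /represents_isometric; apply.
exact/isometric_sym/(polygon_isometric n_gt0 Gc zg wFl zF L1 GC').
Qed.

Lemma realizeE C : represents (polygon n_gt0 C) (realize (\pi_(X R n) C)).
Proof.
have := represents_realize (@polygon_connected _ _ n_gt0 C) (polygon_generator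
  n_gt0 C)
  (weighting_len (polygon n_gt0 C)) _ _ (polygon_self n_gt0 C).
move=> /(_ _ _)/represents_isometric; apply.
- by move=> e /eqP; rewrite oner_eq0.
- exact: (@polygon_circumference _ _ n_gt0 C id).
apply: isometric_trans (isometric_sym (contract_set0 _)) _.
exact/isometric_sym/reweight_len.
Qed.

(** Weights are built on polygons, while [MG] is made of graphs on ordinals; this carries over what
    [represents_near] and [represents_realize] ask for. *)
Lemma transport_weights (V E V' E' : finType) (G : mgraph R n V E)
    (H : mgraph R n V' E') z l F :
    isometric G H -> generator G z -> weighting F l ->
  exists z' l' (F' : {set E'}),
    [/\ generator H z', weighting F' l',
      circumference z' l' = circumference z l &
      [/\ forall C, cycle_of G l C -> cycle_of H l' C,
          \sum_e `|l' e - len H e| = \sum_e `|l e - len G e|,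
          (forall e, z e = 0 -> e \in F) -> (forall e, z' e = 0 -> e \in F') &
          forest G F -> forest H F']].
Proof.
move=> [f [g [bf bg j len_eq m]]] zg wFl.
have [g' gK g'K] := bg; have [z' zg' z'g] := iso_generator bf bg j zg.
have z'0 e' : (z' e' == 0) = (z (g' e') == 0).
  rewrite -{1}(g'K e') z'g mulf_eq0.
  by have [->|->] := iso_signN G H f g (g' e'); rewrite ?oppr_eq0 oner_eq0.
pose F' := [set e' | g' e' \in F].
exists z', (l \o g'), F'; split=> //.
- by move=> e'; rewrite inE; exact: wFl.
- rewrite /circumference (reindex g) /=; last exact: onW_bij.
  by apply: eq_bigr => e _;
    rewrite gK z'g exprMn [iso_sign _ _ _ _ _ ^+ 2]expr2 iso_sign2 mul1r.
split.
- move=> C; apply: (cycle_of_iso bf bg j m) => e /=.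
  by rewrite gK.
- rewrite (reindex g) /=; last exact: onW_bij.
  by apply: eq_bigr => e _; rewrite gK len_eq.
- by move=> zF e' /eqP; rewrite z'0 inE => /eqP/zF.
- move=> /(forest_generator _ zg)[e ze eF]; apply/(forest_generator _ zg').
  by exists (g e); [rewrite z'0 gK|rewrite inE gK].
Qed.

(** * Snapping angles to the vertices of a nearby cycle *)

Section Snap.
Variables (C D : cycle_graph R n) (eta : R).
Hypotheses (eta_gt0 : 0 < eta) (eta_gap :
  forall a : angle C, 2 * eta <= next_angle C (val a) - val a).

(** The base point occurs twice, as 0 through [zero_angle] and as 1, so that angles just below 1 can
    be snapped upwards. *)
Definition node s := s = 1 \/ exists a : angle C, val a = s.

Lemma node_le1 s : node s -> s <= 1.
Proof. by case=> [->//|[a <-]]; apply/ltW/angle_lt1. Qed.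

Lemma node0 : node 0.
Proof. by right; exists (zero_angle n_gt0 C); exact: zero_angleE. Qed.

Lemma node_gap s s' : node s -> node s' -> s < s' -> s + 2 * eta <= s'.
Proof.
move=> Ns Ns' ss'; case: Ns => [s1|[a aE]].
  by have := node_le1 Ns'; rewrite leNgt -s1 ss'.
have := eta_gap a; suff : next_angle C (val a) <= s' by rewrite aE; lra.
case: Ns' => [->|[b bE]]; first exact: next_angle_le1.
by rewrite -bE; apply: next_angle_le; rewrite aE bE.
Qed.

Definition snap t : R := xget t [set s | node s /\ `|s - t| < eta]%classic.

(** Distinct nodes are at least [2 * eta] apart, so at most one is within [eta] of [t]. *)
Lemma snapE s t : node s -> `|s - t| < eta -> snap t = s.
Proof.
move=> Ns st; rewrite /snap; case: xgetP => [s' _ [Ns' s't]|/(_ s)];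
  last by case.
move: st s't; rewrite !ltr_distl => /andP[h1 h2] /andP[h3 h4].
case: (ltgtP s' s) => // lt.
  by have := node_gap Ns' Ns lt; lra.
by have := node_gap Ns Ns' lt; lra.
Qed.

Lemma snap_self s : node s -> snap s = s.
Proof. by move=> Ns; apply: snapE; rewrite // subrr normr0. Qed.

Lemma snap_homo t t' : node (snap t) -> `|snap t - t| < eta ->
  node (snap t') -> `|snap t' - t'| < eta -> t <= t' -> snap t <= snap t'.
Proof.
rewrite !ltr_distl => N /andP[h1 h2] N' /andP[h3 h4] tt'.
by rewrite leNgt; apply/negP => lt; have := node_gap N' N lt; lra.
Qed.

Lemma circ_node s : node s -> verts C (circ s).
Proof.
case=> [->|[a <-]]; last by have [] := angle_valP a.
rewrite -[1]add0r circD1 circ0 -(pos_first C (k := Ordinal n_gt0)) //.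
exact: pos_verts.
Qed.

(* Both ends of [0, 1] represent the base point, which no other node of [C]
   approaches. *)
Lemma near_node t (b : angle D) : verts C (circ t) -> `|t - val b| < eta ->
  node t.
Proof.
move=> Ct; rewrite ltr_distl => /andP[h1 h2].
have b0 := angle_ge0 b; have b1 := angle_lt1 b.
have [a aE] := vert_angle Ct.
have a0 := angle_ge0 a; have a1 := angle_lt1 a.
have ta : t - val a \is a Num.int by apply/circ_eq.
have Na : node (val a) by right; exists a.
have N1 : node 1 by left.
have etale : 2 * eta <= 1.
  by have := node_gap node0 N1 ltr01; rewrite add0r.
have [t0|t0] := ltP t 0.
  have : t - val a + 1 = 0.
    apply: int_lt1; first by rewrite rpredD // rpred1.
    by rewrite ltr_norml; apply/andP; split; lra.
  by have := node_gap Na N1 a1; lra.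
have [t1|t1] := ltP t 1.
  have : t - val a = 0 by apply: int_lt1 => //; rewrite ltr_norml; apply/andP;
    split; lra.
  by move/eqP; rewrite subr_eq0 => /eqP ->.
have : t - val a - 1 = 0.
  apply: int_lt1; first by rewrite rpredB // rpred1.
  by rewrite ltr_norml; apply/andP; split; lra.
have [a00|a00] := eqVneq (val a) 0; first by rewrite a00 => tE; left; lra.
have : 0 < val a by rewrite lt_def a00.
by move=> /(node_gap node0 Na); lra.
Qed.

End Snap.

(** [F] may have any number of edges, so adding up [eta] over them is useless. Since both weights
    have the same sum, the mass of [l'] on [F] is compensated outside [F], where there are at most
    [N] edges. *)
Lemma sum_weight_dist (E : finType) (F : {set E}) (l l' : E -> R) eta (N : nat)
  :
    (forall e, e \in F -> l e = 0) -> (forall e, 0 <= l' e) ->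
    \sum_e l e = \sum_e l' e -> (forall e, `|l e - l' e| <= eta) ->
    (#|[set e | e \notin F]| <= N)%N -> 0 <= eta ->
  \sum_e `|l e - l' e| <= 2 * eta * N%:R.
Proof.
move=> lF l'0 ll' dl FN eta0.
pose D := \sum_(e | e \notin F) `|l e - l' e|.
have DN : D <= eta * N%:R.
  apply: le_trans (_ : \sum_(e | e \notin F) eta <= _); first exact: ler_sum.
  rewrite sumr_const -[leLHS]mulr_natr ler_wpM2l // ler_nat (leq_trans _ FN) //.
  by rewrite cardsE.
have inF : \sum_(e in F) `|l e - l' e| = \sum_(e | e \notin F) (l e - l' e).
  rewrite (eq_bigr l') => [|e eF]; last by rewrite lF // sub0r normrN ger0_norm.
  move: ll'; rewrite (bigID (mem F)) /= big1 // add0r [in RHS](bigID (mem F))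
    /=.
  by rewrite sumrB => ->; rewrite addrK.
have FD : \sum_(e in F) `|l e - l' e| <= D.
  by rewrite inF; apply: ler_sum => e _; exact: ler_norm.
by rewrite (bigID (mem F)) /= -/D; lra.
Qed.

Lemma gap_exists (C : cycle_graph R n) : exists2 d, 0 < d &
  forall a : angle C, d <= next_angle C (val a) - val a.
Proof.
exists (\big[Num.min/1]_(a : angle C) (next_angle C (val a) - val a)).
  by apply: lt_bigmin => // a _; exact: gap_gt0.
by move=> a; exact: bigmin_le.
Qed.

Lemma continuous_realize : continuous realize.
Proof.
apply: (continuous_criterion open_XP) => x V oV Vx.
have [e e0 eV] := (open_MGP V).1 oV _ Vx.
set C := repr x; have xC : x = \pi_(X R n) C by rewrite reprK.
have [g g0 gap] := gap_exists C.
pose N := (#|angle C|).+1; have N0 : 0 < N%:R :> R by rewrite ltr0n.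
(* [g / 2] keeps nodes [2 * eta] apart. Each end of an edge moves by less than [eta], so
   [sum_weight_dist] bounds the total by [4 * eta * #|angle C|], which is below [e]. *)
pose eta := Num.min (g / 2) (e / (8 * N%:R)).
have eta0 : 0 < eta by rewrite lt_min !divr_gt0 // mulr_gt0.
have eta_gap (a : angle C) : 2 * eta <= next_angle C (val a) - val a.
  apply: le_trans (gap a); have : eta <= g / 2 by rewrite ge_min lexx.
  by lra.
have [d d0 dP] := circle_close_circ eta0.
exists (d / 2); first by rewrite divr_gt0.
move=> y /X_near_repr[H -> [c1 c2 c3]]; apply: eV.
have close p q : circle_close (d / 2) p q -> circle_close d p q.
  by apply: circle_closeS; rewrite ler_pdivrMr // ler_pMr // ler1n.
have close_sym p q : circle_close (d / 2) p q -> circle_close d q p.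
  by move/circle_close_sym; rewrite divfK.
pose s := snap C eta.
have sP (b : angle H) p : verts C p -> circle_close d (circ (val b)) p ->
    [/\ circ (s (val b)) = p, node C (s (val b)) & `|s (val b) - val b| < eta].
  move=> Cp /dP[t pE tb]; rewrite pE in Cp.
  have Nt := near_node eta_gap Cp tb.
  by rewrite /s (snapE eta_gap Nt tb).
have sb (b : angle H) : node C (s (val b)) /\ `|s (val b) - val b| < eta.
  have [a Ca ba] := c2 _ (angle_valP b).2.
  by have [] := sP b a Ca (close _ _ ba).
have s0 : s 0 = 0 by apply/(snap_self eta0 eta_gap)/node0.
have s1 : s 1 = 1 by apply: (snap_self eta0 eta_gap); left.
have snext (b : angle H) : node C (s (next_angle H (val b))) /\
    `|s (next_angle H (val b)) - next_angle H (val b)| < eta.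
  have [->|[b' -> _]] := next_angle_cases H (val b); last exact: sb.
  by rewrite s1 subrr normr0; split=> //; left.
(* The cycle [C] as a weight on the polygon of [H]: vertices snapped to the same node are joined by
   edges of weight 0, and the edges that survive correspond to those of the polygon of [C]. *)
pose l (b : angle H) := s (next_angle H (val b)) - s (val b).
pose F := [set b | l b == 0].
have wFl : weighting F l.
  move=> b; rewrite inE subr_ge0; split=> //.
  have [N1 h1] := sb b; have [N2 h2] := snext b.
  apply: (snap_homo eta_gap) => //.
  exact/ltW/next_angle_gt/angle_lt1.
have lC : cycle_of (polygon n_gt0 H) l C.
  apply: polygon_cycle_of => // [|k].
    apply/seteqP; split=> [p Cp|_ [b _ <-]]; last first.
      by apply: circ_node; have [] := sb b.
    have [q Hq pq] := c3 _ Cp; have [b bE] := vert_angle Hq.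
    exists b => //; have [] // := sP b p Cp; rewrite bE; exact: close_sym.
  have [] // := sP (mark (polygon n_gt0 H) k) (pos C k) (pos_verts C k).
  by rewrite polygon_mark; exact: close_sym.
have L1 : circumference (fun=> 1) l = 1 by exact: polygon_circumference.
have zF : forall e : angle H, (1 : R) = 0 -> e \in F.
  by move=> b /eqP; rewrite oner_eq0.
have pg := polygon_generator n_gt0 H.
have Ff : forest (polygon n_gt0 H) F.
  apply/(forest_generator _ pg); apply: contrapT => none.
  have := L1; rewrite /circumference big1 => [/eqP|b _];
    first by rewrite eq_sym oner_eq0.
  rewrite expr1n mul1r; apply: (weighting_eq0 wFl); apply/negPn/negP => bF.
  by apply: none; exists b; rewrite ?oner_eq0.
have small : \sum_b `|l b - len (polygon n_gt0 H) b| < e.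
  apply: le_lt_trans (_ : 2 * (2 * eta) * #|angle C|%:R < _).
    apply: (@sum_weight_dist _ F) => [b|b||b||].
    - exact: weighting_eq0.
    - exact/ltW/len_gt0.
    - by rewrite (sum_gap n_gt0 H s) (sum_gap n_gt0 H id) s0 s1.
    - have [_ h1] := sb b; have [_ h2] := snext b.
      rewrite -[len _ b]/(next_angle H (val b) - val b) /l; move: h1 h2;
        rewrite !ltr_distl => /andP[h1 h2] /andP[h3 h4].
      by rewrite ler_distl; apply/andP; split; lra.
    - have [f [h [_ bh _ _ _]]] := polygon_isometric n_gt0
        (@polygon_connected _ _ n_gt0 H) pg wFl zF L1 lC.
      by rewrite -(bij_eq_card bh) card_sig cardsE.
    - by rewrite mulr_ge0 // ltW.
  have : eta * (8 * N%:R) <= e.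
    by rewrite -ler_pdivlMr ?mulr_gt0 // ge_min lexx orbT.
  have : (#|angle C|%:R : R) < N%:R by rewrite ltr_nat.
  have : 0 <= (#|angle C|%:R : R) by rewrite ler0n.
  by nra.
have [K -> HK] := realizeE H.
have [z' [l' [F' [zg' wFl' L1' [cl dl zF' ff]]]]] :=
  transport_weights HK pg wFl.
apply: (represents_near wFl' (ff Ff)); last by rewrite dl.
rewrite xC; apply: (represents_realize _ zg' wFl' (zF' zF)).
- exact: genus1_connected.
- by rewrite L1'.
- exact: cl.
Qed.

End Realization.

(** * Shrinking the bridges *)

Section Shrinking.
Context {R : realType} {n : nat}.
Hypothesis n_gt0 : (0 < n)%N.

(* The factor on the cycle is chosen so that its length [L] becomes
   [1 - s + s L]. *)
Definition shrink (E : finType) (z l : E -> R) (s : R) (e : E) : R :=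
  (z e ^+ 2 * ((1 - s) / circumference z l) + s) * l e.

Lemma shrink1 (E : finType) (z l : E -> R) : shrink z l 1 = l.
Proof. by apply/funext => e; rewrite /shrink subrr mul0r mulr0 add0r mul1r. Qed.

Section Weights.
Context {V E : finType} (G : mgraph R n V E) (z l : E -> R).
Hypotheses (zg : generator G z) (L0 : 0 < circumference z l).

Lemma generator_pow4 e : z e ^+ 2 * z e ^+ 2 = z e ^+ 2.
Proof. by have [/(_ e)[->|->] _ _ _] := zg; rewrite ?mulr1 // expr0n mulr0. Qed.

Lemma shrink_factor_ge0 s e : 0 <= s <= 1 ->
  0 <= z e ^+ 2 * ((1 - s) / circumference z l) + s.
Proof.
move=> /andP[s0 s1]; rewrite addr_ge0 // mulr_ge0 ?sqr_ge0 // divr_ge0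
  ?subr_ge0 //.
exact: ltW.
Qed.

Lemma shrink_factor_gt0 s e : 0 < s <= 1 ->
  0 < z e ^+ 2 * ((1 - s) / circumference z l) + s.
Proof.
move=> /andP[s0 s1]; rewrite ltr_wpDl // mulr_ge0 ?sqr_ge0 // divr_ge0
  ?subr_ge0 //.
exact: ltW.
Qed.

Lemma weighting_shrink F s : weighting F l -> 0 < s <= 1 ->
  weighting F (shrink z l s).
Proof.
move=> wFl s01 e; have [l0 lF] := wFl e; have f0 := shrink_factor_gt0 e s01.
by rewrite mulr_ge0 ?(ltW f0) // mulf_eq0 (gt_eqF f0).
Qed.

Lemma circumference_shrink0 : circumference z (shrink z l 0) = 1.
Proof.
rewrite -[RHS](divff (lt0r_neq0 L0)) {2}/circumference mulr_suml.
apply: eq_bigr => e _; rewrite /shrink subr0 div1r addr0 mulrA mulrA.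
by rewrite generator_pow4 mulrAC.
Qed.

Lemma cycle_of_shrink0 C : cycle_of G l C -> cycle_of G (shrink z l 0) C.
Proof.
move=> [z' [th [zg' thc vE pE]]]; exists z', th; split=> // e.
rewrite (generator_circumference (shrink z l 0) zg zg') circumference_shrink0
  divr1.
have -> : z' e * shrink z l 0 e = z' e * l e / circumference z' l;
  last exact: thc.
rewrite (generator_circumference l zg zg') /shrink subr0 div1r addr0.
have [/(_ e)[z0|z2] _ _ _] := zg'; first by rewrite z0 !mul0r.
by rewrite -(generator_sqr e zg zg') z2; ring.
Qed.

(** The cycle part of [shrink] is [(1 - s) * z e] times a slope, so [slope_dist] controls it. A
    change of [s] acts on slopes of total size 1 and on the lengths [l], whence the factor
    [1 + \sum_e l e]. *)
Lemma shrink_dist (l' : E -> R) s s' :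
    0 < circumference z l' -> (forall e, 0 <= l e) -> (forall e, 0 <= l' e) ->
    0 <= s <= 1 -> 0 <= s' <= 1 ->
  \sum_e `|shrink z l s e - shrink z l' s' e| <=
  (2 / circumference z l + 1) * (\sum_e `|l e - l' e|) +
  `|s - s'| * (1 + \sum_e l e).
Proof.
move=> L'0 l0 l'0 /andP[s0 s1] /andP[s'0 s'1].
move: (slope_dist zg L0 L'0 l'0) (L0) (L'0).
set L := circumference z l; set L' := circumference z l'.
set D := \sum_e `|l e - l' e|; set T := \sum_e l e => slope Lp L'p.
apply: le_trans (_ : \sum_e (`|z e * l e / L - z e * l' e / L'| +
   `|s - s'| * (z e ^+ 2 * l' e / L') + (`|l e - l' e| + `|s - s'| * l e)) <=
     _).
  apply: ler_sum => e _; rewrite /shrink -/L -/L'.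
  have -> : (z e ^+ 2 * ((1 - s) / L) + s) * l e -
      (z e ^+ 2 * ((1 - s') / L') + s') * l' e =
      z e * ((1 - s) * (z e * l e / L - z e * l' e / L')) +
      (s' - s) * (z e ^+ 2 * l' e / L') + (s' * (l e - l' e) + (s - s') * l e).
    by rewrite expr2; field; rewrite !gt_eqF.
  have z1 : `|z e| <= 1 by rewrite (generator_norm e zg) (generator_sqr_le1 zg).
  apply: le_trans (ler_normD _ _) _; apply: lerD.
    apply: le_trans (ler_normD _ _) _; apply: lerD.
      rewrite normrM; apply: le_trans (ler_piMl (normr_ge0 _) z1) _.
      rewrite normrM ger0_norm ?subr_ge0 // ler_piMl //; lra.
    by rewrite normrM distrC (ger0_norm (_ : 0 <= _ / L')) // divr_ge0 ?(ltW
      L'p) //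
      mulr_ge0 ?sqr_ge0.
  apply: le_trans (ler_normD _ _) _; apply: lerD.
    by rewrite normrM (ger0_norm s'0) ler_piMl.
  by rewrite normrM (ger0_norm (l0 e)).
rewrite !big_split /= -!mulr_sumr -mulr_suml -/D -/T -[X in _ * (X / _)]/L'.
rewrite divff ?gt_eqF // mulr1.
have -> : (2 / L + 1) * D + `|s - s'| * (1 + T) =
  2 * D / L + `|s - s'| + (D + `|s - s'| * T) by ring.
by rewrite !lerD2r.
Qed.

End Weights.

Lemma genus1_reweight (V E : finType) (G : mgraph R n V E) l :
  genus1 G -> genus1 (reweight G l).
Proof. by []. Qed.

Definition repr_generator (x : MG R n) :=
  projT1 (cid (genus1_generator (genus1_graph_genus1 (repr x)))).

(** At [s = 0] the bridges have weight 0 and the edge set changes, so this value needs its own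
    definition. *)
Definition shrink_graph (x : MG R n) (s : R) : MG R n :=
  if 0 < s then projT1 (cid (represents_exists (genus1_reweight
    (shrink (@repr_generator x) (len (repr x)) s) (genus1_graph_genus1 (repr
      x)))))
  else realize n_gt0 (positions n_gt0 x).

Lemma shrink_graphE (V E : finType) (G : mgraph R n V E) x z s :
    represents G x -> generator G z -> 0 < s ->
  represents (reweight G (shrink z (len G) s)) (shrink_graph x s).
Proof.
move=> Gx zg s0; rewrite /shrink_graph s0.
have := projT2 (cid (represents_exists (genus1_reweight
  (shrink (@repr_generator x) (len (repr x)) s) (genus1_graph_genus1 (repr
    x))))).
move=> /represents_isometric; apply; apply: isometric_sym.
have zg0 : generator (repr x) (@repr_generator x) :=
  projT2 (cid (genus1_generator (genus1_graph_genus1 (repr x)))).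
have LE : circumference (@repr_generator x) (len (repr x)) = circumference z
  (len G).
  by rewrite (cycle_lengthE Gx zg) (cycle_lengthE (represents_repr x) zg0).
have [f [g [bf bg j l m]]] := represents_uniq Gx (represents_repr x).
have [z' zg' z'g] := iso_generator bf bg j zg.
exists f, g; split=> // e; rewrite /= /new_len.
have -> // : shrink z (len G) s e = shrink (@repr_generator x) (len (repr x)) s
  (g e).
rewrite /shrink LE l (generator_sqr (g e) zg' zg0) z'g exprMn.
by rewrite [iso_sign _ _ _ _ _ ^+ 2]expr2 iso_sign2 mul1r.
Qed.

Lemma shrink_graph0 x : shrink_graph x 0 = realize n_gt0 (positions n_gt0 x).
Proof. by rewrite /shrink_graph ltxx. Qed.

Lemma shrink_graph1 x : shrink_graph x 1 = x.
Proof.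
have [z zg] := genus1_generator (genus1_graph_genus1 (repr x)).
have := shrink_graphE (represents_repr x) zg ltr01; rewrite shrink1 => h.
apply: represents_inj h (represents_repr x) _.
exact/isometric_sym/reweight_len.
Qed.

Section OneGraph.
Variables (H : genus1_graph R n) (z l : 'I_(nedges H) -> R) (F : {set
  'I_(nedges H)}).
Variable x : MG R n.
Hypotheses (zg : generator H z) (Ff : forest H F) (wFl : weighting F l).
Hypothesis Hx : represents (contract (reweight H l) F) x.

Lemma weights_length_gt0 : 0 < circumference z l.
Proof. exact: circumference_gt0 zg Ff wFl. Qed.

Lemma represents_shrink_pos s : 0 < s <= 1 ->
  represents (contract (reweight H (shrink z l s)) F) (shrink_graph x s).
Proof.
move=> s01; have /andP[s0 s1] := s01.
have zgK : generator (contract (reweight H l) F) (z \o val).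
  exact: (@contract_generator _ _ _ _ (reweight H l)).
apply: represents_isometric (shrink_graphE Hx zgK s0) _.
have len_l (e : contract_edge F) : len (contract (reweight H l) F) e = l (val
  e).
  rewrite -[LHS]/(len (reweight H l) (val e)).
  by rewrite (len_reweight _ wFl) ?(valP e).
exists id, id; split=> //; [by exists id|by exists id| |].
  by move=> e; rewrite /joins /= eqxx.
move=> e; rewrite -[LHS]/(new_len _ e) -[RHS]/(new_len (shrink z l s) (val e)).
rewrite /new_len.
have -> // : shrink (z \o val) (len (contract (reweight H l) F)) s e =
  shrink z l s (val e).
by rewrite /shrink contract_circumference // len_l.
Qed.

(** One graph [H] carries the whole family: [s] changes the weights and, at [s = 0], adds the
    bridges to the contracted edges. These still form a forest, because the cycle keeps length 1. *)
Lemma represents_shrink s : 0 <= s <= 1 ->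
  exists F', [/\ forest H F', weighting F' (shrink z l s) &
    represents (contract (reweight H (shrink z l s)) F') (shrink_graph x s)].
Proof.
move=> /andP[]; rewrite le_eqVlt => /predU1P[<- _|s0 s1]; last first.
  exists F; split=> //; first by apply: weighting_shrink => //;
    [exact: weights_length_gt0|rewrite s0].
  by apply: represents_shrink_pos; rewrite s0.
have L0 := weights_length_gt0.
pose F' := [set e | shrink z l 0 e == 0].
have wF' : weighting F' (shrink z l 0).
  move=> e; rewrite inE; split=> //; apply: mulr_ge0; last by have [] := wFl e.
  by apply: (shrink_factor_ge0 L0); rewrite lexx ler01.
have L1 := circumference_shrink0 zg L0.
exists F'; split=> //.
  apply/(forest_generator _ zg); apply: contrapT => none.
  have := L1; rewrite /circumference big1 => [/eqP|e _];
    first by rewrite eq_sym oner_eq0.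
  have [->|ze] := eqVneq (z e) 0; first by rewrite expr0n mul0r.
  rewrite (weighting_eq0 wF') ?mulr0 //; apply/negPn/negP => eF.
  by apply: none; exists e.
have [C HC] := cycle_of_exists n_gt0 zg (lt0r_neq0 L0).
rewrite shrink_graph0 (positionsE n_gt0 Hx (cycle_of_contract Ff wFl HC)).
apply: (represents_realize n_gt0 _ zg wF') => //.
- exact: genus1_connected.
- by move=> e z0; rewrite inE /shrink z0 expr0n mul0r addr0 mul0r.
- exact: cycle_of_shrink0.
Qed.

End OneGraph.

Definition total_length (x : MG R n) : R := \sum_e len (repr x) e.

Lemma total_lengthE (V E : finType) (G : mgraph R n V E) x :
  represents G x -> \sum_e len G e = total_length x.
Proof.
move=> Gx; have [f [g [bf bg j l m]]] := represents_uniq Gx (represents_repr x).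
rewrite /total_length [RHS](reindex g) /=; last exact: onW_bij.
by apply: eq_bigr => e _.
Qed.

Lemma total_length_ge0 x : 0 <= total_length x.
Proof. by apply: sumr_ge0 => e _; exact/ltW/len_gt0. Qed.

Lemma contract_total_length (V E : finType) (G : mgraph R n V E) l F :
  weighting F l -> \sum_e len (contract (reweight G l) F) e = \sum_e l e.
Proof.
move=> wFl; rewrite [RHS](bigID (mem F)) /= [X in _ = X + _]big1 ?add0r;
  last first.
  by move=> e eF; rewrite (weighting_eq0 wFl eF).
rewrite -(sum_notin F l); apply: eq_bigr => e _ /=.
by rewrite -[new_len l _]/(len (reweight G l) (val e)) (len_reweight _ wFl)
  ?(valP e).
Qed.

(** For [s' > 0] the nearby graph keeps all edges of [H], so it is an expansion to which
    [represents_near] applies, even when [s = 0]. *)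
Lemma shrink_near x s V : 0 <= s <= 1 -> open V -> V (shrink_graph x s) ->
  exists2 r, 0 < r & forall y s', MG_near x r y -> `|s' - s| < r ->
    0 < s' <= 1 -> V (shrink_graph y s').
Proof.
move=> s01 oV Vx.
have [e e0 eV] := (open_MGP V).1 oV _ Vx.
have L0 := cycle_length_gt0 x; have T0 := total_length_ge0 x.
pose c := 2 / cycle_length x + 1; pose T := 1 + total_length x.
have c0 : 0 < c by rewrite addr_gt0 // divr_gt0.
have Tp : 0 < T by rewrite ltr_pwDl.
(* One half of [e] pays for the change of weights, with constant [c], the other for the change of
   time, with constant [T]. *)
have eta0 : 0 < e / 2 / c by rewrite !divr_gt0.
have [r r0 rP] := near_represents x eta0.
exists (Num.min r (e / 2 / T)); first by rewrite lt_min r0 !divr_gt0.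
move=> y s' xy ss' s'01.
have {}xy : MG_near x r y by apply: MG_nearS xy; rewrite ge_min lexx.
have {}ss' : `|s' - s| * T < e / 2.
  by rewrite -ltr_pdivlMr //; apply: lt_le_trans ss' _;
    rewrite ge_min lexx orbT.
have [H [F [l [-> Ff wFl Hx small]]]] := rP y xy.
have [z zg] := genus1_generator (genus1_graph_genus1 H).
have [F' [Ff' wF' HF']] := represents_shrink zg Ff wFl Hx s01.
have [Kc Kb] := genus1_reweight (shrink z (len H) s') (genus1_graph_genus1 H).
pose K := Genus1Graph Kc Kb.
have -> : shrink_graph (\pi_(MG R n) H) s' = \pi_(MG R n) K.
  have /andP[s'0 _] := s'01.
  apply: represents_inj (shrink_graphE (represents_pi H) zg s'0) (represents_pi
    K) _.
  exact: isometric_refl.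
apply: eV; apply: (@represents_near _ _ K F' (shrink z l s)) => //.
have L'0 := circumference_len_gt0 zg.
have LE : circumference z l = cycle_length x.
  rewrite -(contract_circumference H z wFl).
  by apply: (cycle_lengthE Hx);
    exact: (@contract_generator _ _ _ _ (reweight H l)).
have TE : \sum_e l e = total_length x.
  by rewrite -(contract_total_length H wFl) (total_lengthE Hx).
have lenK a : len K a = shrink z (len H) s' a.
  rewrite /= /new_len ifT // mulr_gt0 ?len_gt0 //.
  exact: shrink_factor_gt0 L'0 _ _ s'01.
under eq_bigr do rewrite lenK.
have s'01' : 0 <= s' <= 1 by move: s'01 => /andP[/ltW -> ->].
apply: le_lt_trans (shrink_dist zg (weights_length_gt0 zg Ff wFl) L'0 _ _ s01
  s'01') _.
- by move=> a; have [] := wFl a.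
- by move=> a; exact/ltW/len_gt0.
rewrite LE TE -/c -/T distrC.
have : c * (\sum_e0 `|l e0 - len H e0|) < e / 2 by rewrite mulrC -ltr_pdivlMr.
by lra.
Qed.

Notation I01 := `[0 : R, 1]%classic.

Lemma continuous_shrink :
  continuous (fun p : MG R n * I01 => shrink_graph p.1 (set_val p.2)).
Proof.
apply: (continuous_prod_criterion open_MGP MG_near_refl (@MG_nearS R n)) =>
  x t V oV /= Vx.
have t01 := itv_bounds t.
have [r r0 rP] := shrink_near t01 oV Vx.
have bound (t' : I01) : 0 < set_val t' -> 0 < set_val t' <= 1.
  by move=> -> /=; have /andP[] := itv_bounds t'.
have [t0|t0] := eqVneq (set_val t) 0; last first.
  have {}t0 : 0 < set_val t by rewrite lt_def t0; have /andP[] := t01.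
  exists (Num.min r (set_val t)); first by rewrite lt_min r0.
  move=> y t' xy tt'; apply: rP.
  - by apply: MG_nearS xy; rewrite ge_min lexx.
  - by apply: lt_le_trans tt' _; rewrite ge_min lexx.
  apply: bound; have : `|set_val t' - set_val t| < set_val t.
    by apply: lt_le_trans tt' _; rewrite ge_min lexx orbT.
  by rewrite ltr_distl subrr => /andP[].
(* Near time 0, positive times are covered by [shrink_near]; at time 0 itself the map is [realize]
   after [positions], whose continuity is already known. *)
rewrite t0 shrink_graph0 in Vx.
have rpc : continuous (@realize R n n_gt0 \o @positions R n n_gt0).
  move=> y.
  have := continuous_comp (@continuous_positions R n n_gt0 y)
    (@continuous_realize R n n_gt0 _).
  by [].
have oW : open ((realize n_gt0 \o positions n_gt0) @^-1` V)%classic.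
  by move/continuousP: rpc; apply.
have [r' r'0 rP'] := (open_MGP _).1 oW x Vx.
exists (Num.min r r'); first by rewrite lt_min r0.
move=> y t' xy tt'; have [t'0|t'0] := eqVneq (set_val t') 0.
  by rewrite t'0 shrink_graph0; apply: rP'; apply: MG_nearS xy;
    rewrite ge_min lexx orbT.
apply: rP.
- by apply: MG_nearS xy; rewrite ge_min lexx.
- by apply: lt_le_trans tt' _; rewrite ge_min lexx.
by apply: bound; rewrite lt_def t'0; have /andP[] := itv_bounds t'.
Qed.

End Shrinking.

(** * Stable graphs *)

Section Tropical.
Context {R : realType} {n : nat}.
Hypothesis n_gt0 : (0 < n)%N.

Definition stable (V E : finType) (G : mgraph R n V E) : Prop :=
  forall v, (3 <= valency G v + nmarks G v)%N.

Lemma isometric_stable (V E V' E' : finType) (G : mgraph R n V E)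
    (H : mgraph R n V' E') : isometric G H -> stable G -> stable H.
Proof.
move=> [f [g [bf bg j _ m]]] Gs w; have [f' fK f'K] := bf.
rewrite -(f'K w); move: (f' w) => v; apply: leq_trans (Gs v) _.
apply: leq_add.
  rewrite /valency [leqRHS](reindex g) /=; last exact: onW_bij.
  apply: leq_sum => e _; have /joins_ends := j e.
  by case=> ->; rewrite /= !(inj_eq (can_inj fK)) // addnC.
rewrite /nmarks subset_leq_card //; apply/fintype.subsetP => k; rewrite !inE m.
by move=> /eqP ->.
Qed.

Lemma TM_represents (V E : finType) (G : mgraph R n V E) x :
  represents G x -> @TM R n x <-> stable G.
Proof.
move=> Gx; split=> [xs|Gs K xK].
  apply: isometric_stable (isometric_sym (represents_uniq Gx (represents_repr
    x))) _.
  by apply: xs; rewrite reprK.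
apply: isometric_stable Gs; apply: represents_uniq Gx _; rewrite xK.
exact: represents_pi.
Qed.

Lemma polygon_stable C : (verts C `<=` marked C)%classic ->
  stable (@polygon R n n_gt0 C).
Proof.
move=> Cm a; rewrite -[3%N]/(2 + 1)%N; apply: leq_add.
  rewrite /valency big_split /= -[2%N]/(1 + 1)%N; apply: leq_add.
    by rewrite (bigD1 a) //= eqxx.
  have [p ap] : exists p, next_vertex n_gt0 p = a.
    by have [h _ hK] := injF_bij (@next_vertex_inj _ _ n_gt0 C); exists (h a).
  by rewrite (bigD1 p) //= ap eqxx.
have [a01 /Cm[k _ ka]] := angle_valP a.
rewrite /nmarks card_gt0; apply/set0Pn; exists k; rewrite inE.
apply/eqP/val_inj; apply: circ_inj => //; last by rewrite polygon_mark.
by have [] := angle_valP (mark (polygon n_gt0 C) k).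
Qed.

Lemma TM_realize x : unmark x = x -> @TM R n (realize n_gt0 x).
Proof.
rewrite -[x]reprK unmarkE; move: (repr x) => C <-.
by apply/(TM_represents (realizeE n_gt0 _))/polygon_stable.
Qed.

(** * Marks on the trees of a stable graph *)

Section UnmarkedComponent.
Context {V E : finType} (G : mgraph R n V E).
Variables (z l : E -> R) (F : {set E}) (th : V -> R) (v : V).
Hypotheses (G_connected : connected_graph G) (zg : generator G z).
Hypotheses (wFl : weighting F l) (zF : forall e, (e \in F) = (z e == 0)).
Hypothesis length1 : circumference z l = 1.
Hypothesis thc : coordinates G z l th.

Let D := [set u | connect (adj G F) v u].
Let S := [set e in F | tail G e \in D].

Let D_ends e : e \in F -> (tail G e \in D) = (head G e \in D).
Proof.
move=> eF; rewrite !inE; have te := connect_ends G eF; apply/idP/idP => h.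
  exact: connect_trans h te.
by apply: connect_trans h _; rewrite connectC.
Qed.

(* Otherwise the bridges inside the component carry a circulation. *)
Lemma component_edges : (#|S| < #|D|)%N.
Proof.
rewrite ltnNge; apply/negP => DS.
pose A (e : {e | e \in S}) (u : {u | u \in D}) : R :=
  (val u == head G (val e))%:R - (val u == tail G (val e))%:R.
have delta w : w \in D -> \sum_(u : {u | u \in D}) (val u == w)%:R = 1 :> R.
  move=> wD; rewrite (bigD1 (exist _ w wD)) //= eqxx big1 ?addr0 // => u uw.
  by rewrite -val_eqE /= in uw; rewrite (negbTE uw).
have [||e|x [e0 xe0] xA] := @nontrivial_relation R _ _ A (fun=> 1).
- by rewrite !card_sig.
- have vD : v \in D by rewrite inE connect0.
  by exists (exist _ v vD); rewrite oner_eq0.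
- have := valP e; rewrite inE => /andP[eF tD].
  under eq_bigr do rewrite mulr1.
  by rewrite sumrB !delta ?subrr // -D_ends.
pose y e := if insub e is Some e' then x e' else 0.
have yx e : y (val e) = x e by rewrite /y valK.
have y0 e : e \notin S -> y e = 0 by move=> eS; rewrite /y insubF //;
  apply/negbTE.
have [_ _ _ zgen] := zg.
have /zgen[c yc] : circulation G y.
  apply/circulationP => w; rewrite (bigID (mem S)) /= [X in _ + X]big1 ?addr0;
    last first.
    by move=> e /y0 ->; rewrite mul0r.
  have [wD|wD] := boolP (w \in D); last first.
    apply: big1 => e; rewrite inE => /andP[eF tD].
    have tw : (w == tail G e) = false by apply: contraNF wD => /eqP ->.
    have hw : (w == head G e) = false.
      by apply: contraNF wD => /eqP ->; rewrite -D_ends.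
    by rewrite tw hw subrr mulr0.
  rewrite -[RHS](xA (exist _ w wD)).
  rewrite -(sum_sig (fun e => e \in S)
    (fun e => y e * ((w == head G e)%:R - (w == tail G e)%:R))).
  by apply: eq_bigr => e _; rewrite yx.
have e0F : val e0 \in F by have := valP e0; rewrite inE => /andP[].
move: xe0; rewrite -yx yc; move: e0F; rewrite zF => /eqP ->.
by rewrite mulr0 eqxx.
Qed.

(** Stability would give an unmarked component with [d] vertices a valency sum of at least [3 * d],
    while its fewer than [d] bridges contribute 2 each and the cycle at most 2, in total at most
    [2 * d]. *)
Lemma component_marked : stable G -> exists k, tau th (mark G k) = tau th v.
Proof.
move=> Gs; apply: contrapT => unmarked.
have zF' e : z e = 0 -> e \in F by rewrite zF => ->.
have D0 u : u \in D -> nmarks G u = 0%N.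
  rewrite inE => vu; apply/eqP; rewrite cards_eq0; apply/eqP/setP => k;
    rewrite !inE.
  apply/negP => /eqP ku; apply: unmarked; exists k; rewrite ku; apply/esym.
  exact: (tau_connect zg wFl zF' length1 thc vu).
pose ins e := ((tail G e \in D) + (head G e \in D))%N.
have valD : (\sum_(u in D) valency G u = \sum_e ins e)%N.
  rewrite /valency exchange_big /=; apply: eq_bigr => e _.
  rewrite big_split /= /ins; congr (_ + _)%N.
    rewrite -[(ends G e).1]/(tail G e); move: (tail G e) => w.
    have [wD|wD] := boolP (w \in D).
      by rewrite (bigD1 w) //= eqxx big1 // => u /andP[_ /negbTE];
        rewrite eq_sym => ->.
    by rewrite big1 // => u uD; case: eqP => // wu; rewrite wu uD in wD.
  rewrite -[(ends G e).2]/(head G e); move: (head G e) => w.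
  have [wD|wD] := boolP (w \in D).
    by rewrite (bigD1 w) //= eqxx big1 // => u /andP[_ /negbTE];
      rewrite eq_sym => ->.
  by rewrite big1 // => u uD; case: eqP => // wu; rewrite wu uD in wD.
have le3 : (3 * #|D| <= \sum_(u in D) valency G u)%N.
  rewrite mulnC -sum_nat_const; apply: leq_sum => u uD.
  by have := Gs u; rewrite D0 // addn0.
have inF : (\sum_(e in F) ins e = 2 * #|S|)%N.
  rewrite mulnC -sum_nat_const (eq_bigr (fun e => (tail G e \in D) * 2)%N);
    last first.
    by move=> e eF; rewrite /ins -D_ends // addnn muln2.
  rewrite (bigID (fun e => tail G e \in D)) /= [X in (_ + X)%N]big1 ?addn0;
    last first.
    by move=> e /andP[_ /negbTE ->].
  by apply: eq_big => [e|e /andP[_ ->]]; rewrite ?inE ?mul1n.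
(* Only one arc starts at the position of the component; by conservation as many arcs end in the
   component as start there. *)
have srcD : (\sum_(e | e \notin F) (src G z e \in D) <= 1)%N.
  have [[e1 e1F e1D]|none] := pselect (exists2 e, e \notin F & src G z e \in D).
    rewrite (bigD1 e1) //= e1D big1 // => e /andP[eF ee1].
    apply/eqP; rewrite eqb0; apply: contra ee1 => eD; apply/eqP.
    apply: (src_inj zg wFl zF' length1 thc eF e1F).
    rewrite -(tau_connect zg wFl zF' length1 thc (_ : connect (adj G F) v _)).
      by apply: (tau_connect zg wFl zF' length1 thc); rewrite inE in e1D.
    by rewrite inE in eD.
  rewrite big1 // => e eF; apply/eqP; rewrite eqb0; apply/negP => eD.
  by apply: none; exists e.
have dstD : (\sum_(e | e \notin F) (dst G z e \in D) =
    \sum_(e | e \notin F) (src G z e \in D))%N.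
  apply/eqP; rewrite -(eqr_nat R) !natr_sum -subr_eq0 -sumrB.
  apply/eqP; rewrite -[RHS](flow_sum0 zg (fun u => (u \in D)%:R)).
  by apply: eq_bigl => e; rewrite zF.
have outF : (\sum_(e | e \notin F) ins e <= 2)%N.
  rewrite (eq_bigr (fun e => (src G z e \in D) + (dst G z e \in D))%N).
    by rewrite big_split /= dstD addnn -mul2n -[2%N in X in (_ <= X)%N]/(2 *
      1)%N leq_mul2l.
  by move=> e _; rewrite /ins /src /dst; case: ifP; rewrite // addnC.
have := component_edges; rewrite valD (bigID (mem F)) /= inF in le3.
move: (#|S|) (#|D|) outF le3 => s d; lia.
Qed.

End UnmarkedComponent.

Lemma TM_positions x : @TM R n x -> unmark (positions n_gt0 x) = positions
  n_gt0 x.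
Proof.
move=> xs; have [z zg] := genus1_generator (genus1_graph_genus1 (repr x)).
have L0 := circumference_len_gt0 zg.
have [C GC] := cycle_of_repr n_gt0 x.
rewrite (positionsE n_gt0 (represents_repr x) GC) unmarkE.
(* The weights at [s = 0] have circumference 1 and vanish exactly on the bridges, as
   [component_marked] requires, and they give the same cycle. *)
have [z' [th [zg' thc vE pE]]] := cycle_of_shrink0 zg L0 GC.
pose F := [set e | z' e == 0].
have wF : weighting F (shrink z (len (repr x)) 0).
  move=> e; rewrite inE -[z' e == 0]sqrf_eq0 (generator_sqr e zg zg') sqrf_eq0;
    split.
    by rewrite mulr_ge0 ?(shrink_factor_ge0 L0) ?lexx ?ler01 // ltW // len_gt0.
  rewrite mulf_eq0 [len _ _ == 0]gt_eqF ?len_gt0 // orbF addr0 mulf_eq0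
    sqrf_eq0.
  by rewrite subr0 div1r invr_eq0 (gt_eqF L0) orbF.
apply/eqmodP/asboolP; left; split=> //=; apply/seteqP; split=> [p|_ [k _ <-]];
  last first.
  exact: pos_verts.
rewrite vE => -[v _ <-].
have [||||||k kv] :=
    @component_marked _ _ (repr x) z' (shrink z (len (repr x)) 0) F th v.
- exact: zg'.
- exact: wF.
- by move=> e; rewrite inE.
- by rewrite (generator_circumference _ zg zg') (circumference_shrink0 zg L0).
- exact: thc.
- exact: (TM_represents (represents_repr x)).1 xs.
by exists k => //; rewrite pE -circ_frac -[frac _]/(tau th _) kv circ_frac.
Qed.

Lemma TM_shrink x s : 0 <= s <= 1 -> @TM R n x -> @TM R n (shrink_graph n_gt0 x
  s).
Proof.
move=> /andP[]; rewrite le_eqVlt => /predU1P[<- _ xs|s0 s1 xs].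
  by rewrite shrink_graph0; apply: TM_realize; exact: TM_positions.
have [z zg] := genus1_generator (genus1_graph_genus1 (repr x)).
apply/(TM_represents (shrink_graphE n_gt0 (represents_repr x) zg s0)).
exact: (TM_represents (represents_repr x)).1 xs.
Qed.

Lemma MG_homotopy_equivalent_TM : homotopy_equivalent R (MG R n) (@TM R n).
Proof.
pose core (x : MG R n) := realize n_gt0 (unmark (positions n_gt0 x)).
have core_TM x : @TM R n (core x) by apply: TM_realize; exact: unmark_idem.
have core_c : continuous core.
  move=> x; apply: (@continuous_comp _ _ _ (fun x => unmark (positions n_gt0 x))
    (@realize R n n_gt0)); last exact: continuous_realize.
  apply: (@continuous_comp _ _ _ (@positions R n n_gt0) (@unmark R n)).
    exact: continuous_positions.
  exact: continuous_unmark.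
pose f (x : MG R n) : @TM R n := SigSub (mem_set (core_TM x)).
exists f, set_val; split.
- by apply: continuous_to_sub; exact: core_c.
- exact: continuous_set_val.
- have H1 := homotopic_comp (@continuous_positions R n n_gt0)
    (@continuous_realize R n n_gt0) (unmark_homotopic n_gt0).
  apply: homotopic_trans H1 _;
    exists (fun p => shrink_graph n_gt0 p.1 (set_val p.2)).
  split=> [|x s s0|x s s1]; first exact: continuous_shrink.
    by rewrite /= s0 shrink_graph0.
  by rewrite /= s1 shrink_graph1.
have sub_TM (p : @TM R n * `[0 : R, 1]%classic) :
    @TM R n (shrink_graph n_gt0 (set_val p.1) (set_val p.2)).
  by apply: TM_shrink; [exact: itv_bounds|exact: set_valP].
exists (fun p => SigSub (mem_set (sub_TM p))); split=> [|x s s0|x s s1].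
- apply: continuous_to_sub => p.
  apply: (@continuous_comp _ _ _ (fun p : @TM R n * `[0 : R, 1]%classic =>
    (set_val p.1, p.2)) (fun p : MG R n * `[0 : R, 1]%classic =>
    shrink_graph n_gt0 p.1 (set_val p.2))); last exact: continuous_shrink.
  apply: continuous_pair; last by move=> q; exact: cvg_snd.
  move=> q; apply: (@continuous_comp _ _ _ (fun p : @TM R n * `[0 : R,
    1]%classic => p.1)
    set_val); [exact: cvg_fst|exact: continuous_set_val].
- apply: val_inj => /=; rewrite s0 shrink_graph0 /core TM_positions //.
  exact: set_valP.
- by apply: val_inj => /=; rewrite s1 shrink_graph1.
Qed.

End Tropical.

Theorem theorem3p2 (R : realType) (n : nat) (n_gt0 : (0 < n)%N) :
  deformation_retraction (@Y R n) (@Phi R n) /\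
  homotopy_equivalent R (X R n) (@Y R n) /\
  homotopy_equivalent R (MG R n) (@TM R n).
Proof.
split; first exact: Phi_retraction.
by split; [exact: X_homotopy_equivalent_Y|exact: MG_homotopy_equivalent_TM].
Qed.
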